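(* Let $r\in\mathbb{N}^{+}\cup\{\infty,a\}$ and consider the autonomous system $$\dot{x}=Ax+f_{0}(x)+\epsilon f_{1}(x;\epsilon),\qquad f_{0}(x)=\mathcal{O}(|x|^{2}),\qquad 0\le\epsilon\ll 1,$$ where $A\in\mathbb{R}^{N\times N}$, $\mathcal{U}\subset\mathbb{R}^{N}$ is an open set containing $0$, and $f_{0},f_{1}$ are $\mathbb{R}^{N}$-valued functions of class $C^{r}$ in their arguments ($f_0$ in $x\in\mathcal{U}$, $f_1$ in $x\in\mathcal{U}$ and the parameter $\epsilon$). Assume that all eigenvalues $\lambda_{1},\dots,\lambda_{N}$ of $A$ satisfy $\mathrm{Re}\,\lambda_{j}<0$. Then, for $\epsilon\neq0$ small enough, there exists in a neighborhood of $x=0$ a unique trivial nonlinear normal mode (fixed point) $x_{\epsilon}=\tau(\epsilon)$ of the system, with $\tau(0)=0$. This nonlinear normal mode attracts all nearby trajectories and depends on $\epsilon$ in a $C^{r}$ fashion.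
   Context: $C^{a}$ denotes the class of (real) analytic functions. The function $f_1$ need not vanish at $x=0$. A trivial nonlinear normal mode (NNM) of an autonomous system is a fixed point of that system. ''Attracts all nearby trajectories'' means that all trajectories starting sufficiently close to the fixed point converge to it as $t\to\infty$. *)

(* Defs.v *)
From HB Require Import structures.
From mathcomp Require Import all_boot all_order all_algebra.
From mathcomp Require Import all_classical all_reals all_analysis.
From mathcomp Require Import complex.
Set Implicit Arguments.
Unset Strict Implicit.
Unset Printing Implicit Defensive.
Import Order.TTheory GRing.Theory Num.Theory.
Import numFieldNormedType.Exports.
Local Open Scope classical_set_scope.
Local Open Scope ring_scope.

Inductive smoothness := Cfin of nat | Cinfty | Canalytic.

(* On an open set [O], f is C^0 if it is continuous, and C^(k+1) if it is
   differentiable with all its directional derivatives of class C^k. *)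
Fixpoint Ck (R : realType) (m n : nat) (k : nat) (O : set 'cV[R]_m)
    (f : 'cV[R]_m -> 'cV[R]_n) : Prop :=
  match k with
  | 0 => forall x, O x -> {for x, continuous f}
  | k'.+1 => (forall x, O x -> differentiable f x) /\
             (forall v : 'cV[R]_m, Ck k' O ('D_v f))
  end.

Definition monomial (R : realType) (m : nat) (h : 'cV[R]_m)
    (a : {ffun 'I_m -> nat}) : R :=
  \prod_(i < m) h i 0 ^+ a i.

(* f is the sum of an absolutely convergent power series near p; by absolute
   convergence the sum may be computed along the cubes {0, .., K-1}^m of
   multi-indices. *)
Definition analytic_at (R : realType) (m n : nat)
    (f : 'cV[R]_m -> 'cV[R]_n) (p : 'cV[R]_m) : Prop :=
  exists (c : {ffun 'I_m -> nat} -> 'cV[R]_n) (rho : R), 0 < rho /\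
    forall h : 'cV[R]_m, `|h| < rho ->
      summable [set: {ffun 'I_m -> nat}]
        (fun a => (`|monomial h a *: c a|)%:E) /\
      (fun K : nat => \sum_(b : {ffun 'I_m -> 'I_K})
          (monomial h [ffun i => b i : nat] *: c [ffun i => b i : nat]))
        @ \oo --> f (p + h).

Definition class_on_open (R : realType) (m n : nat) (r : smoothness)
    (O : set 'cV[R]_m) (f : 'cV[R]_m -> 'cV[R]_n) : Prop :=
  match r with
  | Cfin k => Ck k O f
  | Cinfty => forall k, Ck k O f
  | Canalytic => forall p, O p -> analytic_at f p
  end.

(* Class C^r on an arbitrary set [S], through local extensions to open sets.
   This is needed because the parameter ranges over a half-open interval
   [0, e1[; when [S] is open it agrees with [class_on_open]. *)
Definition class_on (R : realType) (m n : nat) (r : smoothness)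
    (S : set 'cV[R]_m) (f : 'cV[R]_m -> 'cV[R]_n) : Prop :=
  forall p, S p -> exists (O : set 'cV[R]_m) (g : 'cV[R]_m -> 'cV[R]_n),
    [/\ open O, O p, class_on_open r O g & {in O `&` S, g =1 f}].

(* Joint regularity in (x, e): the pair is encoded as the column (x; e). *)
Definition class_on_param (R : realType) (N n : nat) (r : smoothness)
    (U : set 'cV[R]_N) (I : set R) (f : 'cV[R]_N -> R -> 'cV[R]_n) : Prop :=
  class_on r
    [set z : 'cV[R]_(N + 1) | U (usubmx z) /\ I (dsubmx z 0 0)]
    (fun z : 'cV[R]_(N + 1) => f (usubmx z) (dsubmx z 0 0)).

Definition class_on_curve (R : realType) (n : nat) (r : smoothness)
    (I : set R) (f : R -> 'cV[R]_n) : Prop :=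
  class_on r [set z : 'cV[R]_1 | I (z 0 0)] (fun z : 'cV[R]_1 => f (z 0 0)).

Definition vector_field (R : realType) (N : nat) (A : 'M[R]_N)
    (f0 : 'cV[R]_N -> 'cV[R]_N) (f1 : 'cV[R]_N -> R -> 'cV[R]_N)
    (e : R) (x : 'cV[R]_N) : 'cV[R]_N :=
  A *m x + f0 x + e *: f1 x e.

Definition trivial_NNM (R : realType) (N : nat) (U : set 'cV[R]_N)
    (F : 'cV[R]_N -> 'cV[R]_N) (p : 'cV[R]_N) : Prop :=
  U p /\ F p = 0.

(* x solves x' = F x in U on [0, T[, with T possibly +oo; the derivative at
   time 0 is one-sided. *)
Definition solution (R : realType) (N : nat) (U : set 'cV[R]_N)
    (F : 'cV[R]_N -> 'cV[R]_N) (T : \bar R) (x : R -> 'cV[R]_N) : Prop :=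
  [/\ forall t : R, 0 <= t -> (t%:E < T)%E -> U (x t),
      (0 < T)%E -> h^-1 *: (x h - x 0) @[h --> (0 : R)^'+] --> F (x 0) &
      forall t : R, 0 < t -> (t%:E < T)%E -> is_derive t 1 x (F (x t))].

(* A forward trajectory: a solution on [0, T[ with no solution extending it
   to a longer interval. *)
Definition trajectory (R : realType) (N : nat) (U : set 'cV[R]_N)
    (F : 'cV[R]_N -> 'cV[R]_N) (T : \bar R) (x : R -> 'cV[R]_N) : Prop :=
  [/\ (0 < T)%E, solution U F T x &
      forall (S : \bar R) (y : R -> 'cV[R]_N), (T < S)%E -> solution U F S y ->
        ~ (forall t : R, 0 <= t -> (t%:E < T)%E -> y t = x t)].

(* The first conjunct keeps the second one from being vacuous; [T = +oo]
   rules out trajectories that leave U or blow up in finite time. *)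
Definition attracts_nearby (R : realType) (N : nat) (U : set 'cV[R]_N)
    (F : 'cV[R]_N -> 'cV[R]_N) (p : 'cV[R]_N) : Prop :=
  exists2 delta : R, 0 < delta &
    forall q : 'cV[R]_N, `|q - p| < delta ->
      (exists T x, trajectory U F T x /\ x 0 = q) /\
      (forall T x, trajectory U F T x -> x 0 = q ->
         T = +oo%E /\ x t @[t --> +oo] --> p).

(* Main.v *)
Require Import Defs.
From HB Require Import structures.
From mathcomp Require Import all_boot all_order all_algebra.
From mathcomp Require Import all_classical all_reals all_analysis.
From mathcomp Require Import complex.
From mathcomp Require Import ring lra.
Set Implicit Arguments.
Unset Strict Implicit.
Unset Printing Implicit Defensive.
Import Order.TTheory GRing.Theory Num.Theory.
Import numFieldNormedType.Exports.
Local Open Scope classical_set_scope.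
Local Open Scope ring_scope.

(** Write F(x, e) = A x + f0 x + e f1(x, e).  The quadratic bound on f0 kills the
    derivative of f0 at 0, so the x-derivative of F at the origin is A,
    a stable and in particular invertible matrix.  Everything follows from that.

    Existence and uniqueness.  The regularity used here is strict
    differentiability, f u - f v - L (u - v) = o(|u - v|) as u, v -> p, which both
    C^1 maps ([C1_strict_diff]) and analytic maps ([expansion_strict_diff]) have.
    It makes x |-> x - A^-1 F(x, e) a contraction of a fixed ball for every
    small e, hence a unique zero tau(e) in that ball, Lipschitz in e
    ([implicit_branch]).

    Attraction.  A stable matrix has a quadratic Lyapunov form S
    ([lyapunov_form]), and strict differentiability makes every field F(., e) with
    e small one-sided Lipschitz for it: form(z - w, F z - F w) is at most
    -c form(z - w, z - w).  Two solutions therefore never separate in the norm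
    of S, which gives uniqueness in forward time, trapping in the sublevel sets
    around tau(e), and convergence to tau(e).  Solutions exist for all time
    because the field, once clamped to a cube, is bounded and Lipschitz, and the
    Euler polygons then converge along an ultrafilter ([euler_limit]); the
    clamping is invisible to the trapped solution ([attracts_of_dissipative]).

    Regularity of tau.  For C^k, tau' = -(D_x F)^-1 D_e F along the branch, and
    the right-hand side is as smooth as tau, which is the induction step of
    [smooth_branch].  In the analytic case the work is done by functions of one
    variable which are sums of power series with sum |a_n| rho^n <= M
    ([power_series]).  Such functions are stable under pointwise limits with the
    same rho and M ([power_series_lim]), by compactness of the coefficients.
    Substituting them into an analytic map is such a limit, its terms being
    finite sums of monomials, and the part of degree at least two costs only
    C M^2 ([analytic_expansion]).  The contraction iterates that start from 0
    therefore stay in one fixed class, and so does their limit tau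
    ([analytic_branch_power_series]). *)

(** * Matrix norms *)

Lemma mx_coord_le (R : realType) m n (x : 'M[R]_(m, n)) i j :
  `|x i j| <= `|x|.
Proof.
rewrite [leRHS]/Num.Def.normr /= mx_normrE.
exact: (le_bigmax _ (fun ij : 'I_m * 'I_n => `|x ij.1 ij.2|) (i, j)).
Qed.

Lemma mx_norm_le (R : realType) m n (x : 'M[R]_(m, n)) (c : R) :
  0 <= c -> (forall i j, `|x i j| <= c) -> `|x| <= c.
Proof.
move=> c0 xc; rewrite [leLHS]/Num.Def.normr /= mx_normrE.
by apply: bigmax_le => // -[i j] _; exact: xc.
Qed.

Lemma col_norm_le (R : realType) m (x : 'cV[R]_m) (c : R) :
  0 <= c -> (forall i, `|x i 0| <= c) -> `|x| <= c.
Proof. by move=> c0 xc; apply: mx_norm_le => // i j; rewrite ord1. Qed.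

Lemma mulmx_bound (R : realType) m n (A : 'M[R]_(m, n)) :
  exists2 K : R, 0 < K & forall p (x : 'M[R]_(n, p)), `|A *m x| <= K * `|x|.
Proof.
exists (n%:R * `|A| + 1) => [|p x].
  by rewrite ltr_wpDl// mulr_ge0.
apply: mx_norm_le => [|i j]; first by rewrite mulr_ge0// addr_ge0// mulr_ge0.
rewrite mxE (le_trans (ler_norm_sum _ _ _))//.
have -> : (n%:R * `|A| + 1) * `|x| = \sum_(k < n) (`|A| * `|x|) + `|x|.
  by rewrite sumr_const card_ord -[in RHS]mulr_natl mulrDl mul1r mulrA.
rewrite ler_wpDr// ler_sum// => k _.
by rewrite normrM ler_pM// mx_coord_le.
Qed.

Lemma sqr_norm_le_sum (R : realType) n (x : 'cV[R]_n) :
  `|x| ^+ 2 <= \sum_i x i 0 ^+ 2.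
Proof.
have S0 : 0 <= \sum_i x i 0 ^+ 2 by apply: sumr_ge0 => i _; exact: sqr_ge0.
have : `|x| <= Num.sqrt (\sum_i x i 0 ^+ 2).
  apply: col_norm_le => [|i]; first exact: sqrtr_ge0.
  rewrite -sqrtr_sqr ler_wsqrtr// (bigD1 i)//= lerDl.
  by apply: sumr_ge0 => j _; exact: sqr_ge0.
move=> h; rewrite -[leRHS]sqr_sqrtr// ler_sqr ?nnegrE//; exact: sqrtr_ge0.
Qed.

Lemma cvg_col (R : realType) (T : Type) (Fl : set_system T) (FF : Filter Fl) N
    (u : T -> 'cV[R]_N) (l : 'cV[R]_N) :
  (forall i, u n i 0 @[n --> Fl] --> l i 0) -> u n @[n --> Fl] --> l.
Proof.
move=> ul; apply/cvgrPdist_le => e e0; near=> n.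
apply: col_norm_le => [|i]; first exact: ltW.
rewrite !mxE; move: i; near: n; apply: filter_forall => i.
by have /cvgrPdist_le/(_ _ e0) := ul i.
Unshelve. all: by end_near. Qed.

(** * A quadratic Lyapunov form for a stable matrix *)

(** Here X + iY is triangular and acts on a + ib; the left-hand side is the real
    part of the weighted Hermitian product of a + ib with its image.  Geometrically decaying
    weights make the off-diagonal entries negligible against the diagonal. *)
Lemma triangular_form_neg (R : realType) n (X Y : 'M[R]_n) (mu : R) :
  0 < mu -> (forall i j : 'I_n, (i < j)%N -> X i j = 0 /\ Y i j = 0) ->
  (forall i, X i i <= - mu) ->
  exists w : 'I_n -> R, (forall i, 0 < w i) /\
    forall a b : 'cV[R]_n,
      \sum_i w i * (a i 0 * ((X *m a) i 0 - (Y *m b) i 0) +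
                    b i 0 * ((X *m b) i 0 + (Y *m a) i 0))
      <= - (mu / 2) * \sum_i w i * (a i 0 ^+ 2 + b i 0 ^+ 2).
Proof.
move=> mu0 trig diag.
pose t : R := `|X| + `|Y|.
have t0 : 0 <= t by rewrite addr_ge0.
have den : 0 < mu + 4 * t * n%:R by rewrite ltr_wpDr// !mulr_ge0.
(* d^(2i) is d^(i - j) times the geometric mean d^(i + j) of the weights of i and j,
   so the terms with j < i carry a factor d *)
have [d [d0 d1 dmu]] : exists d : R, [/\ 0 < d, d <= 1 & d * (4 * t * n%:R) <= mu].
  exists (mu / (mu + 4 * t * n%:R)); split; first by rewrite divr_gt0.
    by rewrite ler_pdivrMr// mul1r lerDl !mulr_ge0.
  by rewrite mulrAC ler_pdivrMr// ler_pM2l// lerDr ltW.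
have d0' := ltW d0.
exists (fun i => d ^+ i * d ^+ i); split=> [i|a b]; first by rewrite !mulr_gt0 ?exprn_gt0.
pose q (i : 'I_n) := d ^+ i * d ^+ i * (a i 0 ^+ 2 + b i 0 ^+ 2).
have q0 i : 0 <= q i by rewrite /q mulr_ge0 ?addr_ge0 ?sqr_ge0// mulr_ge0// exprn_ge0// ltW.
have key (i : 'I_n) : d ^+ i * d ^+ i * (a i 0 * ((X *m a) i 0 - (Y *m b) i 0) +
    b i 0 * ((X *m b) i 0 + (Y *m a) i 0)) <=
    - mu * q i + \sum_(j < n) t * d * (q i + q j).
  have -> : d ^+ i * d ^+ i * (a i 0 * ((X *m a) i 0 - (Y *m b) i 0) +
    b i 0 * ((X *m b) i 0 + (Y *m a) i 0)) =
    \sum_j d ^+ i * d ^+ i * (X i j * (a i 0 * a j 0 + b i 0 * b j 0) +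
       Y i j * (b i 0 * a j 0 - a i 0 * b j 0)).
    rewrite !mxE -big_split /= -sumrB !mulr_sumr -big_split /= mulr_sumr.
    by apply: eq_bigr => j _; ring.
  rewrite (bigD1 i)//= lerD//.
    have -> : a i 0 * a i 0 + b i 0 * b i 0 = a i 0 ^+ 2 + b i 0 ^+ 2 by ring.
    have -> : b i 0 * a i 0 - a i 0 * b i 0 = 0 by ring.
    have -> : d ^+ i * d ^+ i * (X i i * (a i 0 ^+ 2 + b i 0 ^+ 2) + Y i i * 0) =
        X i i * q i by rewrite /q; ring.
    by rewrite ler_wpM2r.
  apply: (@le_trans _ _ (\sum_(j < n | j != i) t * d * (q i + q j))); last first.
    rewrite [leRHS](bigD1 i)//= lerDr mulr_ge0 ?addr_ge0//.
    by rewrite mulr_ge0.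
  apply: ler_sum => j ji.
  have [ij|] := ltnP i j.
    have [-> ->] := trig _ _ ij; rewrite !mul0r addr0 mulr0.
    by rewrite mulr_ge0 ?addr_ge0// mulr_ge0.
  rewrite leq_eqVlt => /orP[/eqP/val_inj eji|lji]; first by rewrite eji eqxx in ji.
  pose u (k : 'I_n) := d ^+ k * (`|a k 0| + `|b k 0|).
  apply: (@le_trans _ _ (t * d * (u i * u j))); last first.
    rewrite ler_wpM2l ?mulr_ge0 ?(ltW d0)//.
    have uq k : u k ^+ 2 <= 2 * q k.
      rewrite /u /q -[a k 0 ^+ 2]real_normK ?num_real//.
      rewrite -[b k 0 ^+ 2]real_normK ?num_real//.
      have := sqr_ge0 (d ^+ k * (`|a k 0| - `|b k 0|)).
      set A := `|_|; set B := `|_|; lra.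
    have := uq i; have := uq j; have := sqr_ge0 (u i - u j); lra.
  have -> : t * d * (u i * u j) =
    d ^+ i * (d * d ^+ j) * (t * ((`|a i 0| + `|b i 0|) * (`|a j 0| + `|b j 0|))).
    by rewrite /u; ring.
  apply: (@le_trans _ _ (d ^+ i * d ^+ i *
      (t * ((`|a i 0| + `|b i 0|) * (`|a j 0| + `|b j 0|))))).
    rewrite ler_wpM2l//; first by rewrite mulr_ge0// exprn_ge0// ltW.
    rewrite (le_trans (ler_norm _))// (le_trans (ler_normD _ _))// /t mulrDl.
    have h1 := mulr_ge0 (normr_ge0 (a i 0)) (normr_ge0 (b j 0)).
    have h2 := mulr_ge0 (normr_ge0 (b i 0)) (normr_ge0 (a j 0)).
    have h3 := mulr_ge0 (normr_ge0 (a i 0)) (normr_ge0 (a j 0)).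
    have h4 := mulr_ge0 (normr_ge0 (b i 0)) (normr_ge0 (b j 0)).
    have b1 : `|a i 0 * a j 0 + b i 0 * b j 0| <=
        (`|a i 0| + `|b i 0|) * (`|a j 0| + `|b j 0|).
      by rewrite (le_trans (ler_normD _ _))// !normrM; lra.
    have b2 : `|b i 0 * a j 0 - a i 0 * b j 0| <=
        (`|a i 0| + `|b i 0|) * (`|a j 0| + `|b j 0|).
      by rewrite (le_trans (ler_normB _ _))// !normrM; lra.
    by rewrite lerD// normrM ler_pM// mx_coord_le.
  rewrite ler_wpM2r ?mulr_ge0 ?addr_ge0//.
  rewrite ler_wpM2l ?exprn_ge0 ?(ltW d0)// -exprS.
  by rewrite ler_wiXn2l// ltW.
apply: le_trans (ler_sum _ (fun i _ => key i)) _.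
rewrite big_split /= -mulr_sumr.
have -> : \sum_(i < n) \sum_(j < n) t * d * (q i + q j) =
   t * d * (2 * n%:R * \sum_i q i).
  under eq_bigr do rewrite -mulr_sumr big_split /= sumr_const card_ord.
  rewrite -mulr_sumr big_split /= sumr_const card_ord -sumrMnl.
  by rewrite sumrMnl -mulr_natr; ring.
rewrite -/q; set Q := \sum_i _.
have Q0 : 0 <= Q by apply: sumr_ge0 => i _.
have : d * (4 * t * n%:R) * Q <= mu * Q by rewrite ler_wpM2r.
set N := n%:R; lra.
Qed.

Lemma real_complex_mul_parts (R : realType) m n p
    (P : 'M[R[i]]_(m, n)) (Q : 'M[R[i]]_(n, p)) :
  map_mx (@complex.Re R) (P *m Q) =
    map_mx (@complex.Re R) P *m map_mx (@complex.Re R) Q -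
    map_mx (@complex.Im R) P *m map_mx (@complex.Im R) Q /\
  map_mx (@complex.Im R) (P *m Q) =
    map_mx (@complex.Re R) P *m map_mx (@complex.Im R) Q +
    map_mx (@complex.Im R) P *m map_mx (@complex.Re R) Q.
Proof.
split; apply/matrixP => i j; rewrite !mxE.
  rewrite (big_morph (@complex.Re R) (id1 := 0) (op1 := +%R)) //=; last by case=> ? ? [].
  by rewrite -sumrB; apply: eq_bigr => k _; rewrite !mxE; case: (P i k) (Q k j) => ? ? [].
rewrite (big_morph (@complex.Im R) (id1 := 0) (op1 := +%R)) //=; last by case=> ? ? [].
by rewrite -big_split; apply: eq_bigr => k _; rewrite !mxE; case: (P i k) (Q k j) => ? ? [].
Qed.

Lemma finite_pos_lb (R : realType) n (f : 'I_n -> R) :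
  (forall i, 0 < f i) -> exists2 c, 0 < c & forall i, c <= f i.
Proof.
move=> f0; exists (\big[Num.min/1]_i f i) => [|i].
  exact: lt_bigmin.
exact: bigmin_le.
Qed.

(** Unitary triangularisation over the complex numbers turns A into T; the real
    form S is the weighted Hermitian form of [triangular_form_neg] pulled back to
    real vectors. *)
Lemma lyapunov_form (R : realType) N (A : 'M[R]_N)
    (A_stable : forall lam : R[i],
        eigenvalue (map_mx (real_complex R) A) lam -> complex.Re lam < 0) :
  exists (S : 'M[R]_N) (al : R), [/\ S^T = S, 0 < al,
    forall x : 'cV_N, al * `|x| ^+ 2 <= (x^T *m S *m x) 0 0 &
    forall x : 'cV_N, (x^T *m S *m (A *m x)) 0 0 <= - al * `|x| ^+ 2].
Proof.
have [N0|N0] := posnP N.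
  subst N; exists 0, 1; split => // [|x|x]; first by rewrite trmx0.
    by rewrite mulmx0 mul0mx !mxE (_ : x = 0) ?normr0 ?expr0n ?mulr0//; apply/matrixP => -[].
  by rewrite mulmx0 mul0mx !mxE (_ : x = 0) ?normr0 ?expr0n ?mulr0//; apply/matrixP => -[].
pose Ac := map_mx (real_complex R) A.
have [P PU Ptrig] := Schur Ac N0.
have Pu := unitarymx_unit PU.
pose T := conjmx P Ac.
have PA : P *m Ac = T *m P by rewrite /T conjumx// mulmxKV.
have trigT : is_trig_mx T by exact: Ptrig.
have Tdiag i : complex.Re (T i i) < 0.
  apply: A_stable; apply: (@eigenvalue_conjmx _ _ _ P Ac).
  - exact: stablemx_unit.
  - by rewrite row_free_unit.
  - rewrite -[_ \in _]/(eigenvalue T (T i i)) eigenvalue_root_char char_poly_trig//.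
    by rewrite (bigD1 i)//= rootM root_XsubC eqxx.
have trigT0 (i j : 'I_N) : (i < j)%N -> T i j = 0 by move=> ij; exact: (is_trig_mxP trigT).
clearbody T.
have [mu mu0 muT] : exists2 mu, 0 < mu & forall i, mu <= - complex.Re (T i i).
  by apply: finite_pos_lb => i; rewrite oppr_gt0.
pose X := map_mx (@complex.Re R) T; pose Y := map_mx (@complex.Im R) T.
pose a := map_mx (@complex.Re R) P; pose b := map_mx (@complex.Im R) P.
have AcR : map_mx (@complex.Re R) Ac = A by apply/matrixP => i j; rewrite !mxE.
have AcI : map_mx (@complex.Im R) Ac = 0 by apply/matrixP => i j; rewrite !mxE.
have [aA bA] : a *m A = X *m a - Y *m b /\ b *m A = X *m b + Y *m a.
  have [h1 h2] := real_complex_mul_parts P Ac.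
  have [h3 h4] := real_complex_mul_parts T P.
  split; first by rewrite -h3 -PA h1 AcR AcI mulmx0 subr0.
  by rewrite -h4 -PA h2 AcR AcI mulmx0 add0r.
(* x is recovered from a x and b x, which makes S definite on real vectors *)
have inv : map_mx (@complex.Re R) (invmx P) *m a -
           map_mx (@complex.Im R) (invmx P) *m b = 1%:M.
  have [<- _] := real_complex_mul_parts (invmx P) P.
  rewrite mulVmx//; apply/matrixP => i j; rewrite !mxE.
  by case: (i == j).
have [||w [w0 wle]] := @triangular_form_neg R N X Y mu mu0.
  by move=> i j ij; rewrite !mxE trigT0.
  by move=> i; rewrite mxE lerNr.
pose D := diag_mx (\row_i w i).
pose S := a^T *m D *m a + b^T *m D *m b.
have form (x y : 'cV[R]_N) : (x^T *m S *m y) 0 0 = \sum_i w i *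
    ((a *m x) i 0 * (a *m y) i 0 + (b *m x) i 0 * (b *m y) i 0).
  have h (c : 'M[R]_N) : (x^T *m (c^T *m D *m c) *m y) 0 0 =
      \sum_i w i * ((c *m x) i 0 * (c *m y) i 0).
    have -> : x^T *m (c^T *m D *m c) *m y = (c *m x)^T *m D *m (c *m y).
      by rewrite trmx_mul !mulmxA.
    rewrite mul_mx_diag mxE; apply: eq_bigr => i _.
    by rewrite 3!mxE [in LHS]mxE; ring.
  rewrite mulmxDr mulmxDl mxE !h -big_split.
  by apply: eq_bigr => i _; rewrite mulrDr.
have [K1 K10 K1P] := mulmx_bound (map_mx (@complex.Re R) (invmx P)).
have [K2 K20 K2P] := mulmx_bound (map_mx (@complex.Im R) (invmx P)).
have [c c0 cw] := finite_pos_lb w0.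
pose K := 2 * (K1 ^+ 2 + K2 ^+ 2).
have K0 : 0 < K by rewrite mulr_gt0// addr_gt0// exprn_gt0.
have low (x : 'cV[R]_N) : c / K * `|x| ^+ 2 <= (x^T *m S *m x) 0 0.
  rewrite form.
  apply: (@le_trans _ _ (c * \sum_i ((a *m x) i 0 ^+ 2 + (b *m x) i 0 ^+ 2))).
    rewrite -mulrA ler_pM2l// mulrC ler_pdivrMr//.
    have -> : x = map_mx (@complex.Re R) (invmx P) *m (a *m x) -
                  map_mx (@complex.Im R) (invmx P) *m (b *m x).
      by rewrite !mulmxA -mulmxBl inv mul1mx.
    rewrite (_ : a *m (_ - _) = a *m x); last first.
      by rewrite !mulmxA -mulmxBl inv mul1mx.
    rewrite (_ : b *m (_ - _) = b *m x); last first.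
      by rewrite !mulmxA -mulmxBl inv mul1mx.
    rewrite big_split /=.
    apply: (@le_trans _ _ ((`|a *m x| ^+ 2 + `|b *m x| ^+ 2) * K)); last first.
      by rewrite ler_pM2r// lerD// sqr_norm_le_sum.
    apply: (@le_trans _ _ ((K1 * `|a *m x| + K2 * `|b *m x|) ^+ 2)).
      rewrite lerXn2r ?nnegrE//; first by rewrite addr_ge0// mulr_ge0// ltW.
      by rewrite (le_trans (ler_normB _ _))// lerD.
    rewrite /K; set u := `|a *m x|; set v := `|b *m x|.
    have := sqr_ge0 (K1 * u - K2 * v).
    have := sqr_ge0 (K1 * v); have := sqr_ge0 (K2 * u); lra.
  rewrite mulr_sumr ler_sum// => i _.
  by rewrite -!expr2 ler_wpM2r// addr_ge0// sqr_ge0.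
exists S, (Num.min 1 (mu / 2) * (c / K)); split.
- by rewrite /S linearD /= !trmx_mul tr_diag_mx !trmxK !mulmxA.
- by rewrite !mulr_gt0 ?invr_gt0// lt_min ltr01 divr_gt0.
- move=> x; apply: le_trans (low x); rewrite ler_wpM2r// ?sqr_ge0//.
  by rewrite ler_piMl ?ge_min ?lexx// ltW// divr_gt0.
move=> x; rewrite form.
have hB (u v : 'cV[R]_N) i : (u - v) i 0 = u i 0 - v i 0 by rewrite !mxE.
have hD (u v : 'cV[R]_N) i : (u + v) i 0 = u i 0 + v i 0 by rewrite mxE.
have -> : \sum_i w i * ((a *m x) i 0 * (a *m (A *m x)) i 0 +
    (b *m x) i 0 * (b *m (A *m x)) i 0) =
  \sum_i w i * ((a *m x) i 0 * ((X *m (a *m x)) i 0 - (Y *m (b *m x)) i 0) +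
    (b *m x) i 0 * ((X *m (b *m x)) i 0 + (Y *m (a *m x)) i 0)).
  apply: eq_bigr => i _.
  by rewrite ![_ *m (A *m x)]mulmxA aA bA mulmxBl mulmxDl -!mulmxA hB hD.
apply: le_trans (wle _ _) _; rewrite !mulNr lerN2.
have -> : \sum_i w i * ((a *m x) i 0 ^+ 2 + (b *m x) i 0 ^+ 2) =
    (x^T *m S *m x) 0 0.
  by rewrite form; apply: eq_bigr => i _; rewrite !expr2.
rewrite -mulrA ler_pM ?le_min ?ler01 ?divr_ge0 ?mulr_ge0 ?sqr_ge0 ?invr_ge0 ?(ltW mu0)//.
- by rewrite ltW.
- by rewrite ltW.
- by rewrite ge_min lexx orbT.
Qed.

(** * Limits along an ultrafilter *)

Lemma ultrafilter_oo : exists U : set_system nat, UltraFilter U /\ \oo `<=` U.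
Proof. by have [U [UU UF]] := ultraFilterLemma (F := \oo) _; exists U. Qed.

Lemma ultra_fmap (T V : Type) (f : T -> V) (U : set_system T) :
  UltraFilter U -> UltraFilter (f @ U).
Proof.
move=> UU; split; first exact: fmap_proper_filter.
move=> G GG UG; apply/seteqP; split=> [A GA|]; last exact: UG.
have [//|UnA] := in_ultra_setVsetC (f @^-1` A) UU.
have GnA : G (~` A) by apply: UG.
by have [? []] := filter_ex (filterI GA GnA).
Qed.

Lemma ultra_bounded_cvg (R : realType) (U : set_system nat) (UU : UltraFilter U)
    (u : nat -> R) (M : R) :
  (forall n, `|u n| <= M) -> exists l : R, u n @[n --> U] --> l.
Proof.
move=> uM; have := @segment_compact R (- M) M; rewrite compact_ultra => cpt.
have UI : UltraFilter (u @ U) by exact: ultra_fmap.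
have [|l [_ ul]] := cpt (u @ U) UI; last by exists l.
by apply: nearW => n; rewrite /= in_itv /= -ler_norml.
Qed.

Lemma ultra_bounded_cvg_col (R : realType) (U : set_system nat)
    (UU : UltraFilter U) N (u : nat -> 'cV[R]_N) (M : R) :
  (forall n, `|u n| <= M) -> exists l : 'cV[R]_N, u n @[n --> U] --> l.
Proof.
move=> uM.
have h i : {l : R | u n i 0 @[n --> U] --> l}.
  apply: cid; apply: (@ultra_bounded_cvg _ _ _ _ M) => n.
  exact: le_trans (mx_coord_le _ _ _) (uM n).
exists (\col_i sval (h i)); apply: cvg_col => i.
by rewrite mxE; exact: (svalP (h i)).
Qed.

(** * Global solutions of a bounded Lipschitz system *)

Section euler.
Variables (R : realType) (N : nat) (G : 'cV[R]_N -> 'cV[R]_N) (K L : R).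
Hypotheses (G_bound : forall x, `|G x| <= K)
           (G_lip : forall x y, `|G x - G y| <= L * `|x - y|) (L0 : 0 <= L).
Variable q : 'cV[R]_N.

Let K0 : 0 <= K. Proof. exact: le_trans (normr_ge0 _) (G_bound 0). Qed.

Let y (h : R) (k : nat) := iter k (fun z => z + h *: G z) q.

Let y_dist (h : R) k j : 0 <= h -> `|y h (k + j) - y h k| <= j%:R * h * K.
Proof.
move=> h0; elim: j => [|j IH]; first by rewrite addn0 subrr normr0 !mul0r.
rewrite addnS /= -/(y h (k + j)).
have -> : y h (k + j) + h *: G (y h (k + j)) - y h k =
  (y h (k + j) - y h k) + h *: G (y h (k + j)) by rewrite addrAC.
rewrite (le_trans (ler_normD _ _))// -natr1 !mulrDl lerD// mul1r normrZ.
by rewrite ger0_norm// ler_wpM2l.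
Qed.

Let y_quad (h : R) k j : 0 <= h ->
  `|y h (k + j) - y h k - (j%:R * h) *: G (y h k)| <= L * K * (j%:R * h) ^+ 2.
Proof.
move=> h0; elim: j => [|j IH].
  by rewrite addn0 subrr !mul0r scale0r subrr normr0 expr0n mulr0.
rewrite addnS /= -/(y h (k + j)).
have -> : y h (k + j) + h *: G (y h (k + j)) - y h k - (j.+1%:R * h) *: G (y h k) =
  (y h (k + j) - y h k - (j%:R * h) *: G (y h k)) +
  h *: (G (y h (k + j)) - G (y h k)).
  by apply/matrixP => a b; rewrite !mxE -natr1; ring.
rewrite (le_trans (ler_normD _ _))//.
have : `|h *: (G (y h (k + j)) - G (y h k))| <= h * (L * (j%:R * h * K)).
  rewrite normrZ ger0_norm// ler_wpM2l// (le_trans (G_lip _ _))//.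
  by rewrite ler_wpM2l// y_dist.
have : 0 <= L * K * h ^+ 2 * (j%:R + 1).
  by rewrite !mulr_ge0// ?sqr_ge0// addr_ge0.
move: IH; rewrite -natr1; set a := `|_|; set b := `|_|; lra.
Qed.

(** Over j steps of size h the Euler polygon drifts by at most L K (j h)^2 from the
    tangent line at its starting point, whatever h is.  The bound passes to
    an ultralimit of the step functions and makes it differentiable at once.  The
    speed bound K and the Lipschitz constant L handle the case
    t < s, which explains the factor 2. *)
Lemma euler_limit : exists x : R -> 'cV[R]_N, x 0 = q /\
  forall s t : R, 0 <= s -> 0 <= t ->
    `|x t - x s - (t - s) *: G (x s)| <= 2 * (L * K) * (t - s) ^+ 2.
Proof.
have [U [UU Uoo]] := ultrafilter_oo.
(* the polygon with step 1/(n+1), frozen at the last node before t *)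
pose z n (t : R) := y n.+1%:R^-1 (Num.truncn (t * n.+1%:R)).
have n0 n : 0 <= n.+1%:R^-1 :> R by [].
have trn n (t : R) : 0 <= t ->
    (Num.truncn (t * n.+1%:R))%:R * n.+1%:R^-1 <= t /\
    t - n.+1%:R^-1 <= (Num.truncn (t * n.+1%:R))%:R * n.+1%:R^-1.
  move=> t0; have /truncn_itv/andP[h1 h2] : 0 <= t * n.+1%:R by rewrite mulr_ge0.
  rewrite ler_pdivrMr// h1; split => //.
  by rewrite ler_pdivlMr// mulrBl mulVf// lerBlDr natr1 ltW.
have zb (t : R) : 0 <= t -> forall n, `|z n t| <= `|q| + t * K.
  move=> t0 n; have := @y_dist n.+1%:R^-1 0 (Num.truncn (t * n.+1%:R)) (n0 n).
  rewrite add0n /= => h.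
  have -> : z n t = q + (z n t - q) by rewrite addrC subrK.
  rewrite (le_trans (ler_normD _ _))// lerD2l (le_trans h)//.
  by rewrite ler_wpM2r//; case: (trn n t t0).
have lim (t : R) : {l : 'cV[R]_N | 0 <= t -> z n t @[n --> U] --> l}.
  apply: cid; have [t0|t0] := leP 0 t; last by exists 0.
  have [l zl] := @ultra_bounded_cvg_col R U UU N (z ^~ t) _ (zb t t0).
  by exists l.
pose x (t : R) := sval (lim t).
have xP (t : R) : 0 <= t -> z n t @[n --> U] --> x t := svalP (lim t).
have Gc u v : u @ U --> v -> G (u n) @[n --> U] --> G v.
  move=> uv; apply/cvgrPdist_le => e e0.
  have e1 : 0 < e / (L + 1) by rewrite divr_gt0// ltr_wpDl.
  move/cvgrPdist_le : uv => /(_ _ e1); apply: filterS => n un.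
  rewrite (le_trans (G_lip _ _))// (@le_trans _ _ ((L + 1) * `|v - u n|))//.
    by rewrite ler_wpM2r// lerDl.
  by rewrite mulrC -ler_pdivlMr// ltr_wpDl.
have tr_cvg (t : R) : 0 <= t ->
    (Num.truncn (t * n.+1%:R))%:R * n.+1%:R^-1 @[n --> U] --> t.
  move=> t0; apply: (cvg_trans (G := _ @ \oo)); first by move=> A; exact: Uoo.
  apply: (@squeeze_cvgr _ _ _ _ (fun n => t - n.+1%:R^-1) (fun=> t)).
  - by near=> n; have [-> ->] := trn n t t0.
  - rewrite -[X in _ --> X]subr0; apply: cvgB; first exact: cvg_cst.
    exact: cvg_harmonic.
  - exact: cvg_cst.
have main (s t : R) : 0 <= s -> s <= t ->
    `|x t - x s - (t - s) *: G (x s)| <= L * K * (t - s) ^+ 2 /\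
    `|x t - x s| <= (t - s) * K.
  move=> s0 st; have t0 := le_trans s0 st.
  pose d n := (Num.truncn (t * n.+1%:R))%:R * n.+1%:R^-1 -
              (Num.truncn (s * n.+1%:R))%:R * n.+1%:R^-1 : R.
  have dl : d n @[n --> U] --> t - s by apply: cvgB; exact: tr_cvg.
  have le n : (Num.truncn (s * n.+1%:R) <= Num.truncn (t * n.+1%:R))%N.
    by apply: le_truncn; rewrite ler_wpM2r.
  split.
    apply: (@ler_cvg_to _ U _ _
      (fun n => `|z n t - z n s - d n *: G (z n s)|) (fun n => L * K * d n ^+ 2)).
    - apply: cvg_norm; apply: cvgB; first by apply: cvgB; exact: xP.
      by apply: cvgZ => //; apply: Gc; exact: xP.
    - by apply: cvgMr; rewrite expr2; apply: cvgM.
    - apply: nearW => n.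
      have := @y_quad n.+1%:R^-1 (Num.truncn (s * n.+1%:R))
        (Num.truncn (t * n.+1%:R) - Num.truncn (s * n.+1%:R)) (n0 n).
      by rewrite subnKC// natrB// mulrBl.
  apply: (@ler_cvg_to _ U _ _ (fun n => `|z n t - z n s|) (fun n => d n * K)).
  - by apply: cvg_norm; apply: cvgB; exact: xP.
  - exact: cvgMl.
  - apply: nearW => n.
    have := @y_dist n.+1%:R^-1 (Num.truncn (s * n.+1%:R))
      (Num.truncn (t * n.+1%:R) - Num.truncn (s * n.+1%:R)) (n0 n).
    by rewrite subnKC// natrB// mulrBl.
exists x; split.
  have : z n 0 @[n --> U] --> q.
    by apply: cvg_near_cst; near=> n; rewrite /z mul0r truncn0.
  by move=> zq; apply: (cvg_unique _ (xP 0 (lexx 0)) zq); exact: norm_hausdorff.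
move=> s t s0 t0; have LK0 : 0 <= L * K * (t - s) ^+ 2 by rewrite mulr_ge0 ?sqr_ge0// mulr_ge0.
have [st|/ltW ts] := leP s t.
  by have [h _] := main _ _ s0 st; rewrite (le_trans h)//; lra.
have [h1 h2] := main t s t0 ts.
have -> : x t - x s - (t - s) *: G (x s) =
  - (x s - x t - (s - t) *: G (x t)) + (s - t) *: (G (x s) - G (x t)).
  by apply/matrixP => a b; rewrite !mxE; ring.
rewrite (le_trans (ler_normD _ _))// normrN.
have h3 : `|(s - t) *: (G (x s) - G (x t))| <= (s - t) * (L * ((s - t) * K)).
  rewrite normrZ ger0_norm ?subr_ge0// ler_wpM2l ?subr_ge0//.
  by rewrite (le_trans (G_lip _ _))// ler_wpM2l.
have e : (t - s) ^+ 2 = (s - t) ^+ 2 by ring.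
rewrite e; move: h1 h3; set a := `|_|; set b := `|_|; lra.
Unshelve. all: by end_near. Qed.

End euler.

(** Dividing the quadratic error by t - s shows that the difference quotients of x
    tend to G (x s), on both sides for s > 0 and on the right for s = 0. *)
Lemma quadratic_error_solution (R : realType) N (G : 'cV[R]_N -> 'cV[R]_N)
    (C : R) (x : R -> 'cV[R]_N) : 0 <= C ->
  (forall s t : R, 0 <= s -> 0 <= t ->
    `|x t - x s - (t - s) *: G (x s)| <= C * (t - s) ^+ 2) ->
  solution setT G +oo x.
Proof.
move=> C0 xC.
have key (t h : R) : 0 <= t -> 0 <= t + h -> h != 0 ->
    `|G (x t) - h^-1 *: (x (t + h) - x t)| <= C * `|h|.
  move=> t0 th hn0; have := xC t (t + h) t0 th.
  have -> : t + h - t = h by rewrite addrC addKr.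
  have -> : x (t + h) - x t - h *: G (x t) =
      (- h) *: (G (x t) - h^-1 *: (x (t + h) - x t)).
    by rewrite scalerBr scalerA scaleNr mulNr divff// scaleN1r opprK addrC.
  rewrite normrZ normrN -[h ^+ 2]real_normK ?num_real// expr2 mulrA mulrC.
  by rewrite ler_pM2r// normr_gt0.
have lim (F : set_system R) (FF : Filter F) (t : R) : 0 <= t ->
    (forall e : R, 0 < e -> \forall h \near F, [/\ h != 0, `|h| <= e & 0 <= t + h]) ->
    h^-1 *: (x (t + h) - x t) @[h --> F] --> G (x t).
  move=> t0 Fh; apply/cvgrPdist_le => e e0.
  have e1 : 0 < e / (C + 1) by rewrite divr_gt0// ltr_wpDl.
  apply: filterS (Fh _ e1) => h [h0 he th].
  rewrite (le_trans (key _ _ t0 th h0))//.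
  rewrite (@le_trans _ _ ((C + 1) * (e / (C + 1))))//; last first.
    by rewrite mulrC divfK// gt_eqF// ltr_wpDl.
  by rewrite ler_pM// lerDl.
split => // [_|t t0 _].
  have := @lim 0^'+ _ 0 (lexx 0).
  under eq_fun do rewrite add0r.
  apply=> e e0; near=> h.
  have h0 : 0 < h by [].
  split; rewrite ?gt_eqF ?add0r ?gtr0_norm ?ltW//.
have dl : (fun h : R => h^-1 *: ((x \o shift t) (h *: (1 : R)) - x t)) @ 0^' -->
    G (x t).
  have := @lim 0^' _ t (ltW t0).
  rewrite /= (_ : (fun h : R => h^-1 *: (x (h *: (1 : R) + t) - x t)) =
    (fun h : R => h^-1 *: (x (t + h) - x t))); last first.
    by apply/funext => h; rewrite -[h *: (1 : R)]/(h * 1) mulr1 [h + t]addrC.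
  apply=> e e0; near=> h.
  split; first by near: h; exact: nbhs_dnbhs_neq.
    by near: h; apply: dnbhs0_le.
  have : `|h| < t by near: h; exact: dnbhs0_lt.
  by rewrite ltr_norml => /andP[]; lra.
split; first by apply/cvg_ex; exists (G (x t)).
by apply: cvg_lim => //; exact: norm_hausdorff.
Unshelve. all: by end_near. Qed.

(** * Quadratic forms along solutions *)

Definition form (R : realType) N (S : 'M[R]_N) (x y : 'cV[R]_N) : R :=
  (x^T *m S *m y) 0 0.

Lemma formE (R : realType) N (S : 'M[R]_N) (x y : 'cV[R]_N) :
  form S x y = \sum_i \sum_j x i 0 * S i j * y j 0.
Proof.
rewrite /form mxE exchange_big /=; apply: eq_bigr => j _.
by rewrite mxE mulr_suml; apply: eq_bigr => i _; rewrite mxE.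
Qed.

Lemma formDr (R : realType) N (S : 'M[R]_N) (x y z : 'cV[R]_N) :
  form S x (y + z) = form S x y + form S x z.
Proof. by rewrite /form mulmxDr mxE. Qed.

Lemma formC (R : realType) N (S : 'M[R]_N) (x y : 'cV[R]_N) :
  S^T = S -> form S x y = form S y x.
Proof.
move=> ST; rewrite !formE exchange_big /=; apply: eq_bigr => j _.
apply: eq_bigr => i _; rewrite -[in RHS]ST mxE; ring.
Qed.

Lemma form_bound (R : realType) N (S : 'M[R]_N) :
  exists2 C, 0 < C & forall x y : 'cV[R]_N, `|form S x y| <= C * `|x| * `|y|.
Proof.
exists (\sum_(i < N) \sum_(j < N) `|S i j| + 1) => [|x y].
  by rewrite ltr_wpDl// sumr_ge0// => i _; rewrite sumr_ge0.
rewrite formE (le_trans (ler_norm_sum _ _ _))//.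
rewrite -mulrA mulrDl mul1r ler_wpDr ?mulr_ge0// mulr_suml ler_sum// => i _.
rewrite (le_trans (ler_norm_sum _ _ _))// mulr_suml ler_sum// => j _.
by rewrite !normrM mulrAC mulrC ler_wpM2l// ler_pM// mx_coord_le.
Qed.

Lemma is_derive_coord (R : realType) N (x : R -> 'cV[R]_N) (t : R) dx i :
  is_derive t (1 : R) x dx -> is_derive t (1 : R) (fun s => x s i 0) (dx i 0).
Proof.
move=> xd; split; first by have /derivable_mxP := @ex_derive _ _ _ _ _ _ _ xd.
by rewrite -(@derive_val _ _ _ _ _ _ _ xd) derive_mx ?mxE//; exact: ex_derive.
Qed.

Lemma is_derive_form (R : realType) N (S : 'M[R]_N) (x : R -> 'cV[R]_N)
    (t : R) dx : S^T = S -> is_derive t (1 : R) x dx ->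
  is_derive t (1 : R) (fun s => form S (x s) (x s)) (2 * form S (x t) dx).
Proof.
move=> ST xd.
have -> : (fun s => form S (x s) (x s)) = \sum_i \sum_j
    (S i j \*: ((fun s => x s i 0) * (fun s => x s j 0))).
  apply/funext => s; rewrite formE fct_sumE; apply: eq_bigr => i _.
  rewrite fct_sumE; apply: eq_bigr => j _.
  by rewrite /= -[RHS]/(S i j * (x s i 0 * x s j 0)); ring.
have c i := @is_derive_coord R N x t dx i xd.
apply: is_derive_eq.
(* the product rule yields form S dx x + form S x dx; symmetry merges the two *)
rewrite mulr_natl mulr2n {2}(formC _ _ ST) !formE -big_split /=.
apply: eq_bigr => i _; rewrite -big_split /=; apply: eq_bigr => j _.
rewrite -![_ *: _]/(_ * _); ring.
Qed.

(** Only one-sided information is available at the left endpoint; the mean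
    value theorem is applied on [s, b] with s > 0, and then s tends to 0. *)
Lemma derive_le0_le (R : realType) (v dv : R -> R) (b : R) : 0 < b ->
  (forall t, 0 < t -> t <= b -> is_derive t (1 : R) v (dv t)) ->
  (forall t, 0 < t -> t < b -> dv t <= 0) ->
  v s @[s --> 0^'+] --> v 0 -> v b <= v 0.
Proof.
move=> b0 vd dv0 vc.
apply: (@ler_cvg_to _ (0 : R)^'+ _ _ (fun=> v b) v) => //; first exact: cvg_cst.
near=> s.
have s0 : 0 < s by [].
have sb : s < b by near: s; exact: nbhs_right_lt.
have [t||c] := @MVT R v dv s b sb.
- rewrite in_itv /= => /andP[st tb]; apply: vd; last exact: ltW.
  exact: lt_trans st.
- apply: derivable_within_continuous => t; rewrite in_itv /= => /andP[st tb].
  by apply: ex_derive; apply: vd => //; exact: lt_le_trans st.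
- rewrite in_itv /= => /andP[sc cb] e; rewrite -subr_le0 e.
  by rewrite mulr_le0_ge0 ?subr_ge0 ?(ltW sb)// dv0// (lt_trans s0).
Unshelve. all: by end_near. Qed.

Lemma solution_right_cvg (R : realType) N (U : set 'cV[R]_N) F T
    (x : R -> 'cV[R]_N) : (0 < T)%E -> solution U F T x ->
  x s @[s --> 0^'+] --> x 0.
Proof.
move=> T0 [_ /(_ T0) xd _].
have : h *: (h^-1 *: (x h - x 0)) @[h --> (0 : R)^'+] --> (0 : R) *: F (x 0).
  by apply: cvgZ => //; apply: cvg_at_right_filter; exact: cvg_id.
rewrite scale0r => xl.
have : (h *: (h^-1 *: (x h - x 0)) + x 0) @[h --> (0 : R)^'+] --> 0 + x 0.
  by apply: cvgD => //; exact: cvg_cst.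
rewrite add0r; apply: cvg_trans; apply: near_eq_cvg; near=> h.
have h0 : 0 < h by [].
by rewrite scalerA mulfV ?gt_eqF// scale1r subrK.
Unshelve. all: by end_near. Qed.

Lemma cvg_sumr (R : realType) (V : normedModType R) (T : Type)
    (Fl : set_system T) (FF : Filter Fl) (I : Type) (r : seq I)
    (f : I -> T -> V) (l : I -> V) :
  (forall i, f i x @[x --> Fl] --> l i) ->
  \sum_(i <- r) f i x @[x --> Fl] --> \sum_(i <- r) l i.
Proof.
move=> fl; elim: r => [|i r IH].
  under eq_fun do rewrite big_nil.
  by rewrite big_nil; exact: cvg_cst.
under eq_fun do rewrite big_cons.
by rewrite big_cons; apply: cvgD.
Qed.

Lemma cvg_form (R : realType) N (S : 'M[R]_N) (T : Type) (Fl : set_system T)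
    (FF : Filter Fl) (x : T -> 'cV[R]_N) (a : 'cV[R]_N) :
  x s @[s --> Fl] --> a -> form S (x s) (x s) @[s --> Fl] --> form S a a.
Proof.
move=> xa.
have -> : form S a a = \sum_i \sum_j a i 0 * S i j * a j 0 by exact: formE.
under eq_fun do rewrite formE.
have c i : x s i 0 @[s --> Fl] --> a i 0.
  by apply: (@cvg_comp _ _ _ x (fun M : 'cV[R]_N => M i 0) _ _ _ xa); exact: coord_continuous.
apply: cvg_sumr => i; apply: cvg_sumr => j.
by apply: cvgM => //; apply: cvgMl.
Qed.

(** * Attraction for one-sided Lipschitz vector fields *)

Lemma is_derive_shift_form (R : realType) N (S : 'M[R]_N) (x y : R -> 'cV[R]_N)
    (t : R) dx dy : S^T = S ->
  is_derive t (1 : R) x dx -> is_derive t (1 : R) y dy ->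
  is_derive t (1 : R) (fun s => form S (x s - y s) (x s - y s))
    (2 * form S (x t - y t) (dx - dy)).
Proof.
move=> ST xd yd.
exact: (@is_derive_form _ _ S (x - y) t (dx - dy) ST (is_deriveB xd yd)).
Qed.

Lemma is_derive_near_lt (R : realType) (v : R -> R) (t dv c : R) :
  is_derive t (1 : R) v dv -> v t < c ->
  exists2 eta, 0 < eta & forall s, `|s - t| < eta -> v s < c.
Proof.
move=> vd vt.
have vc : {for t, continuous v}.
  by apply: differentiable_continuous; apply/derivable1_diffP; exact: ex_derive.
have /vc : nbhs (v t) [set y | y < c] by exact: lt_nbhsl.
rewrite nbhs_filterE /= => /nbhs_ballP[eta /= e0 he]; exists eta => // s st.
by apply: (he s); rewrite -ball_normE /= distrC.
Qed.

(** If the form reaches rho, let ts be the infimum of the times when it does.  It is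
    nonincreasing on [0, ts], hence below rho at ts and, by continuity, shortly
    after ts: a contradiction. *)
Lemma stays_in_sublevel (R : realType) N (S : 'M[R]_N) U F (p : 'cV[R]_N)
    (T : \bar R) x (rho : R) : S^T = S -> (0 < T)%E -> solution U F T x ->
  (forall z, form S (z - p) (z - p) < rho -> form S (z - p) (F z) <= 0) ->
  form S (x 0 - p) (x 0 - p) < rho ->
  forall t : R, 0 <= t -> (t%:E < T)%E -> form S (x t - p) (x t - p) < rho.
Proof.
move=> ST T0 sol diss v0 t1 t10 t1T.
pose v t := form S (x t - p) (x t - p).
have vd t : 0 < t -> (t%:E < T)%E ->
    is_derive t (1 : R) v (2 * form S (x t - p) (F (x t))).
  move=> t0 tT; have [_ _ /(_ t t0 tT) xd] := sol.
  have := is_derive_shift_form ST xd (is_derive_cst p t 1).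
  by rewrite subr0.
have vc : v s @[s --> 0^'+] --> v 0.
  apply: cvg_form; apply: cvgB; last exact: cvg_cst.
  exact: solution_right_cvg sol.
rewrite ltNge; apply/negP => vt1.
(* ts is the infimum of E; eta keeps it away from 0, where v is only known to be
   continuous from the right *)
pose E := [set t : R | [/\ 0 <= t, t <= t1 & rho <= v t]].
have [eta eta0 veta] : exists2 eta, 0 < eta & forall s, 0 < s -> s < eta -> v s < rho.
  have /vc : nbhs (v 0) [set y | y < rho] by exact: lt_nbhsl.
  rewrite nbhs_filterE /= => /nbhs_ballP[e /= e0 he]; exists e => // s s0 se.
  by apply: (he s) => //; rewrite -ball_normE /= sub0r normrN gtr0_norm.
have Elb : lbound E eta.
  move=> t [t0 _ vt]; rewrite leNgt; apply/negP => teta.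
  move: t0; rewrite le_eqVlt => /orP[/eqP t0|t0].
    by move: vt; rewrite -t0 leNgt v0.
  by move: vt; rewrite leNgt veta.
have Et1 : E t1 by split.
have hE : has_inf E by split; [exists t1|exists eta].
pose ts := inf E.
have ts0 : 0 < ts by apply: (lt_le_trans eta0); apply: lb_le_inf => //; exists t1.
have tst1 : ts <= t1 by apply: ge_inf => //; exists eta.
have tT (t : R) : t <= ts -> (t%:E < T)%E.
  by move=> tts; apply: le_lt_trans t1T; rewrite lee_fin (le_trans tts).
have below s : 0 < s -> s < ts -> v s < rho.
  move=> s0 sts; rewrite ltNge; apply/negP => vs.
  have : ts <= s.
    by apply: ge_inf; [exists eta|split => //; rewrite ltW// (lt_le_trans sts)].
  by rewrite leNgt sts.
have : v ts <= v 0.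
  apply: (@derive_le0_le _ v (fun t => 2 * form S (x t - p) (F (x t))) ts ts0) => //.
  - by move=> t t0 tts; apply: vd => //; exact: tT.
  - by move=> t t0 tts; rewrite pmulr_rle0//; apply: diss; exact: below.
move=> vts; have {}vts := le_lt_trans vts v0.
have [eta' eta'0 veta'] := is_derive_near_lt (vd ts ts0 (tT ts (lexx _))) vts.
have [e [e0 et1 ve] ets] := inf_adherent eta'0 hE.
have tse : ts <= e by apply: ge_inf => //; exists eta.
move: ve; rewrite leNgt veta'// ger0_norm ?subr_ge0//.
by rewrite ltrBlDl.
Qed.

(** The nearest-point retraction onto a cube, which is a ball of the maximum norm:
    it extends a field given on the ball to a bounded Lipschitz field on the whole
    space. *)
Definition clamp (R : realType) N (r : R) (z : 'cV[R]_N) : 'cV[R]_N :=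
  \col_i Num.max (- r) (Num.min r (z i 0)).

Lemma clamp_norm (R : realType) N (r : R) (z : 'cV[R]_N) :
  0 <= r -> `|clamp r z| <= r.
Proof.
move=> r0; apply: col_norm_le => // i; rewrite mxE ler_norml.
by rewrite le_max lexx ge_max ge_min lexx /= andbT; lra.
Qed.

Lemma clamp_lip (R : realType) N (r : R) (z w : 'cV[R]_N) :
  0 <= r -> `|clamp r z - clamp r w| <= `|z - w|.
Proof.
move=> r0; apply: col_norm_le => // i.
rewrite (le_trans _ (mx_coord_le (z - w) i 0))// !mxE.
move: (z i 0) (w i 0) => a b; have := ler_norm (a - b); have := ler_norm (- (a - b)).
rewrite normrN; set n := `|a - b|; rewrite ler_norml.
by case: (leP r a); case: (leP r b) => *; rewrite /Num.max; do 2?case: ifP => ?;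
  apply/andP; split; lra.
Qed.

Lemma clamp_id (R : realType) N (r : R) (z : 'cV[R]_N) :
  `|z| <= r -> clamp r z = z.
Proof.
move=> zr; apply/matrixP => i j; rewrite mxE ord1.
have := le_trans (mx_coord_le z i 0) zr; rewrite ler_norml => /andP[h1 h2].
by rewrite min_r// max_r.
Qed.

Section attraction.
Variables (R : realType) (N : nat) (S : 'M[R]_N) (al c r0 L : R).
Variables (U : set 'cV[R]_N) (F : 'cV[R]_N -> 'cV[R]_N) (p : 'cV[R]_N).
Hypotheses (ST : S^T = S) (al0 : 0 < al) (c0 : 0 < c) (L0 : 0 <= L).
Hypothesis Slow : forall x : 'cV[R]_N, al * `|x| ^+ 2 <= form S x x.
Hypothesis ballU : forall z : 'cV[R]_N, `|z| <= r0 -> U z.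
Hypothesis F_lip : forall z w : 'cV[R]_N, `|z| <= r0 -> `|w| <= r0 ->
  `|F z - F w| <= L * `|z - w|.
Hypothesis F_diss : forall z w : 'cV[R]_N, `|z| <= r0 -> `|w| <= r0 ->
  form S (z - w) (F z - F w) <= - c * form S (z - w) (z - w).
Hypotheses (p_in : `|p| < r0) (Fp : F p = 0).

Let V z := form S (z - p) (z - p).
(* the largest level for which [Slow] keeps the sublevel set inside the ball *)
Let rho := al * (r0 - `|p|) ^+ 2.

Let form_ge0 z : 0 <= form S z z.
Proof. by apply: le_trans (Slow z); rewrite mulr_ge0 ?sqr_ge0// ltW. Qed.

Let sublevel_ball z : V z < rho -> `|z| <= r0.
Proof.
move=> Vz; have := le_lt_trans (Slow (z - p)) Vz.
rewrite ltr_pM2l// ltr_sqr ?nnegrE//; last by rewrite subr_ge0 ltW.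
move=> h.
have := ler_normD (z - p) p; rewrite subrK; lra.
Qed.

Let diss_p z : `|z| <= r0 -> form S (z - p) (F z) <= - c * V z.
Proof. by move=> zr; rewrite -[F z]subr0 -Fp F_diss// ltW. Qed.

Let Vdiss z : V z < rho -> form S (z - p) (F z) <= 0.
Proof.
move=> /sublevel_ball/diss_p/le_trans; apply.
by rewrite mulNr oppr_le0 mulr_ge0 ?(ltW c0)//; exact: form_ge0.
Qed.

Let solution_exists q : V q < rho ->
  exists y, [/\ solution U F +oo y, y 0 = q &
    forall t, 0 <= t -> V (y t) < rho].
Proof.
move=> Vq; have r00 : 0 <= r0 by rewrite (le_trans _ (ltW p_in)).
pose G z := F (clamp r0 z).
have G_lip z w : `|G z - G w| <= L * `|z - w|.
  rewrite (le_trans (F_lip _ _)) ?clamp_norm//.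
  by rewrite ler_wpM2l// clamp_lip.
have G_bound z : `|G z| <= L * (2 * r0).
  rewrite -[G z]subr0 -Fp (le_trans (F_lip _ _)) ?clamp_norm ?(ltW p_in)//.
  rewrite ler_wpM2l// (le_trans (ler_normB _ _))// mulr2n mulrDl mul1r.
  by rewrite lerD ?clamp_norm// ltW.
have [y [y0 yq]] := euler_limit G_bound G_lip L0 q.
have ysol : solution setT G +oo y.
  apply: quadratic_error_solution yq.
  by rewrite !mulr_ge0.
have ystay t : 0 <= t -> V (y t) < rho.
  move=> t0; apply: (stays_in_sublevel ST _ ysol) => //; last 2 first.
  - by rewrite y0.
  - exact: ltry.
  move=> z Vz; rewrite /G clamp_id ?sublevel_ball//; exact: Vdiss.
exists y; split => //; case: ysol => [_ yr yd].
have GF t : 0 <= t -> G (y t) = F (y t).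
  by move=> t0; rewrite /G clamp_id// sublevel_ball// ystay.
split=> [t t0 _|T0|t t0 tT].
- by apply: ballU; rewrite sublevel_ball// ystay.
- by rewrite -GF//; exact: yr.
- by rewrite -GF 1?ltW//; exact: yd.
Qed.

Let solution_unique T x y : solution U F T x -> solution U F +oo y ->
  x 0 = y 0 -> V (y 0) < rho -> (0 < T)%E ->
  forall t : R, 0 <= t -> (t%:E < T)%E -> x t = y t.
Proof.
move=> xs ys xy0 Vq T0.
have xin t : 0 <= t -> (t%:E < T)%E -> `|x t| <= r0.
  move=> t0 tT; apply: sublevel_ball; apply: (stays_in_sublevel ST T0 xs) => //.
  by rewrite xy0.
have yin t : 0 <= t -> `|y t| <= r0.
  by move=> t0; apply: sublevel_ball; apply: (stays_in_sublevel ST _ ys); rewrite ?ltry.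
move=> t t0 tT; have [->//|tn0] := eqVneq t 0.
have {tn0}t0' : 0 < t by rewrite lt_def tn0.
(* two solutions cannot separate: w is nonincreasing and vanishes at 0 *)
pose w s := form S (x s - y s) (x s - y s).
have : w t <= w 0.
  apply: (@derive_le0_le _ w (fun s => 2 * form S (x s - y s) (F (x s) - F (y s)))) => //.
  - move=> s s0 st; apply: is_derive_shift_form => //.
      by case: xs => _ _; apply => //; apply: le_lt_trans tT; rewrite lee_fin.
    by case: ys => _ _; apply => //; exact: ltry.
  - move=> s s0 st; rewrite pmulr_rle0// (le_trans (F_diss _ _))//.
    + apply: xin; first exact: ltW.
      by apply: lt_trans tT; rewrite lte_fin.
    + by apply: yin; exact: ltW.
    + by rewrite mulNr oppr_le0 mulr_ge0 ?(ltW c0)//; exact: form_ge0.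
  - apply: cvg_form; apply: cvgB; first exact: solution_right_cvg xs.
    by apply: solution_right_cvg ys; exact: ltry.
have -> : w 0 = 0 by rewrite /w xy0 subrr /form mulmx0 mxE.
move=> wt; have := le_trans (Slow (x t - y t)) wt.
rewrite pmulr_rle0// => h.
have : `|x t - y t| ^+ 2 = 0 by apply/eqP; rewrite eq_le h sqr_ge0.
by move/eqP; rewrite sqrf_eq0 normr_eq0 subr_eq0 => /eqP.
Qed.

Let solution_cvg y : solution U F +oo y -> V (y 0) < rho ->
  y t @[t --> +oo] --> p.
Proof.
move=> ys Vq.
have Vy t : 0 <= t -> V (y t) < rho.
  by move=> t0; apply: (stays_in_sublevel ST _ ys); rewrite ?ltry.
(* polynomial decay is enough for convergence and avoids the exponential; it comes
   from V' <= - 2 c V *)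
have dec t : 0 < t -> (1 + 2 * c * t) * V (y t) <= V (y 0).
  move=> t0; pose u s := (1 + 2 * c * s) * V (y s).
  suff : u t <= u 0 by rewrite /u mulr0 addr0 mul1r.
  pose du s := (2 * c) * V (y s) + (1 + 2 * c * s) * (2 * form S (y s - p) (F (y s))).
  apply: (@derive_le0_le _ u du) => //.
  - move=> s s0 st.
    have yd : is_derive s (1 : R) y (F (y s)) by case: ys => _ _; apply => //; exact: ltry.
    have Vd : is_derive s (1 : R) (fun s => V (y s)) (2 * form S (y s - p) (F (y s))).
      have := is_derive_shift_form ST yd (is_derive_cst p s 1).
      by rewrite subr0.
    have ld : is_derive s (1 : R) (fun s => 1 + 2 * c * s) (2 * c).
      have := is_deriveD (is_derive_cst (1 : R) s 1)
        (is_deriveZ (2 * c) (is_derive_id s (1 : R))).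
      by rewrite add0r -[_ *: 1]/(_ * 1) mulr1.
    have := is_deriveM ld Vd; rewrite /du addrC.
    by rewrite -![_ *: _]/(_ * _) [V _ * _]mulrC.
  - move=> s s0 st; have := diss_p (sublevel_ball (Vy s (ltW s0))).
    rewrite /du; have := form_ge0 (y s - p); rewrite -/(V (y s)).
    set v := V _; set f := form _ _ _ => v0 fv.
    have : 0 <= (1 + 2 * c * s) * (- c * v - f).
      by rewrite mulr_ge0 ?subr_ge0// addr_ge0// !mulr_ge0// ltW.
    have : 0 <= c * c * s * v by rewrite !mulr_ge0// ltW.
    lra.
  - have -> : u 0 = (1 + 2 * c * 0) * V (y 0) by [].
    apply: cvgM.
      apply: cvgD; first exact: cvg_cst.
      by apply: cvgMr; apply: cvg_at_right_filter; exact: cvg_id.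
    apply: cvg_form; apply: cvgB; last exact: cvg_cst.
    by apply: solution_right_cvg ys; exact: ltry.
apply/cvgrPdist_le => e e0.
have k0 : 0 < al * e ^+ 2 by rewrite mulr_gt0// exprn_gt0.
near=> t.
have t0 : 0 < t by near: t; exact: nbhs_pinfty_gt.
have tl : V (y 0) / (2 * c * (al * e ^+ 2)) < t.
  by near: t; apply: nbhs_pinfty_gt; exact: num_real.
have := dec t t0; have := Slow (y t - p).
rewrite -/(V (y t)) => h1 h2.
rewrite distrC leNgt; apply/negP => le.
move: tl; rewrite ltr_pdivrMr ?mulr_gt0// ltNge => /negP; apply.
apply: le_trans h2.
have : al * e ^+ 2 <= V (y t).
  apply: le_trans h1; rewrite ler_pM2l// ler_sqr ?nnegrE ?(ltW e0)//; exact: ltW.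
set W := V (y t) => h3.
have : 0 <= 2 * c * t * (W - al * e ^+ 2) by rewrite !mulr_ge0 ?subr_ge0// ltW.
have : 0 <= W by exact: form_ge0.
lra.
Unshelve. all: by end_near. Qed.

(** Every solution that starts in the sublevel set agrees with a global one, so a
    trajectory, being maximal, must itself be global. *)
Lemma attracts_of_dissipative : attracts_nearby U F p.
Proof.
have [C C0 CP] := form_bound S.
have rho0 : 0 < rho by rewrite mulr_gt0// exprn_gt0// subr_gt0.
exists (Num.min 1 (rho / C)); first by rewrite lt_min ltr01 divr_gt0.
move=> q; rewrite lt_min => /andP[q1 qC].
have Vq : V q < rho.
  apply: (le_lt_trans (ler_norm _)); apply: (le_lt_trans (CP _ _)).
  apply: (@le_lt_trans _ _ (C * `|q - p|)).
    by rewrite ler_piMr ?mulr_ge0 ?(ltW q1) ?(ltW C0).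
  by rewrite mulrC -ltr_pdivlMr.
have [y [ys yq Vy]] := solution_exists Vq.
split.
  exists +oo%E, y; split => //; split => // S' z.
  by rewrite ltNge leey.
move=> T x [T0 xs xmax] xq.
have xy : forall t : R, 0 <= t -> (t%:E < T)%E -> x t = y t.
  by apply: solution_unique; rewrite ?yq// xq.
have Too : T = +oo%E.
  apply/eqP; rewrite -leye_eq leNgt; apply/negP => Tlt.
  by apply: (xmax +oo%E y Tlt ys) => t t0 tT; rewrite xy.
split => //.
have yc : y t @[t --> +oo] --> p by apply: solution_cvg => //; rewrite yq.
apply: cvg_trans yc; apply: near_eq_cvg; near=> t.
by rewrite xy// Too ltry.
Unshelve. all: by end_near. Qed.

End attraction.

(** * Strict differentiability *)

(** Strict (Peano) differentiability: unlike differentiability at p it compares two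
    arbitrary points near p, so f - L is a contraction there with a constant as
    small as desired.  It is stated without derivatives because it must be
    available both for C^1 and for analytic maps. *)
Definition strict_diff (R : realType) m n (f : 'cV[R]_m -> 'cV[R]_n) (p : 'cV[R]_m)
    (L : 'M[R]_(n, m)) : Prop :=
  forall eps : R, 0 < eps -> exists2 d, 0 < d & forall u v,
    `|u - p| < d -> `|v - p| < d -> `|f u - f v - L *m (u - v)| <= eps * `|u - v|.

Lemma strict_diff_near_eq (R : realType) m n (f g : 'cV[R]_m -> 'cV[R]_n) p L (d : R) :
  0 < d -> (forall u, `|u - p| < d -> f u = g u) -> strict_diff f p L -> strict_diff g p L.
Proof.
move=> d0 fg fL e e0; have [d' d'0 h] := fL e e0.
exists (Num.min d d'); first by rewrite lt_min d0.
move=> u v; rewrite !lt_min => /andP[u1 u2] /andP[v1 v2].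
by rewrite -!fg//; exact: h.
Qed.

Lemma strict_diffD (R : realType) m n (f g : 'cV[R]_m -> 'cV[R]_n) p L M :
  strict_diff f p L -> strict_diff g p M -> strict_diff (fun u => f u + g u) p (L + M).
Proof.
move=> fL gM e e0; have e2 : 0 < e / 2 by rewrite divr_gt0.
have [d d0 h] := fL _ e2; have [d' d'0 h'] := gM _ e2.
exists (Num.min d d'); first by rewrite lt_min d0.
move=> u v; rewrite !lt_min => /andP[u1 u2] /andP[v1 v2].
have -> : f u + g u - (f v + g v) - (L + M) *m (u - v) =
    (f u - f v - L *m (u - v)) + (g u - g v - M *m (u - v)).
  rewrite mulmxDl; move: (L *m _) (M *m _) => X Y.
  by apply/matrixP => i j; rewrite !mxE; ring.
rewrite (le_trans (ler_normD _ _))//.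
by rewrite [e]splitr mulrDl lerD ?h ?h'.
Qed.

Lemma strict_diff_mulmx (R : realType) m n (M : 'M[R]_(n, m)) p :
  strict_diff (fun u => M *m u) p M.
Proof.
move=> e e0; exists 1 => // u v _ _.
by rewrite -mulmxBr subrr normr0 mulr_ge0// ltW.
Qed.

Lemma strict_diff_comp_mulmx (R : realType) m n k (f : 'cV[R]_m -> 'cV[R]_n)
    (B : 'M[R]_(m, k)) p L :
  strict_diff f (B *m p) L -> strict_diff (fun u => f (B *m u)) p (L *m B).
Proof.
move=> fL e e0; have [K K0 KP] := mulmx_bound B.
have eK : 0 < e / K by rewrite divr_gt0.
have [d d0 h] := fL _ eK; exists (d / K) => [|u v ud vd]; first by rewrite divr_gt0.
have c w : `|w - p| < d / K -> `|B *m w - B *m p| < d.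
  move=> wd; rewrite -mulmxBr (le_lt_trans (KP _ _))//.
  by rewrite mulrC -ltr_pdivlMr.
have := h _ _ (c u ud) (c v vd); rewrite -mulmxA -mulmxBr => /le_trans; apply.
by rewrite mulrAC ler_pdivrMr// -mulrA ler_pM2l// mulrC KP.
Qed.

Lemma strict_diff_scale_coord (R : realType) m n (g : 'cV[R]_m -> 'cV[R]_n)
    (k : 'I_m) p L :
  strict_diff g p L ->
  strict_diff (fun u => u k 0 *: g u) p (p k 0 *: L + g p *m delta_mx 0 k).
Proof.
move=> gL e e0; have [K K0 KP] := mulmx_bound L.
pose c : R := `|p k 0| + 1.
have c0 : 0 < c by rewrite ltr_wpDl.
have e4 : 0 < e / (4 * c) by rewrite divr_gt0// mulr_gt0.
have [d d0 h] := gL _ e4; have [d' d'0 h'] := gL _ ltr01.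
have K1 : 0 < K + 1 by rewrite ltr_wpDl// ltW.
exists (Num.min (Num.min 1 (e / (4 * (K + 1)))) (Num.min d d')).
  by rewrite !lt_min ltr01 d0 d'0 divr_gt0// mulr_gt0.
move=> u v; rewrite !lt_min => /andP[/andP[u1 ue] /andP[ud ud']].
move=> /andP[/andP[v1 ve] /andP[vd vd']].
(* the first term uses strictness, the second that u is close to p, the third that
   v is *)
have -> : u k 0 *: g u - v k 0 *: g v - (p k 0 *: L + g p *m delta_mx 0 k) *m (u - v)
  = u k 0 *: (g u - g v - L *m (u - v)) +
    ((u k 0 - p k 0) *: (L *m (u - v)) + (u k 0 - v k 0) *: (g v - g p)).
  rewrite mulmxDl -mulmxA -rowE -scalemxAl.
  have -> : g p *m row k (u - v) = (u k 0 - v k 0) *: g p.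
    by apply/matrixP => i j; rewrite !mxE big_ord1 !mxE !ord1 mulrC.
  move: (L *m _) => X; apply/matrixP => i j; rewrite !mxE; ring.
have pk w : `|w - p| < 1 -> `|w k 0| <= c.
  move=> wp; have := mx_coord_le (w - p) k 0; rewrite !mxE => hk.
  have -> : w k 0 = p k 0 + (w k 0 - p k 0) by rewrite addrC subrK.
  by rewrite (le_trans (ler_normD _ _))// lerD2l (le_trans hk)// ltW.
have uvk : `|u k 0 - v k 0| <= `|u - v|.
  by have := mx_coord_le (u - v) k 0; rewrite !mxE.
have t1 : `|u k 0 *: (g u - g v - L *m (u - v))| <= e / 4 * `|u - v|.
  rewrite normrZ (@le_trans _ _ (c * (e / (4 * c) * `|u - v|)))//.
    by rewrite ler_pM// ?pk// h.
  have cn0 : c != 0 by rewrite gt_eqF.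
  by rewrite (_ : c * _ = e / 4 * `|u - v|)//; field.
have t2 : `|(u k 0 - p k 0) *: (L *m (u - v))| <= e / 4 * `|u - v|.
  rewrite normrZ (@le_trans _ _ (e / (4 * (K + 1)) * ((K + 1) * `|u - v|)))//.
    rewrite ler_pM//.
      by have := mx_coord_le (u - p) k 0; rewrite !mxE => /le_trans; apply; exact: ltW.
    by rewrite (le_trans (KP _ _))// ler_wpM2r// lerDl.
  have Kn0 : K + 1 != 0 by rewrite gt_eqF.
  by rewrite (_ : _ * ((K + 1) * _) = e / 4 * `|u - v|)//; field.
have t3 : `|(u k 0 - v k 0) *: (g v - g p)| <= `|u - v| * (e / 4).
  rewrite normrZ ler_pM//.
  have gv : `|g v - g p| <= (K + 1) * `|v - p|.
    have pd' : `|p - p| < d' by rewrite subrr normr0.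
    have := h' v p vd' pd'; rewrite mul1r => hv.
    have -> : g v - g p = (g v - g p - L *m (v - p)) + L *m (v - p) by rewrite subrK.
    by rewrite (le_trans (ler_normD _ _))// mulrDl mul1r addrC lerD.
  rewrite (le_trans gv)// mulrC -ler_pdivlMr// -mulrA -invfM ltW//.
rewrite (le_trans (ler_normD _ _))//.
have t4 := ler_normD ((u k 0 - p k 0) *: (L *m (u - v))) ((u k 0 - v k 0) *: (g v - g p)).
have : 0 <= e * `|u - v| by rewrite mulr_ge0// ltW.
move: t1 t2 t3 t4; set a := `|_|; set b := `|_|; set c' := `|_|; set d'' := `|_|; lra.
Qed.

(** If f - L is eps-Lipschitz on a ball around p, then eps also bounds
    the derivative of f - L at any other point q of the ball, because a strict
    derivative is a limit of difference quotients. *)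
Lemma strict_diff_close (R : realType) m n (f : 'cV[R]_m -> 'cV[R]_n) p q L M
    (eps d : R) : (forall u v,
      `|u - p| < d -> `|v - p| < d -> `|f u - f v - L *m (u - v)| <= eps * `|u - v|) ->
  `|q - p| < d -> strict_diff f q M ->
  forall w : 'cV[R]_m, `|(M - L) *m w| <= eps * `|w|.
Proof.
move=> fL qd fM w; apply/ler_addgt0Pr => eta eta0.
have w1 : 0 < `|w| + 1 by rewrite ltr_wpDl.
have [d' d'0 fM'] := fM (eta / (`|w| + 1)) (divr_gt0 eta0 w1).
have [t [t0 td td']] : exists t : R, [/\ 0 < t, t <= (d - `|q - p|) / 2 & t <= d' / 2].
  exists (Num.min ((d - `|q - p|) / 2) (d' / 2)); split.
  - by rewrite lt_min !divr_gt0// subr_gt0.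
  - by rewrite ge_min lexx.
  - by rewrite ge_min lexx orbT.
have dq : 0 < d - `|q - p| by rewrite subr_gt0.
pose h := t / (`|w| + 1); have h0 : 0 < h by rewrite divr_gt0.
have hw : `|h *: w| <= t.
  rewrite normrZ gtr0_norm// /h mulrAC ler_pdivrMr// ler_wpM2l ?(ltW t0)//.
  by rewrite lerDl.
have hd : `|h *: w + q - p| < d.
  by rewrite -addrA (le_lt_trans (ler_normD _ _))//; lra.
have hd' : `|h *: w + q - q| < d' by rewrite addrK; lra.
have := fL _ _ hd qd; have := fM' (h *: w + q) q hd'.
rewrite subrr normr0 => /(_ d'0); rewrite addrK => h1 h2.
rewrite -(ler_pM2l h0) -{1}(gtr0_norm h0) -normrZ scalemxAr.
have -> : (M - L) *m (h *: w) = (f (h *: w + q) - f q - L *m (h *: w)) -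
    (f (h *: w + q) - f q - M *m (h *: w)).
  rewrite mulmxBl; move: (f _) (f _) (M *m _) (L *m _) => a b c c'.
  by apply/matrixP => i j; rewrite !mxE; ring.
rewrite (le_trans (ler_normB _ _))// (le_trans (lerD h2 h1))//.
rewrite normrZ (gtr0_norm h0) mulrDr mulrCA lerD2l mulrCA ler_pM2l//.
by rewrite mulrAC ler_pdivrMr// ler_pM2l// lerDl.
Qed.

Lemma unitmx_of_injective (R : realType) n (M : 'M[R]_n) :
  (forall w : 'cV[R]_n, M *m w = 0 -> w = 0) -> M \in unitmx.
Proof.
move=> Minj; rewrite -unitmx_tr -row_free_unit -kermx_eq0.
apply/eqP/row_matrixP => i; rewrite row0.
apply/(can_inj (@trmxK _ _ _)); rewrite trmx0; apply: Minj.
by rewrite -{1}[M]trmxK -trmx_mul -row_mul mulmx_ker row0 trmx0.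
Qed.

(** The hypothesis on A bounds its inverse by k, and a perturbation smaller than
    1/k leaves the kernel trivial. *)
Lemma unitmx_perturb (R : realType) n (A B : 'M[R]_n) (k eps : R) :
  (forall w : 'cV[R]_n, `|w| <= k * `|A *m w|) ->
  (forall w : 'cV[R]_n, `|(B - A) *m w| <= eps * `|w|) ->
  0 <= k -> k * eps < 1 -> B \in unitmx.
Proof.
move=> Ak BA k0 ke; apply: unitmx_of_injective => w Bw.
have := BA w; rewrite mulmxBl Bw sub0r normrN => Aw.
have : `|w| <= k * (eps * `|w|) by rewrite (le_trans (Ak w))// ler_wpM2l.
rewrite mulrA => h; apply/eqP; rewrite -normr_eq0 eq_le normr_ge0 andbT.
rewrite leNgt; apply/negP => w0.
by move: h; rewrite leNgt -[ltRHS]mul1r ltr_pM2r// ke.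
Qed.

(** * The branch of zeros through a nondegenerate zero *)

(** The column (x; e), in the encoding of pairs used for joint regularity. *)
Definition pair_col (R : realType) N (x : 'cV[R]_N) (e : R) : 'cV[R]_(N + 1) :=
  col_mx x (const_mx e).

Lemma pair_colB (R : realType) N (x y : 'cV[R]_N) (e e' : R) :
  pair_col x e - pair_col y e' = pair_col (x - y) (e - e').
Proof.
rewrite /pair_col opp_col_mx add_col_mx; congr col_mx.
by apply/matrixP => i j; rewrite !mxE.
Qed.

Lemma pair_col0 (R : realType) N : pair_col 0 0 = 0 :> 'cV[R]_(N + 1).
Proof.
by rewrite /pair_col -[RHS]col_mx0; congr col_mx.
Qed.

Lemma pair_col_norm_le (R : realType) N (x : 'cV[R]_N) (e c : R) : 0 <= c ->
  `|x| <= c -> `|e| <= c -> `|pair_col x e| <= c.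
Proof.
move=> c0 xc ec; apply: col_norm_le => // i.
rewrite mxE; case: fintype.splitP => j _; last by rewrite mxE.
by rewrite (le_trans (mx_coord_le _ _ _)).
Qed.

Lemma pair_col_norm_lt (R : realType) N (x : 'cV[R]_N) (e c : R) :
  `|x| < c -> `|e| < c -> `|pair_col x e| < c.
Proof.
move=> xc ec; apply: (@le_lt_trans _ _ (Num.max `|x| `|e|)).
  by apply: pair_col_norm_le; rewrite le_max ?normr_ge0 ?lexx ?orbT.
by rewrite gt_max xc.
Qed.

Lemma pair_col_norm_add (R : realType) N (x : 'cV[R]_N) (e : R) :
  `|pair_col x e| <= `|x| + `|e|.
Proof. by apply: pair_col_norm_le; rewrite ?addr_ge0// ?lerDl ?lerDr. Qed.

Lemma mulmx_pair_col (R : realType) N k (L : 'M[R]_(k, N + 1)) x (e : R) :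
  L *m pair_col x e = lsubmx L *m x + e *: rsubmx L.
Proof.
rewrite -{1}[L]hsubmxK /pair_col mul_row_col; congr (_ + _).
by apply/matrixP => i j; rewrite !mxE big_ord1 !mxE !ord1 mulrC.
Qed.

(** Matrices over the reals form a Banach space: this joins the completeness and
    the norm structures, so that the contraction principle applies to them. *)
HB.instance Definition _ (R : realType) m n := Complete.on 'M[R]_(m, n).

(** The simplified Newton map Phi e is 1/2-contracting on the ball of radius r for
    all small e at once.  Applying the strict derivative to two zeros
    (tau e, e) and (tau e', e') gives the Lipschitz bound. *)
Lemma implicit_branch (R : realType) N (F : 'cV[R]_(N + 1) -> 'cV[R]_N)
    (L : 'M[R]_(N, N + 1)) (r0 : R) :
  strict_diff F 0 L -> F 0 = 0 -> lsubmx L \in unitmx -> 0 < r0 ->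
  exists (r e0 K : R) (tau : R -> 'cV[R]_N),
    [/\ 0 < r <= r0, 0 < e0,
     forall e, `|e| < e0 -> `|tau e| < r /\ F (pair_col (tau e) e) = 0,
     forall e x, `|e| < e0 -> `|x| <= r -> F (pair_col x e) = 0 -> x = tau e &
     forall e e', `|e| < e0 -> `|e'| < e0 -> `|tau e - tau e'| <= K * `|e - e'|].
Proof.
move=> FL F0 Au r00; pose A := lsubmx L; pose b := rsubmx L.
have [k k0 kP] := mulmx_bound (invmx A).
have ek : 0 < (2 * k)^-1 by rewrite invr_gt0 mulr_gt0.
have [d d0 Fd] := FL _ ek.
pose r := Num.min r0 (d / 2).
have r_gt0 : 0 < r by rewrite lt_min r00 divr_gt0.
have rd : r < d.
  by rewrite gt_min [X in _ || X]ltr_pdivrMr// mulr_natr mulr2n ltrDl d0 orbT.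
have Fxy x y e e' : `|x| <= r -> `|y| <= r -> `|e| < d -> `|e'| < d ->
    `|F (pair_col x e) - F (pair_col y e') - (A *m (x - y) + (e - e') *: b)| <=
    (2 * k)^-1 * (`|x - y| + `|e - e'|).
  move=> xr yr ed e'd; rewrite -mulmx_pair_col -pair_colB (le_trans (Fd _ _ _ _))//.
  - by rewrite subr0 pair_col_norm_lt// (le_lt_trans xr).
  - by rewrite subr0 pair_col_norm_lt// (le_lt_trans yr).
  - by rewrite ler_pM2l// pair_colB pair_col_norm_add.
pose Phi e x := x - invmx A *m F (pair_col x e).
have Phi_contr e x y : `|e| < d -> `|x| <= r -> `|y| <= r ->
    `|Phi e x - Phi e y| <= 2^-1 * `|x - y|.
  move=> ed xr yr; have := Fxy x y e e xr yr ed ed.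
  rewrite subrr scale0r addr0 normr0 addr0 => h.
  have -> : Phi e x - Phi e y =
      - (invmx A *m (F (pair_col x e) - F (pair_col y e) - A *m (x - y))).
    rewrite /Phi mulmxBr mulKmx// mulmxBr.
    by move: (invmx A *m _) (invmx A *m _) => X Y; apply/matrixP => i j; rewrite !mxE; ring.
  rewrite normrN (le_trans (kP _ _))// mulrC -ler_pdivlMr// (le_trans h)//.
  by rewrite invfM mulrAC.
have Phi0 e : `|e| < d -> `|Phi e 0| <= k * (((2 * k)^-1 + `|b|) * `|e|).
  move=> ed; rewrite /Phi sub0r normrN (le_trans (kP _ _))// ler_pM2l//.
  have d00 : `|0 : R| < d by rewrite normr0.
  have r0' : `|0 : 'cV[R]_N| <= r by rewrite normr0 ltW.
  have := Fxy 0 0 e 0 r0' r0' ed d00.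
  rewrite pair_col0 F0 !subr0 mulmx0 add0r normr0 add0r => h.
  have -> : F (pair_col 0 e) = F (pair_col 0 e) - e *: b + e *: b by rewrite subrK.
  by rewrite (le_trans (ler_normD _ _))// mulrDl lerD// normrZ mulrC.
pose c := k * ((2 * k)^-1 + `|b|).
have c0 : 0 < c by rewrite mulr_gt0// ltr_wpDr.
pose e0 := Num.min d (r / (4 * c)).
have e00 : 0 < e0 by rewrite lt_min d0 divr_gt0// mulr_gt0.
have uniq e x y : `|e| < d -> `|x| <= r -> `|y| <= r ->
    F (pair_col x e) = 0 -> F (pair_col y e) = 0 -> x = y.
  move=> ed xr yr Fx Fy; have := Phi_contr e x y ed xr yr.
  rewrite /Phi Fx Fy mulmx0 !subr0 => h; apply/eqP; rewrite -subr_eq0 -normr_eq0.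
  by rewrite eq_le normr_ge0 andbT; move: h; set n := `|_|; lra.
have ex e : `|e| < e0 -> exists x : 'cV[R]_N, `|x| < r /\ F (pair_col x e) = 0.
  rewrite lt_min => /andP[ed ec].
  (* the half-radius leaves the fixed point strictly inside the ball *)
  pose B := [set x : 'cV[R]_N | `|x| <= r / 2].
  have r2r : r / 2 < r by rewrite ltr_pdivrMr// mulr_natr mulr2n ltrDl.
  have PhiB : set_fun B B (Phi e).
    move=> x /= xr; have xr' := le_trans xr (ltW r2r).
    have r0' : `|0 : 'cV[R]_N| <= r by rewrite normr0 ltW.
    have -> : Phi e x = (Phi e x - Phi e 0) + Phi e 0 by rewrite subrK.
    apply: (le_trans (ler_normD _ _)).
    have h1 := Phi_contr e x 0 ed xr' r0'; rewrite subr0 in h1.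
    have h2 : `|Phi e 0| <= r / 4.
      rewrite (le_trans (Phi0 e ed))// mulrA -/c mulrC -ler_pdivlMr//.
      by rewrite -mulrA -invfM ltW.
    have {}xr : `|x| <= r / 2 := xr.
    by move: h1 h2 xr; set u := `|_|; set v := `|_|; set w := `|_|; lra.
  have [|||x xB xfix] := @banach_fixed_point R _ B (mkfun_fun PhiB).
  - exists (2^-1)%:nng; split; first by rewrite /= invf_lt1// ltr1n.
    move=> -[x y] /= [xB yB]; apply: Phi_contr => //.
      exact: le_trans xB (ltW r2r).
    exact: le_trans yB (ltW r2r).
  - apply: (@closed_comp _ _ (fun x : 'cV[R]_N => `|x|) [set y : R | y <= r / 2]).
      by move=> x _; exact: norm_continuous.
    exact: closed_le.
  - by exists 0; rewrite /B /= normr0 divr_ge0// ltW.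
  exists x; split; first exact: le_lt_trans xB r2r.
  have : invmx A *m F (pair_col x e) = 0.
    have : x = x - invmx A *m F (pair_col x e) := xfix.
    by move/eqP; rewrite -subr_eq0 opprB addrC subrK => /eqP.
  by move/(congr1 (mulmx A)); rewrite mulKVmx// mulmx0.
have [tau tauP] : {tau : R -> 'cV[R]_N & forall e, `|e| < e0 ->
    `|tau e| < r /\ F (pair_col (tau e) e) = 0}.
  apply: (@boolp.choice R 'cV[R]_N
    (fun e x => `|e| < e0 -> `|x| < r /\ F (pair_col x e) = 0)) => e.
  have [/ex[x xP]|_] := ltP `|e| e0; first by exists x.
  by exists 0.
have e0d (e : R) : `|e| < e0 -> `|e| < d by rewrite lt_min => /andP[].
exists r, e0, (2 * c), tau; split => //.
- by rewrite r_gt0 ge_min lexx.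
- move=> e x ee xr Fx; have [tr Ft] := tauP e ee.
  by apply: (uniq e) => //; [exact: e0d|exact: ltW].
move=> e e' ee ee'; have [tr Ft] := tauP e ee; have [tr' Ft'] := tauP e' ee'.
have := Fxy _ _ _ _ (ltW tr) (ltW tr') (e0d _ ee) (e0d _ ee').
rewrite Ft Ft' subrr sub0r normrN => h.
set x := tau e - tau e' in h *; set s := e - e' in h *.
have h2 : `|x| <= k * (`|A *m x + s *: b| + `|s| * `|b|).
  rewrite -{1}[x](mulKmx Au) (le_trans (kP _ _))// ler_pM2l//.
  rewrite -{1}[A *m x](addrK (s *: b)).
  by rewrite (le_trans (ler_normB _ _))// normrZ.
have h3 : k * `|A *m x + s *: b| <= 2^-1 * (`|x| + `|s|).
  by rewrite mulrC -ler_pdivlMr// (le_trans h)// invfM mulrAC.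
have kk : k * (2 * k)^-1 = 2^-1 by rewrite invfM mulrCA divff ?gt_eqF// mulr1.
rewrite /c mulrDr kk.
rewrite mulrDr in h2.
have {h2 h3} := le_trans h2 (lerD h3 (lexx _)).
set X := `|x|; set Y := `|s|; set B := `|b|.
lra.
Qed.

(** * Functions of class C^k *)

(** The same recursion as for C^k maps between column spaces, but with values in an
    arbitrary normed module: scalar functions can then be multiplied and inverted,
    which is what Cramer's formula requires. *)
Fixpoint CkV (R : realType) (W V : normedModType R) (k : nat) (O : set W)
    (f : W -> V) : Prop :=
  match k with
  | 0 => forall x, O x -> {for x, continuous f}
  | k'.+1 => (forall x, O x -> differentiable f x) /\
             (forall v : W, CkV k' O ('D_v f))
  end.

Lemma CkVE (R : realType) m n k (O : set 'cV[R]_m) (f : 'cV[R]_m -> 'cV[R]_n) :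
  Ck k O f <-> CkV k O f.
Proof.
elim: k f => [//|k IH] f /=; split=> -[fd fv]; split=> // v; exact/IH/fv.
Qed.

Lemma near_eq_differentiable (R : realType) (W V : normedModType R)
    (f g : W -> V) x : {near x, f =1 g} -> differentiable f x -> differentiable g x.
Proof.
move=> fg fd; have fgx : f x = g x := nbhs_singleton fg.
pose h := g - f.
have hx : h x = 0 by rewrite /h -[LHS]/(g x - f x) fgx subrr.
have ho : h \o shift x = cst (h x) + \0 +o_ 0 id.
  apply/eqaddoP => _/posnumP[e].
  have : \forall y \near (0 : W), f (y + x) = g (y + x).
    have : (fun y : W => y + x) @ (0 : W) --> x.
      rewrite -[X in _ --> X]add0r; apply: cvgD; [exact: cvg_id|exact: cvg_cst].
    by move/(_ _ fg).
  apply: filterS => y fgy.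
  rewrite [X in `|X|](_ : _ = 0) ?normr0 ?mulr_ge0//.
  by rewrite -[LHS]/(g (y + x) - f (y + x) - (h x + 0)) hx fgy subrr addr0 subr0.
have hdiff : 'd h x = \0 :> (W -> V).
  by apply: (@diff_unique _ _ _ h \0 x) ho; exact: cst_continuous.
have hd : differentiable h x.
  apply/diff_locallyP; rewrite hdiff; split => //; exact: cst_continuous.
have -> : g = f + h by rewrite /h addrC subrK.
exact: differentiableD.
Qed.

(** Directional derivatives at a point of an open set depend only on the germ, so
    the recursion can be carried out on formulas valid on O only. *)
Lemma CkV_eq (R : realType) (W V : normedModType R) k (O : set W) (f g : W -> V) :
  open O -> (forall x, O x -> f x = g x) -> CkV k O f -> CkV k O g.
Proof.
move=> oO; elim: k f g => [|k IH] f g fg /=.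
  move=> fc x Ox; rewrite /prop_for /continuous_at -fg//.
  apply: cvg_trans (fc x Ox); apply: near_eq_cvg.
  by apply: filterS (open_nbhs_nbhs (conj oO Ox)) => y Oy; rewrite fg.
have nfg x : O x -> {near x, f =1 g}.
  by move=> Ox; apply: filterS (open_nbhs_nbhs (conj oO Ox)) => y Oy; rewrite fg.
move=> [fd fv]; split=> [x Ox|v].
  exact: near_eq_differentiable (nfg x Ox) (fd x Ox).
have [->|v0] := eqVneq v 0.
  apply: IH (fv 0) => x Ox; by rewrite !derive0.
by apply: IH (fv v) => x Ox; apply: near_eq_derive => //; exact: nfg.
Qed.

Lemma CkV_sub (R : realType) (W V : normedModType R) k (O O' : set W) (f : W -> V) :
  O' `<=` O -> CkV k O f -> CkV k O' f.
Proof.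
move=> OO; elim: k f => [|k IH] f /=; first by move=> fc x /OO; exact: fc.
by move=> [fd fv]; split=> [x /OO/fd//|v]; exact/IH/fv.
Qed.

Lemma CkVW (R : realType) (W V : normedModType R) k (O : set W) (f : W -> V) :
  CkV k.+1 O f -> CkV k O f.
Proof.
elim: k f => [|k IH] f /= [fd fv].
  by move=> x /fd; exact: differentiable_continuous.
by split => // v; exact: IH.
Qed.

Lemma CkV_leq (R : realType) (W V : normedModType R) j k (O : set W) (f : W -> V) :
  (j <= k)%N -> CkV k O f -> CkV j O f.
Proof.
elim: k => [|k IH]; first by rewrite leqn0 => /eqP->.
rewrite leq_eqVlt => /orP[/eqP->//|jk fC]; apply: IH; [exact: jk|exact: CkVW].
Qed.

Lemma CkV_cst (R : realType) (W V : normedModType R) k (O : set W) (c : V) :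
  open O -> CkV k O (cst c : W -> V).
Proof.
move=> oO; elim: k c => [|k IH] c; first by move=> x _; exact: cst_continuous.
split=> // v; apply: (@CkV_eq _ _ _ k O (cst 0)) => // x _.
by rewrite derive_cst.
Qed.

Lemma CkVD (R : realType) (W V : normedModType R) k (O : set W) (f g : W -> V) :
  open O -> CkV k O f -> CkV k O g -> CkV k O (fun x => f x + g x).
Proof.
move=> oO; elim: k f g => [|k IH] f g /=.
  by move=> fc gc x Ox; apply: continuousD; [exact: fc|exact: gc].
move=> [fd fv] [gd gv]; split=> [x Ox|v].
  by apply: differentiableD; [exact: fd|exact: gd].
apply: (@CkV_eq _ _ _ k O (fun x => 'D_v f x + 'D_v g x)) => //; last exact: IH.
move=> x Ox; rewrite -[in RHS]/(f + g) deriveD//; apply: diff_derivable.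
  exact: fd.
exact: gd.
Qed.

Lemma CkVM (R : realType) (W : normedModType R) k (O : set W) (f g : W -> R) :
  open O -> CkV k O f -> CkV k O g -> CkV k O (fun x => f x * g x).
Proof.
move=> oO; elim: k f g => [|k IH] f g.
  by move=> /= fc gc x Ox; apply: continuousM; [exact: fc|exact: gc].
move=> fC gC; have := fC; have := gC => -[gd gv] [fd fv]; split=> [x Ox|v].
  by apply: differentiableM; [exact: fd|exact: gd].
apply: (@CkV_eq _ _ _ k O (fun x => f x * 'D_v g x + g x * 'D_v f x)) => //.
  move=> x Ox; rewrite -[in RHS]/(f * g) deriveM//; apply: diff_derivable.
    exact: fd.
  exact: gd.
by apply: CkVD => //; apply: IH; first [exact: CkVW|exact: fv|exact: gv].
Qed.

Lemma CkVV (R : realType) (W : normedModType R) k (O : set W) (f : W -> R) :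
  open O -> (forall x, O x -> f x != 0) -> CkV k O f ->
  CkV k O (fun x => (f x)^-1).
Proof.
move=> oO f0; elim: k => [|k IH].
  by move=> /= fc x Ox; apply: continuousV; [exact: f0|exact: fc].
move=> fC; have := fC => -[fd fv]; split=> [x Ox|v].
  by apply: differentiableV; [exact: fd|exact: f0].
apply: (@CkV_eq _ _ _ k O
   (fun x => (- 1) * ((f x)^-1 * (f x)^-1) * 'D_v f x)) => //.
  move=> x Ox; rewrite deriveV ?f0//; last by apply: diff_derivable; exact: fd.
  by rewrite -[RHS]/(_ * _) mulN1r expr2 invfM.
have fi : CkV k O (fun x => (f x)^-1) by apply: IH; exact: CkVW.
apply: CkVM => //; last exact: fv.
apply: CkVM => //; first exact: CkV_cst.
exact: CkVM.
Qed.

Lemma CkV_sum (R : realType) (W V : normedModType R) k (O : set W) (I : Type)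
    (r : seq I) (f : I -> W -> V) :
  open O -> (forall i, CkV k O (f i)) -> CkV k O (fun x => \sum_(i <- r) f i x).
Proof.
move=> oO fC; elim: r => [|i r IH].
  by apply: CkV_eq (CkV_cst k 0 oO) => // x _; rewrite big_nil.
apply: (@CkV_eq _ _ _ k O (fun x => f i x + \sum_(j <- r) f j x)) => //.
  by move=> x _; rewrite big_cons.
exact: CkVD.
Qed.

Lemma CkV_prod (R : realType) (W : normedModType R) k (O : set W) (I : Type)
    (r : seq I) (f : I -> W -> R) :
  open O -> (forall i, CkV k O (f i)) -> CkV k O (fun x => \prod_(i <- r) f i x).
Proof.
move=> oO fC; elim: r => [|i r IH].
  by apply: CkV_eq (CkV_cst k (1 : R) oO) => // x _; rewrite big_nil.
apply: (@CkV_eq _ _ _ k O (fun x => f i x * \prod_(j <- r) f j x)) => //.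
  by move=> x _; rewrite big_cons.
exact: CkVM.
Qed.

Lemma CkV_det (R : realType) (W : normedModType R) k (O : set W) n
    (M : W -> 'M[R]_n) : open O ->
  (forall i j, CkV k O (fun x => M x i j)) -> CkV k O (fun x => \det (M x)).
Proof.
move=> oO MC; apply: CkV_sum => // s; apply: CkVM => //; first exact: CkV_cst.
by apply: CkV_prod => // i; exact: MC.
Qed.

(** By Cramer's formula the entries are rational functions of the entries of M. *)
Lemma CkV_invmx (R : realType) (W : normedModType R) k (O : set W) n
    (M : W -> 'M[R]_n) : open O -> (forall x, O x -> M x \in unitmx) ->
  (forall i j, CkV k O (fun x => M x i j)) ->
  forall i j, CkV k O (fun x => invmx (M x) i j).
Proof.
move=> oO Mu MC i j.
apply: (@CkV_eq _ _ _ k O (fun x => (\det (M x))^-1 * cofactor (M x) j i)) => //.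
  by move=> x Ox; rewrite /invmx Mu// !mxE.
apply: CkVM => //.
  apply: CkVV => //; last exact: CkV_det.
  by move=> x /Mu; rewrite unitmxE unitfE.
apply: CkVM => //; first exact: CkV_cst.
apply: CkV_det => // a b; apply: CkV_eq (MC (lift j a) (lift i b)) => // x _.
by rewrite !mxE.
Qed.

Lemma diff_partials (R : realType) m (V : normedModType R) (f : 'cV[R]_m -> V)
    (x w : 'cV[R]_m) : differentiable f x ->
  'D_w f x = \sum_i w i 0 *: 'D_(delta_mx i 0) f x.
Proof.
move=> fd; rewrite deriveE// {1}[w]matrix_sum_delta.
rewrite linear_sum; apply: eq_bigr => i _.
by rewrite big_ord1 linearZ /= deriveE.
Qed.

Lemma CkV_coord_fun (R : realType) m n k (O : set 'cV[R]_m)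
    (f : 'cV[R]_m -> 'cV[R]_n) i :
  open O -> CkV k O f -> CkV k O (fun x => f x i 0).
Proof.
move=> oO; elim: k f => [|k IH] f /=.
  move=> fc x Ox; apply: (@continuous_comp _ _ _ f (fun M : 'cV[R]_n => M i 0)).
    exact: fc.
  exact: coord_continuous.
move=> [fd fv]; split=> [x Ox|v].
  apply: (@differentiable_comp _ _ _ _ f (fun M : 'cV[R]_n => M i 0)).
    exact: fd.
  exact: differentiable_coord.
apply: (@CkV_eq _ _ _ k O (fun x => ('D_v f x) i 0)) => //; last exact: IH.
by move=> x Ox; rewrite derive_mx ?mxE//; apply: diff_derivable; exact: fd.
Qed.

Lemma col_sum_delta (R : realType) n (y : 'cV[R]_n) :
  y = \sum_i y i 0 *: delta_mx i 0.
Proof.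
rewrite {1}[y]matrix_sum_delta; apply: eq_bigr => i _.
by rewrite big_ord1.
Qed.

Lemma CkV_of_coords (R : realType) m n k (O : set 'cV[R]_m)
    (f : 'cV[R]_m -> 'cV[R]_n) :
  open O -> (forall i, CkV k O (fun x => f x i 0)) -> CkV k O f.
Proof.
move=> oO; elim: k f => [|k IH] f fC.
  by move=> x Ox; apply: (@cvg_col _ _ (nbhs x) (nbhs_filter x)) => i; exact: (fC i x Ox).
have fd x : O x -> differentiable f x.
  move=> Ox; have -> : f = \sum_i (fun x => f x i 0 *: delta_mx i 0).
    by apply/funext => y; rewrite fct_sumE; exact: col_sum_delta.
  apply: differentiable_sum => i; apply: differentiableZl.
  by have [h _] := fC i; exact: h.
split=> // v; apply: IH => i; have [_ /(_ v)] := fC i.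
apply: CkV_eq => // x Ox.
by rewrite derive_mx ?mxE//; apply: diff_derivable; exact: fd.
Qed.

Lemma derive_coord (R : realType) m (i : 'I_m) (x v : 'cV[R]_m) :
  'D_v (fun y : 'cV[R]_m => y i 0) x = v i 0.
Proof.
have := @derive_mx _ _ _ _ (id : 'cV[R]_m -> 'cV[R]_m) x v (@derivable_id _ _ x v).
by rewrite derive_id => /matrixP/(_ i 0); rewrite mxE.
Qed.

Lemma CkV_coord (R : realType) m k (O : set 'cV[R]_m) (i : 'I_m) :
  open O -> CkV k O (fun x : 'cV[R]_m => x i 0).
Proof.
move=> oO; case: k => [|k]; first by move=> x _; exact: coord_continuous.
split=> [x _|v]; first exact: differentiable_coord.
apply: CkV_eq (CkV_cst k (v i 0) oO) => // x _.
by rewrite derive_coord.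
Qed.

Lemma CkV_comp (R : realType) (m n k : nat) (O : set 'cV[R]_m) (O' : set 'cV[R]_n)
    (f : 'cV[R]_m -> R) (g : 'cV[R]_n -> 'cV[R]_m) :
  open O -> open O' -> (forall x, O' x -> O (g x)) ->
  CkV k O f -> CkV k O' g -> CkV k O' (fun x => f (g x)).
Proof.
move=> oO oO' gO; elim: k f => [|k IH] f.
  move=> fc gc x Ox; apply: continuous_comp; first exact: gc.
  by apply: fc; exact: gO.
move=> [fd fv] gC; have := gC => -[gd gv].
have {gv}gi i v : CkV k O' (fun x => ('D_v g x) i 0).
  by apply: CkV_coord_fun => //; exact: gv.
split=> [x Ox|v].
  by apply: differentiable_comp; [exact: gd|apply: fd; exact: gO].
apply: (@CkV_eq _ _ _ k O' (fun x => \sum_i ('D_v g x) i 0 * 'D_(delta_mx i 0) f (g x))) => //.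
  move=> x Ox; have gdx := gd _ Ox; have fdx := fd _ (gO _ Ox).
  rewrite [RHS]deriveE; last exact: differentiable_comp.
  by rewrite diff_comp//= -(deriveE v gdx) -(deriveE _ fdx) (diff_partials _ fdx).
apply: CkV_sum => // i; apply: CkVM => //.
by apply: (IH ('D_(delta_mx i 0) f)); [exact: fv|exact: CkVW].
Qed.

(** * Continuously differentiable maps are strictly differentiable *)

Definition jacobian_mx (R : realType) m n (f : 'cV[R]_m -> 'cV[R]_n)
    (p : 'cV[R]_m) : 'M[R]_(n, m) :=
  \matrix_(i, j) ('D_(delta_mx j 0) f p) i 0.

Lemma jacobianE (R : realType) m n (f : 'cV[R]_m -> 'cV[R]_n) (p w : 'cV[R]_m) :
  differentiable f p -> 'D_w f p = jacobian_mx f p *m w.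
Proof.
move=> fd; rewrite diff_partials//; apply/matrixP => i j.
rewrite summxE mxE; apply: eq_bigr => k _.
by rewrite !mxE !ord1 mulrC.
Qed.

Lemma is_derive_line (R : realType) m (f : 'cV[R]_m -> R) (v w : 'cV[R]_m)
    (s : R) : derivable f (v + s *: w) w ->
  is_derive s (1 : R) (fun s => f (v + s *: w)) ('D_w f (v + s *: w)).
Proof.
move=> fd.
have e : (fun h : R => h^-1 *: (((fun s => f (v + s *: w)) \o shift s) (h *: (1 : R)) -
    f (v + s *: w))) =
  (fun h : R => h^-1 *: ((f \o shift (v + s *: w)) (h *: w) - f (v + s *: w))).
  apply/funext => h /=; congr (_ *: (f _ - _)).
  by rewrite -[h *: (1 : R)]/(h * 1) mulr1 scalerDl addrCA addrA.
by split; [rewrite /derivable e|rewrite /derive e].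
Qed.

(** The mean value theorem on the segment from v to u, coordinate by coordinate,
    with the partial derivatives within e / (m + 1) of their values at p. *)
Lemma C1_strict_diff (R : realType) m n (O : set 'cV[R]_m) (f : 'cV[R]_m -> 'cV[R]_n) p :
  open O -> O p -> CkV 1 O f -> strict_diff f p (jacobian_mx f p).
Proof.
move=> oO Op [fd fv] e e0.
have e1 : 0 < e / (m%:R + 1) by rewrite divr_gt0// ltr_wpDl.
have : \forall q \near p, O q /\ forall j : 'I_m,
    `|'D_(delta_mx j 0) f p - 'D_(delta_mx j 0) f q| <= e / (m%:R + 1).
  near=> q; split; first by near: q; exact: open_nbhs_nbhs.
  move=> j; move: j; near: q; apply: filter_forall => j.
  by have /cvgrPdist_le/(_ _ e1) := fv (delta_mx j 0) p Op.
move=> /nbhs_ballP[d /= d0 dP]; exists d => // u v up vp.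
pose w := u - v.
have seg (s : R) : 0 <= s -> s <= 1 -> ball p d (v + s *: w).
  move=> s0 s1; rewrite -ball_normE /= distrC.
  have -> : v + s *: w - p = (1 - s) *: (v - p) + s *: (u - p).
    by rewrite /w; apply/matrixP => i j; rewrite !mxE; ring.
  rewrite (le_lt_trans (ler_normD _ _))// !normrZ !ger0_norm ?subr_ge0//.
  pose M := Num.max `|v - p| `|u - p|.
  apply: (@le_lt_trans _ _ M); last by rewrite /M gt_max vp.
  have h1 : (1 - s) * `|v - p| <= (1 - s) * M by rewrite ler_wpM2l ?subr_ge0// le_max lexx.
  have h2 : s * `|u - p| <= s * M by rewrite ler_wpM2l// le_max lexx orbT.
  lra.
apply: col_norm_le => [|i]; first by rewrite mulr_ge0// ltW.
pose phi s := f (v + s *: w) i 0.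
have fi q : O q -> differentiable (fun x => f x i 0) q.
  move=> Oq; apply: (@differentiable_comp _ _ _ _ f (fun M : 'cV[R]_n => M i 0)).
    exact: fd.
  exact: differentiable_coord.
have phid (s : R) : 0 <= s -> s <= 1 ->
    is_derive s (1 : R) phi ('D_w (fun x => f x i 0) (v + s *: w)).
  move=> s0 s1; apply: is_derive_line; apply: diff_derivable; apply: fi.
  by have [] := dP _ (seg s s0 s1).
have [s||c] := @MVT R phi (fun s => 'D_w (fun x => f x i 0) (v + s *: w)) 0 1 ltr01.
- by rewrite in_itv /= => /andP[s0 s1]; apply: phid; exact: ltW.
- apply: derivable_within_continuous => t; rewrite in_itv /= => /andP[st tb].
  by apply: ex_derive; exact: phid.
rewrite in_itv /= => /andP[c0 c1]; rewrite subr0 mulr1 /phi scale1r scale0r addr0.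
have -> : v + w = u by rewrite /w addrC subrK.
have [Oc dc] := dP _ (seg c (ltW c0) (ltW c1)).
have -> : 'D_w (fun x => f x i 0) (v + c *: w) = (jacobian_mx f (v + c *: w) *m w) i 0.
  by rewrite -jacobianE ?derive_mx ?mxE//; [apply: diff_derivable|]; exact: fd.
move=> fuv; rewrite -/w.
have -> : (f u - f v - jacobian_mx f p *m w) i 0 =
    ((jacobian_mx f (v + c *: w) - jacobian_mx f p) *m w) i 0.
  rewrite mulmxBl [LHS]mxE [in RHS]mxE -fuv !mxE; ring.
rewrite mxE (le_trans (ler_norm_sum _ _ _))//.
apply: (@le_trans _ _ (\sum_(j < m) (e / (m%:R + 1)) * `|w|)).
  apply: ler_sum => j _; rewrite normrM ler_pM ?mx_coord_le// !mxE distrC.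
  rewrite (le_trans _ (dc j))//.
  by rewrite (le_trans _ (mx_coord_le _ i 0))// !mxE.
rewrite sumr_const card_ord -[leLHS]mulr_natl mulrA ler_wpM2r// mulrCA ger_pMr//.
by rewrite ler_pdivrMr ?mul1r ?lerDl// ltr_wpDl.
Unshelve. all: by end_near. Qed.

(** * Smoothness of the branch of zeros *)

Lemma open_coord_ball (R : realType) (e : R) :
  open [set z : 'cV[R]_1 | `|z 0 0| < e].
Proof.
apply: (@open_comp _ _ (fun z : 'cV[R]_1 => `|z 0 0|) [set y | y < e]).
  move=> z _; apply: (@continuous_comp _ _ _ (fun z : 'cV[R]_1 => z 0 0) Num.norm).
    exact: coord_continuous.
  exact: norm_continuous.
exact: open_lt.
Qed.

Section smooth_branch.
Variables (R : realType) (N : nat) (F : 'cV[R]_(N + 1) -> 'cV[R]_N).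
Variables (O : set 'cV[R]_(N + 1)) (e0 K : R) (tau : R -> 'cV[R]_N).
Hypotheses (oO : open O) (K0 : 0 <= K).
Hypothesis tauO : forall e : R, `|e| < e0 -> O (pair_col (tau e) e).
Hypothesis tauF : forall e : R, `|e| < e0 -> F (pair_col (tau e) e) = 0.
Hypothesis tau_lip : forall e e' : R, `|e| < e0 -> `|e'| < e0 ->
  `|tau e - tau e'| <= K * `|e - e'|.
Hypothesis Junit : forall z, O z -> lsubmx (jacobian_mx F z) \in unitmx.

Let psi z := - (invmx (lsubmx (jacobian_mx F z)) *m rsubmx (jacobian_mx F z)).

(** Strict differentiability of F at (tau e, e), applied to the two zeros
    (tau (e + h), e + h) and (tau e, e), gives A D + h b = o(|D| + |h|) for
    D = tau (e + h) - tau e; the Lipschitz bound turns the right-hand side into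
    o(h). *)
Let tau_derive (e : R) : CkV 1 O F -> `|e| < e0 ->
  is_derive e (1 : R) tau (psi (pair_col (tau e) e)).
Proof.
move=> FC ee; set p := pair_col (tau e) e.
have Op : O p := tauO ee.
set A := lsubmx (jacobian_mx F p); set b := rsubmx (jacobian_mx F p).
have Au : A \in unitmx := Junit Op.
have [k k0 kP] := mulmx_bound (invmx A).
have lim : (fun h : R => h^-1 *: ((tau \o shift e) (h *: (1 : R)) - tau e)) @ 0^' -->
    psi p.
  apply/cvgrPdist_le => eta eta0.
  have e1 : 0 < eta / (k * (K + 1)) by rewrite divr_gt0// mulr_gt0// ltr_wpDl.
  have [d d0 Fd] := C1_strict_diff oO Op FC e1.
  near=> h => /=.
  have h0 : h != 0 by near: h; exact: nbhs_dnbhs_neq.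
  rewrite -[h *: (1 : R)]/(h * 1) mulr1.
  have he : `|h + e| < e0.
    rewrite (le_lt_trans (ler_normD _ _))// -ltrBrDr.
    by near: h; apply: dnbhs0_lt; rewrite subr_gt0.
  set D := tau (h + e) - tau e.
  have Dh : `|D| <= K * `|h| by have := tau_lip he ee; rewrite addrK.
  have pzh : pair_col (tau (h + e)) (h + e) - p = pair_col D h by rewrite pair_colB addrK.
  have pzn : `|pair_col D h| <= (K + 1) * `|h|.
    by rewrite (le_trans (pair_col_norm_add _ _))// mulrDl mul1r lerD2r.
  have hd : `|h| < d / (K + 1).
    by near: h; apply: dnbhs0_lt; rewrite divr_gt0// ltr_wpDl.
  have pd : `|pair_col D h| < d.
    by rewrite (le_lt_trans pzn)// mulrC -ltr_pdivlMr// ltr_wpDl.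
  have := Fd (pair_col (tau (h + e)) (h + e)) p; rewrite pzh subrr normr0 => /(_ pd d0).
  rewrite !tauF// subrr sub0r normrN mulmx_pair_col -/A -/b => hF.
  have -> : psi p - h^-1 *: D = - (h^-1 *: (invmx A *m (A *m D + h *: b))).
    rewrite mulmxDr mulKmx// -scalemxAr [in RHS]scalerDr [in RHS]scalerA mulVf// scale1r.
    by rewrite opprD addrC.
  rewrite normrN normrZ normfV ler_pdivrMl ?normr_gt0//.
  rewrite (le_trans (kP _ _))// mulrC -ler_pdivlMr// (le_trans hF)//.
  rewrite (@le_trans _ _ (eta / (k * (K + 1)) * ((K + 1) * `|h|)))//.
    by rewrite ler_wpM2l// ltW.
  have kn0 : k != 0 by rewrite gt_eqF.
  have K1n0 : K + 1 != 0 by rewrite gt_eqF// ltr_wpDl.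
  rewrite le_eqVlt; apply/orP; left; apply/eqP; field.
  by rewrite kn0.
split; first by apply/cvg_ex; exists (psi p).
by apply: cvg_lim => //; exact: norm_hausdorff.
Unshelve. all: by end_near. Qed.

Let O1 := [set z : 'cV[R]_1 | `|z 0 0| < e0].
Let T (z : 'cV[R]_1) := tau (z 0 0).

Let oO1 : open O1 := @open_coord_ball R e0.

Let T_diff z : CkV 1 O F -> O1 z -> differentiable T z.
Proof.
move=> FC Oz.
apply: (@differentiable_comp _ _ _ _ (fun z : 'cV[R]_1 => z 0 0) tau).
  exact: differentiable_coord.
by apply/derivable1_diffP; apply: ex_derive; exact: tau_derive.
Qed.

Let T_derive z (v : 'cV[R]_1) : CkV 1 O F -> O1 z ->
  'D_v T z = v 0 0 *: psi (pair_col (T z) (z 0 0)).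
Proof.
move=> FC Oz; have td := tau_derive FC Oz.
have tdiff : differentiable tau (z 0 0) by apply/derivable1_diffP; exact: ex_derive.
have cdiff : differentiable (fun z : 'cV[R]_1 => z 0 0 : R) z by exact: differentiable_coord.
rewrite deriveE; last exact: T_diff.
rewrite (@diff_comp _ _ _ _ (fun z : 'cV[R]_1 => z 0 0 : R) tau z cdiff tdiff) /=.
rewrite -(deriveE v cdiff) derive_coord.
rewrite -[v 0 0 in LHS]mulr1 -[v 0 0 * 1]/(v 0 0 *: (1 : R)) linearZ /=.
by rewrite -deriveE// derive_val.
Qed.

(** Bootstrapping: if T is C^k, then its derivative, [psi] along the graph of T, is
    a composition of C^k maps, so T is C^(k+1). *)
Lemma smooth_branch k : CkV k O F -> CkV k O1 T.
Proof.
elim: k => [_ z Oz|k IH FC].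
  apply: (@continuous_comp _ _ _ (fun z : 'cV[R]_1 => z 0 0) tau).
    exact: coord_continuous.
  apply/cvgrPdist_le => e e_gt0.
  have K1 : 0 < K + 1 by rewrite ltr_wpDl.
  near=> s.
  have se : `|s| < e0.
    near: s; have : O1 z := Oz; rewrite /O1 /= => zO.
    have : nbhs `|z 0 0 : R| [set y | y < e0] by exact: lt_nbhsl.
    exact: norm_continuous.
  rewrite (le_trans (tau_lip Oz se))// (@le_trans _ _ ((K + 1) * `|z 0 0 - s|))//.
    by rewrite ler_wpM2r// lerDl.
  rewrite mulrC -ler_pdivlMr//; near: s.
  by apply: cvgr_dist_le => //; rewrite divr_gt0.
have FC1 : CkV 1 O F.
  by elim: {IH} k FC => // k IH FC; apply: IH; exact: CkVW.
have TC : CkV k O1 T by apply: IH; exact: CkVW.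
split=> [z Oz|v]; first exact: T_diff.
have GC : CkV k O1 (fun z : 'cV[R]_1 => pair_col (T z) (z 0 0)).
  apply: CkV_of_coords => // i.
  have [j ij|j ij] := fintype.splitP i.
    apply: CkV_eq (CkV_coord_fun j oO1 TC) => // z _.
    by rewrite /pair_col (_ : i = lshift 1 j) ?col_mxEu//; exact: val_inj.
  apply: CkV_eq (CkV_coord k 0 oO1) => // z _.
  by rewrite /pair_col (_ : i = rshift N j) ?col_mxEd ?mxE//; exact: val_inj.
have JC i j : CkV k O (fun z => jacobian_mx F z i j).
  have [_ /(_ (delta_mx j 0)) Fj] := FC.
  apply: CkV_eq (CkV_coord_fun i oO Fj) => // z _.
  by rewrite mxE.
have psiC i : CkV k O (fun z => psi z i 0).
  apply: (@CkV_eq _ _ _ k O (fun z => -1 * \sum_j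
      invmx (lsubmx (jacobian_mx F z)) i j * jacobian_mx F z j (rshift N 0))) => //.
    move=> z _; rewrite !mxE mulN1r; congr (- _).
    by apply: eq_bigr => j _; rewrite !mxE.
  apply: CkVM => //; first exact: CkV_cst.
  apply: CkV_sum => // j; apply: CkVM => //.
  apply: (@CkV_invmx _ _ _ _ _ (fun z => lsubmx (jacobian_mx F z))) => // a c.
  by apply: CkV_eq (JC a (lshift 1 c)) => // z _; rewrite [RHS]mxE.
apply: CkV_of_coords => // i.
apply: (@CkV_eq _ _ _ k O1 (fun z => v 0 0 * psi (pair_col (T z) (z 0 0)) i 0)) => //.
  by move=> z Oz; rewrite T_derive// [RHS]mxE.
apply: CkVM => //; first exact: CkV_cst.
by apply: (@CkV_comp _ _ _ k O O1 (fun u => psi u i 0)) => // z Oz; exact: tauO.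
Unshelve. all: by end_near. Qed.

End smooth_branch.

(** * Power series with weighted absolutely summable coefficients *)

(** The functions whose Taylor series at 0 has l^1 norm at most M with weights
    rho^n.  These norms are submultiplicative, and balls for them are closed under
    pointwise limits. *)
Definition power_series (R : realType) (rho M : R) (f : R -> R) : Prop :=
  exists a : nat -> R,
    (forall K : nat, \sum_(n < K) `|a n| * rho ^+ n <= M) /\
    forall t : R, `|t| < rho -> \sum_(n < K) a n * t ^+ n @[K --> \oo] --> f t.

Lemma power_series_ge0 (R : realType) (rho M : R) f : power_series rho M f -> 0 <= M.
Proof. by case=> a [/(_ 0%N)]; rewrite big_ord0. Qed.

Lemma power_series_tail_le (R : realType) (rho M : R) (a : nat -> R) (t : R) K K' :
  (forall K : nat, \sum_(n < K) `|a n| * rho ^+ n <= M) -> `|t| < rho ->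
  `|\sum_(n < K + K') a n * t ^+ n - \sum_(n < K) a n * t ^+ n| <=
    M * (`|t| / rho) ^+ K.
Proof.
move=> aM trho; have rho0 : 0 < rho by exact: le_lt_trans trho.
have q1 : `|t| / rho <= 1 by rewrite ler_pdivrMr// mul1r ltW.
have q0 : 0 <= `|t| / rho by rewrite divr_ge0// ltW.
rewrite big_split_ord /= addrAC subrr add0r (le_trans (ler_norm_sum _ _ _))//.
apply: (@le_trans _ _ (\sum_(n < K') (`|a (K + n)%N| * rho ^+ (K + n)) * (`|t| / rho) ^+ K)).
  apply: ler_sum => n _; rewrite normrM -mulrA ler_wpM2l//.
  have -> : `|t ^+ (K + n)| = rho ^+ (K + n) * (`|t| / rho) ^+ (K + n).
    by rewrite -exprMn mulrCA divff ?mulr1 ?normrX// gt_eqF.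
  rewrite ler_wpM2l ?exprn_ge0 ?(ltW rho0)//.
  by rewrite ler_wiXn2l// leq_addr.
rewrite -mulr_suml ler_wpM2r ?exprn_ge0//.
apply: le_trans (aM (K + K')%N); rewrite [leRHS]big_split_ord /= lerDr.
by apply: sumr_ge0 => n _; rewrite mulr_ge0 ?exprn_ge0// ltW.
Qed.

Lemma power_series_tail (R : realType) (rho M : R) (a : nat -> R) f (t : R) K :
  (forall K : nat, \sum_(n < K) `|a n| * rho ^+ n <= M) -> `|t| < rho ->
  (\sum_(n < K) a n * t ^+ n @[K --> \oo] --> f t) ->
  `|f t - \sum_(n < K) a n * t ^+ n| <= M * (`|t| / rho) ^+ K.
Proof.
move=> aM trho af.
apply: (@ler_cvg_to _ \oo _ _
  (fun K' => `|\sum_(n < K') a n * t ^+ n - \sum_(n < K) a n * t ^+ n|)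
  (fun=> M * (`|t| / rho) ^+ K)).
- by apply: cvg_norm; apply: cvgB => //; exact: cvg_cst.
- exact: cvg_cst.
- exists K => // K' /= KK'; have := power_series_tail_le K (K' - K) aM trho.
  by rewrite subnKC.
Qed.

Lemma power_series_bound (R : realType) (rho M : R) f t :
  power_series rho M f -> `|t| < rho -> `|f t| <= M.
Proof.
case=> a [aM af] trho; have := power_series_tail 0 aM trho (af t trho).
by rewrite big_ord0 subr0 expr0 mulr1.
Qed.

Lemma power_series_le (R : realType) (rho M M' : R) f :
  M <= M' -> power_series rho M f -> power_series rho M' f.
Proof.
move=> MM [a [aM af]]; exists a; split => // K; exact: le_trans (aM K) MM.
Qed.

Lemma power_series_eq (R : realType) (rho M : R) f g :
  (forall t, `|t| < rho -> f t = g t) -> power_series rho M f -> power_series rho M g.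
Proof.
move=> fg [a [aM af]]; exists a; split => // t trho.
by rewrite -fg//; exact: af.
Qed.

(** The coefficients of degree n are bounded by M / rho^n uniformly in k, so they
    converge along an ultrafilter finer than G.  The tails of the series are
    geometric uniformly in k, so the limit coefficients sum to the limit function.
    This plays the part of Montel's theorem. *)
Lemma power_series_lim (R : realType) (rho M : R) (G : set_system nat)
    (GG : ProperFilter G) (f : nat -> R -> R) (g : R -> R) :
  0 < rho -> (forall k, power_series rho M (f k)) ->
  (forall t, `|t| < rho -> f k t @[k --> G] --> g t) -> power_series rho M g.
Proof.
move=> rho0 fps fg.
have [U [UU GU]] := ultraFilterLemma GG.
have [a aP] : {a : nat -> nat -> R & forall k,
    (forall K : nat, \sum_(n < K) `|a k n| * rho ^+ n <= M) /\
    forall t : R, `|t| < rho -> \sum_(n < K) a k n * t ^+ n @[K --> \oo] --> f k t}.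
  exact: (@boolp.choice nat (nat -> R) (fun k a =>
    (forall K : nat, \sum_(n < K) `|a n| * rho ^+ n <= M) /\
    forall t : R, `|t| < rho -> \sum_(n < K) a n * t ^+ n @[K --> \oo] --> f k t)).
have ab k n : `|a k n| <= M / rho ^+ n.
  rewrite ler_pdivlMr ?exprn_gt0//; have [/(_ n.+1) h _] := aP k.
  apply: le_trans h; rewrite big_ord_recr /= lerDr.
  by apply: sumr_ge0 => i _; rewrite mulr_ge0 ?exprn_ge0// ltW.
have [b bP] : {b : nat -> R & forall n, a k n @[k --> U] --> b n}.
  apply: (@boolp.choice nat R (fun n l => a k n @[k --> U] --> l)) => n.
  exact: (@ultra_bounded_cvg _ U UU (fun k => a k n) (M / rho ^+ n)).
have sums (c : R -> R) (K : nat) (s : R) : (forall n, c (a k n) @[k --> U] --> c (b n)) ->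
    \sum_(n < K) c (a k n) * s ^+ n @[k --> U] --> \sum_(n < K) c (b n) * s ^+ n.
  move=> ch; apply: (@cvg_sumr _ _ _ U _ _ _ (fun (n : 'I_K) k => c (a k n) * s ^+ n)) => n.
  exact: cvgMl.
have bM K : \sum_(n < K) `|b n| * rho ^+ n <= M.
  apply: (@ler_cvg_to _ U _ _ (fun k => \sum_(n < K) `|a k n| * rho ^+ n) (fun=> M)).
  - by apply: (sums Num.norm) => n; exact: cvg_norm.
  - exact: cvg_cst.
  - by apply: nearW => k; have [] := aP k.
exists b; split => // t trho.
have q0 : 0 <= `|t| / rho by rewrite divr_ge0// ltW.
have q1 : `|t| / rho < 1 by rewrite ltr_pdivrMr// mul1r.
have tail K : `|g t - \sum_(n < K) b n * t ^+ n| <= M * (`|t| / rho) ^+ K.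
  apply: (@ler_cvg_to _ U _ _ (fun k => `|f k t - \sum_(n < K) a k n * t ^+ n|)
    (fun=> M * (`|t| / rho) ^+ K)).
  - apply: cvg_norm; apply: cvgB; last by apply: (sums id).
    by move=> A /(fg t trho); exact: GU.
  - exact: cvg_cst.
  - apply: nearW => k; have [aM af] := aP k.
    by apply: power_series_tail => //; exact: af.
have geo : M * (`|t| / rho) ^+ K @[K --> \oo] --> (0 : R).
  by rewrite -[X in _ --> X](mulr0 M); apply: cvgMr; apply: cvg_expr; rewrite ger0_norm.
apply/cvgrPdist_le => e e0; move/cvgrPdist_le : geo => /(_ e e0).
apply: filterS => K; rewrite sub0r normrN => h.
by rewrite (le_trans (tail K))// (le_trans (ler_norm _)).
Qed.

Lemma power_seriesD (R : realType) (rho M M' : R) f g :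
  0 <= rho -> power_series rho M f -> power_series rho M' g ->
  power_series rho (M + M') (fun t => f t + g t).
Proof.
move=> rho0 [a [aM af]] [b [bM bg]]; exists (fun n => a n + b n); split=> [K|t trho].
  apply: le_trans (lerD (aM K) (bM K)); rewrite -big_split /=.
  by apply: ler_sum => n _; rewrite -mulrDl ler_wpM2r ?exprn_ge0// ler_normD.
under eq_fun do under eq_bigr do rewrite mulrDl.
under eq_fun do rewrite big_split.
by apply: cvgD; [exact: af|exact: bg].
Qed.

Lemma power_seriesZ (R : realType) (rho M c : R) f :
  power_series rho M f -> power_series rho (`|c| * M) (fun t => c * f t).
Proof.
move=> [a [aM af]]; exists (fun n => c * a n); split=> [K|t trho].
  rewrite (eq_bigr (fun n : 'I_K => `|c| * (`|a n| * rho ^+ n))); last first.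
    by move=> n _; rewrite normrM mulrA.
  by rewrite -mulr_sumr ler_wpM2l ?aM.
under eq_fun do under eq_bigr do rewrite -mulrA.
under eq_fun do rewrite -mulr_sumr.
by apply: cvgMr; exact: af.
Qed.

Lemma power_series_poly (R : realType) (rho : R) (p : {poly R}) : 0 <= rho ->
  power_series rho (map_poly Num.norm p).[rho] (horner p).
Proof.
move=> rho0.
have nE n : (map_poly Num.norm p)`_n = `|p`_n| by rewrite coef_map_id0 ?normr0.
exists (fun n => p`_n); split=> [K|t trho].
  have [sK|Ks] := leqP (size p) K.
    have sz : (size (map_poly Num.norm p) <= K)%N.
      by apply: leq_trans sK; exact: size_poly.
    rewrite (horner_coef_wide _ sz) le_eqVlt; apply/orP; left; apply/eqP.
    by apply: eq_bigr => n _; rewrite nE.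
  have sz : (size (map_poly Num.norm p) <= size p)%N by exact: size_poly.
  rewrite (horner_coef_wide _ sz) -(subnKC (ltnW Ks)) big_split_ord /=.
  rewrite (eq_bigr (fun n : 'I_K => (map_poly Num.norm p)`_n * rho ^+ n)).
    by rewrite lerDl sumr_ge0// => n _; rewrite nE mulr_ge0 ?exprn_ge0.
  by move=> n _; rewrite nE.
apply: cvg_near_cst; exists (size p) => // K /= sK.
by rewrite (horner_coef_wide _ sK).
Qed.

Lemma norm_poly_mul (R : realType) (rho : R) (p q : {poly R}) : 0 <= rho ->
  (map_poly Num.norm (p * q)).[rho] <=
  (map_poly Num.norm p).[rho] * (map_poly Num.norm q).[rho].
Proof.
move=> rho0; rewrite -hornerM.
have nE (r : {poly R}) n : (map_poly Num.norm r)`_n = `|r`_n|.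
  by rewrite coef_map_id0 ?normr0.
set P := map_poly _ (p * q); set Q := map_poly _ p * _.
rewrite (@horner_coef_wide _ (maxn (size P) (size Q)) P) ?leq_maxl//.
rewrite (@horner_coef_wide _ (maxn (size P) (size Q)) Q) ?leq_maxr//.
apply: ler_sum => n _; rewrite ler_wpM2r ?exprn_ge0// nE !coefM.
by rewrite (le_trans (ler_norm_sum _ _ _))// ler_sum// => i _; rewrite normrM !nE.
Qed.

(** For polynomials this is the submultiplicativity of the l^1 norm; the general
    case follows by truncation, since pointwise limits preserve the class. *)
Lemma power_seriesM (R : realType) (rho M M' : R) f g :
  0 < rho -> power_series rho M f -> power_series rho M' g ->
  power_series rho (M * M') (fun t => f t * g t).
Proof.
move=> rho0 [a [aM af]] [b [bM bg]].
have poly (c : nat -> R) (B : R) K : (forall K : nat, \sum_(n < K) `|c n| * rho ^+ n <= B) ->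
    (map_poly Num.norm (\poly_(n < K) c n)).[rho] <= B.
  move=> cB; apply: le_trans (cB K).
  rewrite (@horner_coef_wide _ K); last first.
    by apply: leq_trans (size_poly K _); exact: size_poly.
  by apply: ler_sum => n _; rewrite coef_map_id0 ?normr0// coef_poly ltn_ord.
apply: (@power_series_lim _ _ _ \oo _
  (fun K => horner (\poly_(n < K) a n * \poly_(n < K) b n))) => // [K|t trho].
  apply: power_series_le (power_series_poly _ (ltW rho0)).
  rewrite (le_trans (norm_poly_mul _ _ (ltW rho0)))//.
  rewrite ler_pM// ?poly//; rewrite horner_coef sumr_ge0// => n _;
  by rewrite coef_map_id0 ?normr0// mulr_ge0// exprn_ge0// ltW.
under eq_fun do rewrite hornerM !horner_poly.
by apply: cvgM; [exact: af|exact: bg].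
Qed.

Lemma power_series_cst (R : realType) (rho c : R) : 0 <= rho -> power_series rho `|c| (fun=> c).
Proof.
move=> rho0; have := power_series_poly c%:P rho0.
have -> : map_poly Num.norm c%:P = `|c|%:P.
  apply/polyP => n; rewrite coef_map_id0 ?normr0// !coefC.
  by case: (n == 0)%N; rewrite ?normr0.
rewrite hornerC.
by apply: power_series_eq => t _; rewrite hornerC.
Qed.

Lemma power_series_id (R : realType) (rho : R) : 0 <= rho -> power_series rho rho id.
Proof.
move=> rho0; have := power_series_poly 'X rho0.
have -> : map_poly Num.norm 'X = 'X :> {poly R}.
  apply/polyP => n; rewrite coef_map_id0 ?normr0// coefX.
  by case: (n == 1)%N; rewrite ?normr1 ?normr0.
by rewrite hornerX; apply: power_series_eq => t _; rewrite hornerX.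
Qed.

Lemma power_series_sum (R : realType) (rho : R) (I : Type) (r : seq I) (P : pred I)
    (M : I -> R) (f : I -> R -> R) : 0 <= rho ->
  (forall i, P i -> power_series rho (M i) (f i)) ->
  power_series rho (\sum_(i <- r | P i) M i) (fun t => \sum_(i <- r | P i) f i t).
Proof.
move=> rho0 fM; elim: r => [|i r IH].
  rewrite big_nil; have := power_series_cst 0 rho0; rewrite normr0.
  by apply: power_series_eq => t _; rewrite big_nil.
rewrite big_cons; case: ifPn => Pi.
  by apply: power_series_eq (power_seriesD rho0 (fM i Pi) IH) => t _; rewrite big_cons Pi.
by apply: power_series_eq IH => t _; rewrite big_cons (negbTE Pi).
Qed.

Lemma power_series_prod (R : realType) (rho : R) (I : Type) (r : seq I)
    (M : I -> R) (f : I -> R -> R) : 0 < rho ->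
  (forall i, power_series rho (M i) (f i)) ->
  power_series rho (\prod_(i <- r) M i) (fun t => \prod_(i <- r) f i t).
Proof.
move=> rho0 fM; elim: r => [|i r IH].
  rewrite big_nil; have := power_series_cst 1 (ltW rho0); rewrite normr1.
  by apply: power_series_eq => t _; rewrite big_nil.
rewrite big_cons; apply: power_series_eq (power_seriesM rho0 (fM i) IH) => t _.
by rewrite big_cons.
Qed.

Lemma power_seriesX (R : realType) (rho M : R) f k : 0 < rho ->
  power_series rho M f -> power_series rho (M ^+ k) (fun t => f t ^+ k).
Proof.
move=> rho0 fM; elim: k => [|k IH].
  by have := power_series_cst 1 (ltW rho0); rewrite normr1.
rewrite exprS; apply: power_series_eq (power_seriesM rho0 fM IH) => t _.
by rewrite exprS.
Qed.

(** The increment over a unit step inside a disc of radius rho > 1 only sees the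
    coefficients of positive degree. *)
Lemma power_series_increment (R : realType) (rho M : R) f : 1 < rho ->
  power_series rho M f -> `|f 1 - f 0| <= M / rho.
Proof.
move=> rho1 [a [aM af]]; have rho0 : 0 < rho := lt_trans ltr01 rho1.
have a1 : \sum_(n < K) a n * 1 ^+ n @[K --> \oo] --> f 1 by apply: af; rewrite normr1.
have a0 : \sum_(n < K) a n * 0 ^+ n @[K --> \oo] --> f 0 by apply: af; rewrite normr0.
apply: (@ler_cvg_to _ \oo _ _
  (fun K => `|\sum_(n < K) a n * 1 ^+ n - \sum_(n < K) a n * 0 ^+ n|)
  (fun=> M / rho)).
- by apply: cvg_norm; exact: cvgB.
- exact: cvg_cst.
apply: nearW => K; rewrite -sumrB (le_trans (ler_norm_sum _ _ _))//.
rewrite ler_pdivlMr// (le_trans _ (aM K))// mulr_suml.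
apply: ler_sum => -[[|n] nK] _ /=.
  by rewrite !expr0 subrr normr0 mul0r mulr1.
rewrite expr1n expr0n /= mulr0 subr0 mulr1 ler_wpM2l// exprS ler_peMr ?(ltW rho0)//.
by rewrite exprn_ege1// ltW.
Qed.

(** * Substituting power series into an analytic map *)

Lemma cube_sum_le_esum (R : realType) m K (F : {ffun 'I_m -> nat} -> \bar R) :
  (\sum_(b : {ffun 'I_m -> 'I_K}) F [ffun i => b i : nat] <=
   \esum_(a in [set: {ffun 'I_m -> nat}]) F a)%E.
Proof.
pose phi (b : {ffun 'I_m -> 'I_K}) : {ffun 'I_m -> nat} := [ffun i => b i : nat].
have phi_inj : injective phi.
  move=> b b' /ffunP bb; apply/ffunP => i; apply: val_inj.
  by have := bb i; rewrite !ffunE.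
apply: esum_ge; exists [set` [seq phi b | b <- enum {: {ffun 'I_m -> 'I_K}}]].
  by split => //; exact: finite_seq.
rewrite -fsbig_seq; last by rewrite map_inj_uniq// enum_uniq.
rewrite big_map big_enum le_eqVlt; apply/orP; left; apply/eqP; exact: eq_bigl.
Qed.

Lemma sum_nat_eq1P m (b : 'I_m -> nat) : (\sum_i b i = 1)%N ->
  exists2 i0, b i0 = 1%N & forall i, i != i0 -> b i = 0%N.
Proof.
move=> b1; have [i0 bi0] : exists i0, b i0 != 0%N.
  apply/existsP; rewrite -negb_forall; apply/negP => /forallP b0.
  by move: b1; rewrite big1 // => i _; apply/eqP; exact: b0.
move: b1; rewrite (bigD1 i0)//=.
move: bi0; case E : (b i0) => [//|[|k]] _ //; rewrite add1n => -[/eqP].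
rewrite sum_nat_eq0 => /forallP h; exists i0 => // i ii0.
by apply/eqP; have := h i; rewrite ii0.
Qed.

(** First-order Taylor expansion of f at p with quadratic remainder, measured on
    analytic curves near p rather than on points: if the coordinates
    of u have norm at most M, the remainder along u has norm at most C M^2. *)
Definition power_series_expansion (R : realType) m n (f : 'cV[R]_m -> 'cV[R]_n)
    (p : 'cV[R]_m) (L : 'M[R]_(n, m)) (C r : R) : Prop :=
  [/\ 0 <= C, 0 < r & forall (rho M : R) (u : R -> 'cV[R]_m), 0 < rho ->
    0 <= M <= r -> (forall i, power_series rho M (fun t => u t i 0)) ->
    forall j, power_series rho (C * M ^+ 2) (fun t => (f (p + u t) - f p - L *m u t) j 0)].

(** Along the finite cubes of exponents, the truncations of f are polynomials in
    u; their parts of degree at least two have norm at most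
    sum_(|b| > 1) M^|b| |c_b| <= (M / r1)^2 sum_b r1^|b| |c_b|.
    The cubes converge pointwise, and L is the ultralimit of the linear parts, so
    the closure of [power_series] under pointwise limits applies. *)
Lemma analytic_expansion (R : realType) m n (f : 'cV[R]_m -> 'cV[R]_n)
    (p : 'cV[R]_m) : analytic_at f p -> exists L C r, power_series_expansion f p L C r.
Proof.
move=> [c [r [r0 fP]]].
pose r1 := r / 2.
have r10 : 0 < r1 by rewrite divr_gt0.
have r1r : r1 < r by rewrite ltr_pdivrMr// mulr_natr mulr2n ltrDl.
pose deg K (b : {ffun 'I_m -> 'I_K}) := (\sum_i b i)%N.
pose cb K (b : {ffun 'I_m -> 'I_K}) := c [ffun i => b i : nat].
have monE K (h : 'cV[R]_m) (b : {ffun 'I_m -> 'I_K}) :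
    monomial h [ffun i => b i : nat] = \prod_i h i 0 ^+ b i.
  by apply: eq_bigr => i _; rewrite ffunE.
have [S SP] : exists S : R, forall K,
    \sum_(b : {ffun 'I_m -> 'I_K}) r1 ^+ deg K b * `|cb K b| <= S.
  have h0r : `|const_mx r1 : 'cV[R]_m| < r.
    apply: le_lt_trans r1r; apply: col_norm_le => [|i]; first exact: ltW.
    by rewrite mxE ger0_norm// ltW.
  have [sm _] := fP _ h0r.
  move: sm; rewrite /summable.
  set F := (fun a => `|_|)%E => sm.
  have F0 : (0 <= \esum_(a in [set: {ffun 'I_m -> nat}]) F a)%E.
    by apply: esum_ge0 => a _; exact: abse_ge0.
  have Ffin : (\esum_(a in [set: {ffun 'I_m -> nat}]) F a)%E \is a fin_num.
    by rewrite ge0_fin_numE.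
  exists (fine (\esum_(a in [set: {ffun 'I_m -> nat}]) F a)%E) => K.
  rewrite -lee_fin fineK// -sumEFin.
  apply: le_trans (cube_sum_le_esum K F); apply: lee_sum => b _.
  rewrite /F /= lee_fin normr_id normrZ monE.
  rewrite (_ : \prod_i _ = r1 ^+ deg K b); last first.
    by rewrite /deg expr_sum; apply: eq_bigr => i _; rewrite mxE.
  by rewrite ger0_norm// exprn_ge0// ltW.
have S0 : 0 <= S.
  apply: le_trans (SP 0%N); apply: sumr_ge0 => b _.
  by rewrite mulr_ge0// exprn_ge0// ltW.
(* [full] minus its value at 0 minus its linear part leaves exactly the terms of
   degree at least two *)
have mon0 K (b : {ffun 'I_m -> 'I_K}) : (0 < deg K b)%N ->
    \prod_i (0 : 'cV[R]_m) i 0 ^+ b i = 0.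
  rewrite lt0n sum_nat_eq0 negb_forall => /existsP[i /= bi].
  by rewrite (bigD1 i)//= mxE expr0n (negbTE bi) mul0r.
have mon_deg0 K (b : {ffun 'I_m -> 'I_K}) (h : 'cV[R]_m) : deg K b = 0%N ->
    \prod_i h i 0 ^+ b i = 1.
  move/eqP; rewrite sum_nat_eq0 => /forallP b0; rewrite big1// => i _.
  by move: (b0 i) => /= /eqP ->; rewrite expr0.
have mon_deg1 K (b : {ffun 'I_m -> 'I_K}) (h : 'cV[R]_m) : deg K b = 1%N ->
    \prod_i h i 0 ^+ b i = \sum_i (b i)%:R * h i 0.
  move=> /sum_nat_eq1P[i0 b1 b0].
  rewrite (bigD1 i0)//= [RHS](bigD1 i0)//= b1 expr1 mul1r !big1 ?mulr1 ?addr0//.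
    by move=> i /b0 ->; rewrite mul0r.
  by move=> i /b0 ->; rewrite expr0.
pose full K (h : 'cV[R]_m) := \sum_(b : {ffun 'I_m -> 'I_K})
  (\prod_i h i 0 ^+ b i) *: cb K b.
pose lin K : 'M[R]_(n, m) := \sum_(b : {ffun 'I_m -> 'I_K} | deg K b == 1%N)
  cb K b *m \row_i (b i)%:R.
pose quad K (h : 'cV[R]_m) := \sum_(b : {ffun 'I_m -> 'I_K} | (1 < deg K b)%N)
  (\prod_i h i 0 ^+ b i) *: cb K b.
have quadE K h : quad K h = full K h - full K 0 - lin K *m h.
  rewrite /quad /full /lin mulmx_suml big_mkcond -sumrB.
  rewrite [X in _ = _ - X]big_mkcond -sumrB; apply: eq_bigr => b _.
  case E : (deg K b) => [|[|k]] /=.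
  - by rewrite !mon_deg0// subrr subr0.
  - rewrite mon0 ?E// scale0r subr0 mon_deg1//; apply/esym/eqP; rewrite subr_eq0.
    apply/eqP/matrixP => i j; rewrite -mulmxA !mxE big_ord1 !ord1 mulrC; congr (_ * _).
    by rewrite mxE; apply: eq_bigr => k _; rewrite mxE.
  - by rewrite mon0 ?E// scale0r !subr0.
have full_cvg h : `|h| < r -> full K h @[K --> \oo] --> f (p + h).
  move=> hr; have [_] := fP h hr; rewrite /full /cb.
  by under eq_fun do under eq_bigr do rewrite monE.
have [U [UU Uoo]] := ultrafilter_oo.
have lin_bound K i j : `|lin K i j| <= S / r1.
  rewrite /lin summxE (le_trans (ler_norm_sum _ _ _))// ler_pdivlMr//.
  rewrite mulr_suml (le_trans _ (SP K))// big_mkcond; apply: ler_sum => b _.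
  case: eqP => [b1|_]; last by rewrite mulr_ge0// exprn_ge0// ltW.
  rewrite b1 expr1 mulrC ler_pM2l// mxE big_ord1 normrM mxE normr_nat.
  rewrite -[leRHS]mulr1 ler_pM ?mx_coord_le// -[leRHS]/(1%:R) ler_nat.
  by move: b1; rewrite /deg (bigD1 j)//= => <-; rewrite leq_addr.
have [L LP] : {L : 'M[R]_(n, m) | forall i j, lin K i j @[K --> U] --> L i j}.
  have h i j : {l : R | lin K i j @[K --> U] --> l}.
    by apply: cid; exact: (ultra_bounded_cvg UU (fun K => lin_bound K i j)).
  by exists (\matrix_(i, j) sval (h i j)) => i j; rewrite mxE; exact: (svalP (h i j)).
exists L, (S / r1 ^+ 2), r1; split => //.
  by rewrite divr_ge0// exprn_ge0// ltW.
move=> rho M u rho0 /andP[M0 Mr1] uM j.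
apply: (@power_series_lim _ _ _ U _ (fun K t => quad K (u t) j 0)) => // [K|t trho].
  apply: (@power_series_le _ _ (\sum_(b : {ffun 'I_m -> 'I_K} | (1 < deg K b)%N)
     M ^+ deg K b * `|cb K b|)).
    rewrite (@le_trans _ _ ((M / r1) ^+ 2 * S))//; last first.
      by rewrite expr_div_n mulrC mulrA mulrAC.
    apply: (@le_trans _ _ (\sum_(b : {ffun 'I_m -> 'I_K})
        (M / r1) ^+ 2 * (r1 ^+ deg K b * `|cb K b|))); last first.
      by rewrite -mulr_sumr ler_wpM2l ?sqr_ge0.
    rewrite big_mkcond; apply: ler_sum => b _.
    have t0 : 0 <= r1 ^+ deg K b * `|cb K b| by rewrite mulr_ge0// exprn_ge0// ltW.
    case: ifPn => db; last by rewrite mulr_ge0 ?sqr_ge0.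
    rewrite mulrA ler_wpM2r//.
    have -> : M ^+ deg K b = (M / r1) ^+ deg K b * r1 ^+ deg K b.
      by rewrite -exprMn divfK// gt_eqF.
    rewrite ler_wpM2r ?exprn_ge0 ?(ltW r10)// ler_wiXn2l//.
      by rewrite divr_ge0// ltW.
    by rewrite ler_pdivrMr// mul1r.
  apply: (@power_series_eq _ _ _ (fun t => \sum_(b : {ffun 'I_m -> 'I_K} | (1 < deg K b)%N)
      cb K b j 0 * \prod_i u t i 0 ^+ b i)).
    by move=> t _; rewrite /quad summxE; apply: eq_bigr => b _; rewrite mxE mulrC.
  apply: power_series_sum => [|b _]; first exact: ltW.
  rewrite mulrC; apply: (@power_series_le _ _ (`|cb K b j 0| * M ^+ deg K b)).
    by rewrite ler_wpM2r ?exprn_ge0// mx_coord_le.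
  apply: power_seriesZ; rewrite /deg expr_sum; apply: power_series_prod => // i.
  exact: power_seriesX.
have ur : `|u t| < r.
  apply: le_lt_trans r1r; apply: col_norm_le => [|i]; first exact: ltW.
  exact: le_trans (power_series_bound (uM i) trho) Mr1.
have UF (g : nat -> 'cV[R]_n) (l : 'cV[R]_n) :
    g K @[K --> \oo] --> l -> g K j 0 @[K --> U] --> l j 0.
  move=> gl; have gU : g K @[K --> U] --> l by move=> A /gl; exact: Uoo.
  by apply: (@cvg_comp _ _ _ g (fun M : 'cV[R]_n => M j 0) _ _ _ gU); exact: coord_continuous.
under eq_fun do rewrite quadE !mxE.
rewrite !mxE; apply: cvgB.
  apply: cvgB; first by apply: (UF (full ^~ (u t))); exact: full_cvg.
  have := full_cvg 0; rewrite normr0 addr0 => /(_ r0); exact: (UF (full ^~ 0)).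
apply: (@cvg_sumr _ _ _ U _ _ _ (fun k K => lin K j k * u t k 0)) => k.
exact: cvgMl.
Qed.

(** On the line through u and v, parametrised by v + s (u - v), the remainder is a
    power series of norm at most 9 C d^2 on the disc of radius
    rho = 2 d / |u - v|; its increment from s = 0 to s = 1 is at most that norm
    divided by rho, that is O(d) |u - v|. *)
Lemma expansion_strict_diff (R : realType) m n (f : 'cV[R]_m -> 'cV[R]_n)
    (p : 'cV[R]_m) L C r : power_series_expansion f p L C r -> strict_diff f p L.
Proof.
move=> [C0 r0 fE] e e0.
have C1 : 0 < 9 * C + 9 by rewrite ltr_wpDl// mulr_ge0.
pose d := Num.min (r / 3) (2 * e / (9 * C + 9)).
have d0 : 0 < d by rewrite lt_min !divr_gt0// mulr_gt0.
have dr : 3 * d <= r by rewrite mulrC -ler_pdivlMr// ge_min lexx.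
have de : d * (9 * C + 9) <= 2 * e by rewrite -ler_pdivlMr// ge_min lexx orbT.
exists d => // u v ud vd; have [->|uv] := eqVneq u v.
  by rewrite !subrr mulmx0 subrr !normr0 mulr0.
pose w := u - v.
have w0 : 0 < `|w| by rewrite normr_gt0 subr_eq0.
have wd : `|w| < 2 * d.
  have -> : w = (u - p) - (v - p) by rewrite opprB addrA subrK.
  by rewrite (le_lt_trans (ler_normB _ _))// mulr2n mulrDl mul1r ltrD.
pose rho := 2 * d / `|w|.
have rho1 : 1 < rho by rewrite ltr_pdivlMr// mul1r.
have rho0 : 0 < rho := lt_trans ltr01 rho1.
pose x (s : R) := (v - p) + s *: w.
have xM i : power_series rho (3 * d) (fun s => x s i 0).
  apply: (@power_series_le _ _ (`|(v - p) i 0| + `|w i 0| * rho)).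
    have h1 := le_lt_trans (mx_coord_le (v - p) i 0) vd.
    have h2 : `|w i 0| * rho <= 2 * d.
      by rewrite /rho mulrCA ger_pMr ?mulr_gt0// ler_pdivrMr// mul1r mx_coord_le.
    lra.
  apply: (@power_series_eq _ _ _ (fun s => (v - p) i 0 + w i 0 * s)).
    by move=> s _; rewrite /x !mxE [s * _]mulrC.
  apply: power_seriesD; first exact: ltW.
    by apply: power_series_cst; exact: ltW.
  by apply: power_seriesZ; apply: power_series_id; exact: ltW.
apply: col_norm_le => [|j]; first by rewrite mulr_ge0// ltW.
have M0 : 0 <= 3 * d <= r by rewrite dr mulr_ge0// ltW.
have := power_series_increment rho1 (fE rho (3 * d) x rho0 M0 xM j).
have -> : p + x 1 = u by rewrite /x scale1r /w; apply/matrixP => a b; rewrite !mxE; ring.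
have -> : p + x 0 = v by rewrite /x scale0r; apply/matrixP => a b; rewrite !mxE; ring.
have -> : (f u - f p - L *m x 1) j 0 - (f v - f p - L *m x 0) j 0 =
    (f u - f v - L *m (u - v)) j 0.
  have -> : x 1 = x 0 + w by rewrite /x scale1r scale0r addr0.
  rewrite mulmxDr -/w; move: (L *m _) (L *m _) => X Y; rewrite !mxE; ring.
move=> h; apply: (le_trans h); rewrite /rho invf_div mulrCA mulrC -/w ler_wpM2r//.
rewrite ler_pdivrMr ?mulr_gt0//.
have : 0 <= d * (2 * e - d * (9 * C + 9)) by rewrite mulr_ge0 ?subr_ge0// ltW.
have : 0 <= d * d by rewrite mulr_ge0// ltW.
lra.
Qed.

(** * The perturbed vector field as a function of the pair (x, e) *)

Definition field_pair (R : realType) N (A : 'M[R]_N) (f0 : 'cV[R]_N -> 'cV[R]_N)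
    (g : 'cV[R]_(N + 1) -> 'cV[R]_N) (z : 'cV[R]_(N + 1)) : 'cV[R]_N :=
  A *m usubmx z + f0 (usubmx z) + dsubmx z 0 0 *: g z.

Lemma field_pairE (R : realType) N (A : 'M[R]_N) f0 g (x : 'cV[R]_N) (e : R) :
  field_pair A f0 g (pair_col x e) = A *m x + f0 x + e *: g (pair_col x e).
Proof. by rewrite /field_pair /pair_col col_mxKu col_mxKd mxE. Qed.

Lemma field_pair_strict_diff (R : realType) N (A : 'M[R]_N) (f0 : 'cV[R]_N -> 'cV[R]_N)
    (g : 'cV[R]_(N + 1) -> 'cV[R]_N) x (e : R) L M :
  strict_diff f0 x L -> strict_diff g (pair_col x e) M ->
  exists2 J, strict_diff (field_pair A f0 g) (pair_col x e) J &
    lsubmx J = A + L + e *: lsubmx M.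
Proof.
move=> f0L gM; pose P : 'M[R]_(N, N + 1) := row_mx 1%:M 0.
have PE (z : 'cV[R]_(N + 1)) : P *m z = usubmx z.
  by rewrite -{1}[z]vsubmxK mul_row_col mul1mx mul0mx addr0.
pose k : 'I_(N + 1) := rshift N 0.
have Pz : P *m pair_col x e = x by rewrite PE /pair_col col_mxKu.
have f0L' : strict_diff f0 (P *m pair_col x e) L by rewrite Pz.
(* e g(x, e) contributes e D_x g to the x-derivative; its other term,
   g(x, e) times the last coordinate form, lies in the e-column *)
have := strict_diffD (strict_diffD (@strict_diff_mulmx _ _ _ (A *m P) (pair_col x e))
    (strict_diff_comp_mulmx f0L'))
  (strict_diff_scale_coord k gM).
set J := (X in strict_diff _ _ X) => JP; exists J.
  apply: strict_diff_near_eq ltr01 _ JP => z _.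
  by rewrite /field_pair -mulmxA PE [dsubmx z 0 0]mxE.
rewrite /J !linearD /= linearZ /= -!mulmx_lsub /P row_mxKl !mulmx1.
have -> : lsubmx (delta_mx 0 k) = 0 :> 'M[R]_(1, N).
  apply/matrixP => i j; rewrite !mxE /k.
  by rewrite (_ : lshift 1 j == rshift N 0 = false) ?andbF// eq_lrshift.
by rewrite mulmx0 addr0 /pair_col col_mxEd mxE.
Qed.

(** * Analyticity of the branch of zeros *)

Lemma power_series_mulmx (R : realType) m n (A : 'M[R]_(n, m)) (rho M : R)
    (v : R -> 'cV[R]_m) : 0 <= rho -> (forall j, power_series rho M (fun t => v t j 0)) ->
  forall i, power_series rho (m%:R * `|A| * M) (fun t => (A *m v t) i 0).
Proof.
move=> rho0 vM i.
apply: (@power_series_le _ _ (\sum_(j < m) `|A i j| * M)).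
  apply: (@le_trans _ _ (\sum_(j < m) `|A| * M)).
    by apply: ler_sum => j _; rewrite ler_wpM2r ?mx_coord_le// (power_series_ge0 (vM j)).
  by rewrite sumr_const card_ord -[leLHS]mulr_natl mulrA.
apply: (@power_series_eq _ _ _ (fun t => \sum_j A i j * v t j 0)).
  by move=> t _; rewrite mxE.
by apply: power_series_sum => // j _; exact: power_seriesZ.
Qed.

Lemma power_series_mulid (R : realType) (rho M : R) f : 0 < rho -> power_series rho M f ->
  power_series rho (rho * M) (fun t => t * f t).
Proof. by move=> rho0 fM; apply: power_seriesM => //; apply: power_series_id; exact: ltW. Qed.

Section analytic_branch.
Variables (R : realType) (N : nat) (A : 'M[R]_N) (f0 : 'cV[R]_N -> 'cV[R]_N).
Variables (g : 'cV[R]_(N + 1) -> 'cV[R]_N) (e0 K eb : R) (tau : R -> 'cV[R]_N).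
Variables (L : 'M[R]_N) (Lg : 'M[R]_(N, N + 1)) (C Cg r rg : R).
Let p := tau eb.
Let q := pair_col p eb.
Let F := field_pair A f0 g.
Hypotheses (K0 : 0 <= K) (eb0 : `|eb| < e0).
Hypothesis tauF : forall e : R, `|e| < e0 -> F (pair_col (tau e) e) = 0.
Hypothesis tau_lip : forall e e' : R, `|e| < e0 -> `|e'| < e0 ->
  `|tau e - tau e'| <= K * `|e - e'|.
Hypothesis f0E : power_series_expansion f0 p L C r.
Hypothesis gE : power_series_expansion g q Lg Cg rg.
Let D := A + L + eb *: lsubmx Lg.
Hypothesis D_unit : D \in unitmx.

(* the simplified Newton map at the parameter eb + t, centred at p; Hf and Hg are
   the quadratic remainders *)
Let Q (t : R) (x : 'cV[R]_N) := x - invmx D *m F (pair_col (p + x) (eb + t)).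
Let Hf x := f0 (p + x) - f0 p - L *m x.
Let Hg w := g (q + w) - g q - Lg *m w.

(** The linear terms in x cancel, because D is the x-derivative at q; what remains
    is quadratic in (x, t) or has a factor t. *)
Let QE t x : Q t x = (- invmx D) *m (Hf x + eb *: Hg (pair_col x t) +
  (t *: (eb *: rsubmx Lg + g q + Lg *m pair_col x t + Hg (pair_col x t)))).
Proof.
have Fq : A *m p + f0 p + eb *: g q = 0 by rewrite -(tauF eb0) /F field_pairE.
have pair_colE : pair_col (p + x) (eb + t) = q + pair_col x t.
  rewrite /q /pair_col add_col_mx; congr col_mx.
  by apply/matrixP => i j; rewrite !mxE.
rewrite /Q -{1}[x](mulKmx D_unit) -mulmxBr mulNmx -mulmxN; congr (_ *m _).
rewrite /F field_pairE pair_colE.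
have -> : f0 (p + x) = f0 p + L *m x + Hf x.
  rewrite /Hf; move: (f0 _) (f0 _) (_ *m _) => a b c.
  by apply/matrixP => i j; rewrite !mxE; ring.
have gE' : g (q + pair_col x t) = g q + Lg *m pair_col x t + Hg (pair_col x t).
  rewrite /Hg; move: (g _) (g _) (_ *m _) => a b c.
  by apply/matrixP => i j; rewrite !mxE; ring.
rewrite gE' /D !mulmxDl mulmxDr -scalemxAl.
have -> : A *m p = - f0 p - eb *: g q.
  move: Fq; move: (A *m p) => Ap h; apply/eqP; rewrite -subr_eq0.
  by rewrite opprB opprK [_ *: _ + f0 p]addrC addrA h.
move: (Hf x) (Hg _) => a b.
rewrite mulmx_pair_col.
move: (f0 p) (g q) (A *m x) (L *m x) (lsubmx Lg *m x) (rsubmx Lg) => *.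
by apply/matrixP => i j; rewrite !mxE; ring.
Qed.

(** If x has norm M, then Q x has norm O(M^2 + rho): the factor t contributes rho.
    For M small and rho much smaller, the ball of norm M is thus invariant. *)
Let Q_power_series : exists B : R, 0 < B /\ forall (rho M : R) (x : R -> 'cV[R]_N),
  0 < rho -> rho <= M -> M <= 1 -> M <= r -> M <= rg ->
  (forall i, power_series rho M (fun t => x t i 0)) ->
  forall i, power_series rho (B * (M ^+ 2 + rho)) (fun t => Q t (x t) i 0).
Proof.
have [C0 r0 f0P] := f0E; have [Cg0 rg0 gP] := gE.
pose B0 := C + `|eb| * Cg + (`|eb| * `|Lg| + `|g q| + (N + 1)%:R * `|Lg| + Cg).
have B00 : 0 <= B0 by rewrite !addr_ge0// mulr_ge0.
exists (N%:R * `|- invmx D| * B0 + 1); split; first by rewrite ltr_wpDl// !mulr_ge0.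
move=> rho M x rho0 rM M1 Mr Mrg xM i.
have rho0' := ltW rho0; have M0 : 0 <= M := le_trans rho0' rM.
have zM k : power_series rho M (fun t => pair_col (x t) t k 0).
  have [j kj|j kj] := fintype.splitP k.
    apply: power_series_eq (xM j) => t _.
    by rewrite /pair_col (_ : k = lshift 1 j) ?col_mxEu//; exact: val_inj.
  apply: power_series_le rM _; apply: power_series_eq (power_series_id rho0') => t _.
  by rewrite /pair_col (_ : k = rshift N j) ?col_mxEd ?mxE//; exact: val_inj.
have HfM j : power_series rho (C * M ^+ 2) (fun t => Hf (x t) j 0).
  by apply: f0P; rewrite ?M0.
have HgM j : power_series rho (Cg * M ^+ 2) (fun t => Hg (pair_col (x t) t) j 0).
  by apply: (gP rho M (fun t => pair_col (x t) t)); rewrite ?M0.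
have LgM j : power_series rho ((N + 1)%:R * `|Lg| * M) (fun t => (Lg *m pair_col (x t) t) j 0).
  exact: (@power_series_mulmx _ _ _ Lg rho M (fun t => pair_col (x t) t)).
have cM j : power_series rho (`|eb| * `|Lg| + `|g q|)
    (fun=> eb * rsubmx Lg j 0 + g q j 0).
  apply: power_series_le (power_series_cst _ rho0'); rewrite (le_trans (ler_normD _ _))//.
  rewrite lerD ?mx_coord_le// normrM ler_wpM2l//.
  by rewrite mxE mx_coord_le.
have RM j : power_series rho (B0 * (M ^+ 2 + rho))
  (fun t => (Hf (x t) + eb *: Hg (pair_col (x t) t) +
  (t *: (eb *: rsubmx Lg + g q + Lg *m pair_col (x t) t + Hg (pair_col (x t) t)))) j 0).
  have s1 := power_seriesD rho0' (HfM j) (power_seriesZ eb (HgM j)).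
  have s2 := power_series_mulid rho0
    (power_seriesD rho0' (power_seriesD rho0' (cM j) (LgM j)) (HgM j)).
  have s3 := power_seriesD rho0' s1 s2.
  apply: (@power_series_le _ _ (C * M ^+ 2 + `|eb| * (Cg * M ^+ 2) + rho *
      (`|eb| * `|Lg| + `|g q| + (N + 1)%:R * `|Lg| * M + Cg * M ^+ 2))).
    pose c := `|eb| * `|Lg| + `|g q|.
    have c0 : 0 <= c by rewrite addr_ge0// mulr_ge0.
    pose l := (N + 1)%:R * `|Lg|.
    have l0 : 0 <= l by rewrite mulr_ge0.
    have M2 : M ^+ 2 <= 1 by rewrite expr_le1.
    rewrite /B0 -/c -/l.
    have M20 : 0 <= M ^+ 2 by rewrite sqr_ge0.
    have h1 : 0 <= (c + l + Cg) * M ^+ 2 by rewrite mulr_ge0 ?addr_ge0.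
    have h2 : 0 <= (C + `|eb| * Cg) * rho by rewrite mulr_ge0 ?addr_ge0 ?mulr_ge0.
    have h3 : 0 <= rho * (l * (1 - M)) by rewrite !mulr_ge0// subr_ge0.
    have h4 : 0 <= rho * (Cg * (1 - M ^+ 2)) by rewrite !mulr_ge0// subr_ge0.
    move: h1 h2 h3 h4; set m2 := M ^+ 2; lra.
  apply: power_series_eq s3 => t _.
  move: (Hf _) (Hg _) (Lg *m _) (rsubmx Lg) (g q) => a b c d e'.
  by rewrite !mxE; ring.
apply: (@power_series_le _ _ (N%:R * `|- invmx D| * (B0 * (M ^+ 2 + rho)))).
  by rewrite mulrA ler_wpM2r ?lerDl// addr_ge0// sqr_ge0.
apply: power_series_eq (power_series_mulmx (- invmx D) rho0' RM i) => t _.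
by rewrite QE.
Qed.

(** The iterates of Q from 0 have norm at most M for all n and converge pointwise to
    tau (eb + t) - p, the fixed point of the contraction. *)
Lemma analytic_branch_power_series : exists rho M : R, 0 < rho /\
  forall i, power_series rho M (fun t => tau (eb + t) i 0).
Proof.
have [C0 r0 f0P] := f0E; have [Cg0 rg0 gP] := gE.
have [B [B0 QB]] := Q_power_series.
have [J FJ JD] := field_pair_strict_diff A
  (expansion_strict_diff f0E) (expansion_strict_diff gE).
have [k k0 kP] := mulmx_bound (invmx D).
have k2 : 0 < (2 * k)^-1 by rewrite invr_gt0 mulr_gt0.
have [d d0 Fd] := FJ _ k2.
have [M [M0 M1 Md [Mr Mrg MB]]] : exists M : R,
    [/\ 0 < M, M <= 1, M <= d / 2 & [/\ M <= r, M <= rg & M <= (2 * B)^-1]].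
  exists (Num.min (Num.min 1 (d / 2)) (Num.min (Num.min r rg) (2 * B)^-1)).
  rewrite !lt_min ltr01 divr_gt0// r0 rg0 invr_gt0 mulr_gt0//.
  by rewrite !ge_min !lexx ?orbT.
have Mltd : M < d by rewrite (le_lt_trans Md)// ltr_pdivrMr// mulr_natr mulr2n ltrDl.
have K1 : 0 < K + 1 by rewrite ltr_wpDl.
have [rho [rho0 rM [rB re rK]]] : exists rho : R, [/\ 0 < rho, rho <= M &
    [/\ rho <= M / (2 * B), rho <= e0 - `|eb| & rho <= M / (K + 1)]].
  exists (Num.min (Num.min M (M / (2 * B))) (Num.min (e0 - `|eb|) (M / (K + 1)))).
  rewrite !lt_min M0 !divr_gt0 ?mulr_gt0// subr_gt0 eb0.
  by rewrite !ge_min !lexx ?orbT.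
exists rho, (`|p| + M); split => //.
pose X := fix X (k : nat) (t : R) : 'cV[R]_N := if k is k'.+1 then Q t (X k' t) else 0.
have XM n : forall i, power_series rho M (fun t => X n t i 0).
  elim: n => [|n IH] i.
    apply: (@power_series_le _ _ 0); first exact: ltW.
    have := power_series_cst 0 (ltW rho0); rewrite normr0.
    by apply: power_series_eq => t _; rewrite mxE.
  apply: power_series_le (QB rho M (X n) rho0 rM M1 Mr Mrg IH i).
  have h1 : B * M ^+ 2 <= M / 2.
    have MB2 : 2 * B * M <= 1 by rewrite mulrC -ler_pdivlMr ?mulr_gt0// mul1r.
    have : 0 <= M * (1 - 2 * B * M) by rewrite mulr_ge0 ?subr_ge0// ltW.
    lra.
  have h2 : B * rho <= M / 2.
    by rewrite mulrC -ler_pdivlMr// -mulrA -invfM.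
  by rewrite mulrDr; lra.
pose y t := tau (eb + t) - p.
have te (t : R) : `|t| < rho -> `|eb + t| < e0.
  move=> tr; have h := lt_le_trans tr re.
  by rewrite (le_lt_trans (ler_normD _ _))// -ltrBrDl.
have yM t : `|t| < rho -> `|y t| <= M.
  move=> tr; rewrite (le_trans (tau_lip (te t tr) eb0))//.
  rewrite [eb + t]addrC addrK (@le_trans _ _ ((K + 1) * rho))//.
    by rewrite ler_pM// ?lerDl// ltW.
  by rewrite mulrC -ler_pdivlMr.
have Qy t : `|t| < rho -> Q t (y t) = y t.
  move=> tr; rewrite /Q /y [p + _]addrC subrK tauF ?mulmx0 ?subr0//.
  exact: te.
have Qc (t : R) x x' : `|t| < rho -> `|x| <= M -> `|x'| <= M ->
    `|Q t x - Q t x'| <= 2^-1 * `|x - x'|.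
  move=> tr xM x'M.
  have near z : `|z| <= M -> `|pair_col (p + z) (eb + t) - q| < d.
    move=> zM; rewrite /q pair_colB [p + z]addrC [eb + t]addrC !addrK pair_col_norm_lt//.
      exact: le_lt_trans Mltd.
    by rewrite (lt_trans tr)// (le_lt_trans rM).
  have := Fd _ _ (near x xM) (near x' x'M).
  have -> : pair_col (p + x) (eb + t) - pair_col (p + x') (eb + t) = pair_col (x - x') 0.
    rewrite pair_colB subrr; congr pair_col.
    by move: p => a; apply/matrixP => i j; rewrite !mxE; ring.
  rewrite mulmx_pair_col scale0r addr0 JD -/D => h.
  have pzn : `|pair_col (x - x') 0| <= `|x - x'|.
    by rewrite (le_trans (pair_col_norm_add _ _))// normr0 addr0.
  have -> : Q t x - Q t x' = - (invmx D *m (F (pair_col (p + x) (eb + t)) -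
      F (pair_col (p + x') (eb + t)) - D *m (x - x'))).
    rewrite /Q !mulmxBr !mulKmx//.
    move: (invmx D *m _) (invmx D *m _) => a b; apply/matrixP => i j; rewrite !mxE; ring.
  rewrite normrN (le_trans (kP _ _))// mulrC -ler_pdivlMr// (le_trans h)//.
  rewrite invfM [leRHS]mulrAC ler_wpM2l// mulr_ge0// invr_ge0// ltW//.
have Xb n t : `|t| < rho -> `|X n t| <= M.
  move=> tr; apply: col_norm_le => [|i]; first exact: ltW.
  exact: power_series_bound (XM n i) tr.
have Xy n t : `|t| < rho -> `|X n t - y t| <= M * 2^-1 ^+ n.
  move=> tr; elim: n => [|n IH].
    by rewrite expr0 mulr1 sub0r normrN yM.
  rewrite -(Qy t tr) /= (le_trans (Qc _ _ _ tr (Xb n t tr) (yM t tr)))//.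
  by rewrite exprS mulrCA ler_wpM2l// invr_ge0.
move=> i; apply: (@power_series_eq _ _ _ (fun t => p i 0 + y t i 0)).
  by move=> t _; rewrite /y !mxE [p i 0 + _]addrC subrK.
apply: power_seriesD; first exact: ltW.
  by apply: power_series_le (power_series_cst _ (ltW rho0)); exact: mx_coord_le.
apply: (@power_series_lim _ _ _ \oo _ (fun n t => X n t i 0)) => // t tr.
have geo : M * 2^-1 ^+ n @[n --> \oo] --> (0 : R).
  rewrite -[X in _ --> X](mulr0 M); apply: cvgMr; apply: cvg_expr.
  by rewrite ger0_norm ?invr_ge0// invf_lt1// ltr1n.
apply/cvgrPdist_le => eta eta0; move/cvgrPdist_le : geo => /(_ eta eta0).
apply: filterS => n; rewrite sub0r normrN => h.
have := mx_coord_le (y t - X n t) i 0; rewrite !mxE => h'.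
by rewrite (le_trans h')// distrC (le_trans (Xy n t tr))// (le_trans (ler_norm _)).
Qed.

End analytic_branch.

(** In one variable a multi-index is a number and the cube {0, .., K-1}^1 is an
    initial segment. *)
Lemma analytic_of_power_series (R : realType) N (T : 'cV[R]_1 -> 'cV[R]_N) (z : 'cV[R]_1)
    (rho M : R) : 0 < rho ->
  (forall i, power_series rho M (fun t => T (z + const_mx t) i 0)) -> analytic_at T z.
Proof.
move=> rho0 TM.
have [al alP] : {al : 'I_N -> nat -> R & forall i,
    (forall K : nat, \sum_(n < K) `|al i n| * rho ^+ n <= M) /\
    forall t : R, `|t| < rho ->
      \sum_(n < K) al i n * t ^+ n @[K --> \oo] --> T (z + const_mx t) i 0}.
  exact: (@boolp.choice 'I_N (nat -> R) (fun i a =>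
    (forall K : nat, \sum_(n < K) `|a n| * rho ^+ n <= M) /\
    forall t : R, `|t| < rho ->
      \sum_(n < K) a n * t ^+ n @[K --> \oo] --> T (z + const_mx t) i 0)).
pose c (a : {ffun 'I_1 -> nat}) : 'cV[R]_N := \col_i al i (a 0).
exists c, rho; split => // h hrho.
pose t : R := h 0 0; have trho : `|t| < rho := le_lt_trans (mx_coord_le h 0 0) hrho.
have hE : h = const_mx t by apply/matrixP => i j; rewrite !ord1 mxE.
have monE a : monomial h a = t ^+ a 0 by rewrite /monomial big_ord1.
split.
  rewrite /summable.
  pose e (n : nat) : {ffun 'I_1 -> nat} := [ffun=> n].
  have eb : set_bij [set: nat] [set: {ffun 'I_1 -> nat}] e.
    split=> [//|n n' _ _ /ffunP/(_ 0)|a _]; first by rewrite !ffunE.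
    by exists (a 0) => //; apply/ffunP => i; rewrite !ffunE ord1.
  rewrite (@reindex_esum _ _ _ _ _ e _ eb) -nneseries_esumT; last by move=> n; exact: abse_ge0.
  apply: (@le_lt_trans _ _ (\sum_(i < N) M)%:E); last exact: ltry.
  apply: lime_le; first by apply: is_cvg_nneseries => n _ _; exact: abse_ge0.
  apply: nearW => K; rewrite big_mkord.
  rewrite (eq_bigr (fun n : 'I_K => (`|t ^+ n *: c (e n)|)%:E)); last first.
    by move=> n _; rewrite /= monE ffunE normr_id.
  rewrite sumEFin lee_fin.
  apply: (@le_trans _ _ (\sum_(n < K) \sum_(i < N) `|al i n| * rho ^+ n)).
    apply: ler_sum => n _; rewrite normrZ.
    have rn : `|t ^+ n| <= rho ^+ n by rewrite normrX lerXn2r ?nnegrE// ltW.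
    have cn : `|c (e n)| <= \sum_(i < N) `|al i n|.
      apply: col_norm_le => [|i]; first by apply: sumr_ge0.
      by rewrite mxE ffunE (bigD1 i)//= lerDl sumr_ge0.
    by rewrite -mulr_suml mulrC ler_pM.
  by rewrite exchange_big /=; apply: ler_sum => i _; have [h1 _] := alP i; exact: h1.
rewrite (_ : (fun K : nat => _) = (fun K => \sum_(n < K) t ^+ n *: \col_i al i n)).
  apply: cvg_col => i; rewrite hE; have [_ /(_ t trho)] := alP i.
  apply: cvg_trans; apply: near_eq_cvg; apply: nearW => K.
  by rewrite summxE; apply: eq_bigr => n _; rewrite !mxE mulrC.
apply/funext => K.
rewrite (reindex (fun n : 'I_K => [ffun=> n] : {ffun 'I_1 -> 'I_K})); last first.
  apply: onW_bij; exists (fun b : {ffun 'I_1 -> 'I_K} => b 0) => [n|b].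
    by rewrite ffunE.
  by apply/ffunP => i; rewrite ffunE ord1.
apply: eq_bigr => n _; rewrite monE !ffunE; congr (_ *: _).
by apply/matrixP => i j; rewrite !mxE !ffunE.
Qed.

(** * Local analysis of the perturbed field near the origin *)

Lemma class_strict_diff (R : realType) m n (r : smoothness) (O : set 'cV[R]_m)
    (f : 'cV[R]_m -> 'cV[R]_n) p : r <> Cfin 0 -> open O -> O p ->
  class_on_open r O f -> exists L, strict_diff f p L.
Proof.
move=> r0 oO Op; case: r r0 => [[//|k] _| |] /=.
- move=> fC; exists (jacobian_mx f p); apply: (C1_strict_diff oO Op).
  by apply: (@CkV_leq _ _ _ 1 k.+1) => //; exact/CkVE.
- by move=> _ fC; exists (jacobian_mx f p); apply: (C1_strict_diff oO Op); exact/CkVE/fC.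
- move=> _ /(_ p Op)/analytic_expansion[L [C [s fE]]].
  by exists L; exact: expansion_strict_diff fE.
Qed.

(** Along the ray h w both f and its remainder are o(h), so L w = 0. *)
Lemma strict_diff_quadratic (R : realType) m n (f : 'cV[R]_m -> 'cV[R]_n) L (C d : R) :
  0 < d -> (forall x, `|x| < d -> `|f x| <= C * `|x| ^+ 2) -> strict_diff f 0 L -> L = 0.
Proof.
move=> d0 fC fL.
have f0 : f 0 = 0.
  have := fC 0; rewrite normr0 expr0n mulr0 => /(_ d0).
  by rewrite normr_le0 => /eqP.
have Lw (w : 'cV[R]_m) : L *m w = 0.
  apply/eqP; rewrite -normr_le0; apply/ler_addgt0Pr => eta eta0; rewrite add0r.
  have w1 : 0 < `|w| + 1 by rewrite ltr_wpDl.
  have C1 : 0 < `|C| + 1 by rewrite ltr_wpDl.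
  have eta2 : 0 < eta / 2 by rewrite divr_gt0.
  have [d' d'0 fL'] := fL (eta / 2 / (`|w| + 1)) (divr_gt0 eta2 w1).
  pose b := eta / 2 / ((`|C| + 1) * (`|w| + 1)).
  have b0 : 0 < b by rewrite divr_gt0// mulr_gt0.
  have [t [t0 td td' tb]] : exists t : R, [/\ 0 < t, t <= d / 2, t <= d' / 2 & t <= b].
    exists (Num.min (Num.min (d / 2) (d' / 2)) b).
    by rewrite !lt_min b0 !divr_gt0// !ge_min !lexx ?orbT.
  pose h := t / (`|w| + 1); have h0 : 0 < h by rewrite divr_gt0.
  have hw : `|h *: w| <= t.
    rewrite normrZ gtr0_norm// /h mulrAC ler_pdivrMr// ler_wpM2l ?(ltW t0)//.
    by rewrite lerDl.
  have hd : `|h *: w| < d by lra.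
  have hd' : `|h *: w - 0| < d' by rewrite subr0; lra.
  have := fL' (h *: w) 0 hd'; rewrite subrr normr0 => /(_ d'0).
  rewrite f0 !subr0 => h1; have h2 := fC _ hd.
  rewrite -(ler_pM2l h0) -{1}(gtr0_norm h0) -normrZ scalemxAr.
  have -> : L *m (h *: w) = f (h *: w) - (f (h *: w) - L *m (h *: w)).
    by rewrite opprB addrC subrK.
  rewrite (le_trans (ler_normB _ _))// [eta]splitr mulrDr lerD//.
    have tbC : (`|C| + 1) * (`|w| + 1) * t <= eta / 2.
      by rewrite mulrC -ler_pdivlMr ?mulr_gt0.
    have s1 : C * `|h *: w| ^+ 2 <= (`|C| + 1) * (t * `|h *: w|).
      apply: (@le_trans _ _ (`|C| * `|h *: w| ^+ 2)).
        by rewrite ler_wpM2r ?sqr_ge0// ler_norm.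
      by rewrite ler_pM ?sqr_ge0 ?lerDl// expr2 ler_wpM2r.
    have s2 : (`|C| + 1) * t * `|w| <= (`|C| + 1) * t * (`|w| + 1).
      by rewrite ler_wpM2l ?lerDl// mulr_ge0// ltW.
    rewrite (le_trans h2)// (le_trans s1)// normrZ (gtr0_norm h0).
    have -> : (`|C| + 1) * (t * (h * `|w|)) = h * ((`|C| + 1) * t * `|w|) by ring.
    rewrite ler_pM2l// (le_trans s2)// (le_trans _ tbC)//.
    by rewrite mulrAC.
  rewrite (le_trans h1)// normrZ (gtr0_norm h0) mulrCA ler_pM2l//.
  by rewrite mulrAC ler_pdivrMr// ler_pM2l// lerDl.
apply/matrixP => i j; have := Lw (delta_mx j 0); rewrite -colE => /matrixP/(_ i 0).
by rewrite !mxE.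
Qed.

Lemma field_pair_Ck (R : realType) N (A : 'M[R]_N) (f0 : 'cV[R]_N -> 'cV[R]_N)
    (g : 'cV[R]_(N + 1) -> 'cV[R]_N) k O0 Og O :
  open O0 -> open Og -> open O -> (forall z, O z -> O0 (usubmx z) /\ Og z) ->
  CkV k O0 f0 -> CkV k Og g -> CkV k O (field_pair A f0 g).
Proof.
move=> oO0 oOg oO OO f0C gC; apply: CkV_of_coords => // i.
have zC j : CkV k O (fun z : 'cV[R]_(N + 1) => z j 0) by exact: CkV_coord.
have uC : CkV k O (fun z : 'cV[R]_(N + 1) => usubmx z).
  apply: CkV_of_coords => // j.
  by apply: CkV_eq (zC (lshift 1 j)) => // z _; rewrite mxE.
apply: (@CkV_eq _ _ _ k O (fun z => \sum_j A i j * z (lshift 1 j) 0 +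
    f0 (usubmx z) i 0 + z (rshift N 0) 0 * g z i 0)) => //.
  move=> z _; rewrite !mxE; congr (_ + _ + _).
  by apply: eq_bigr => j _; rewrite mxE.
apply: CkVD => //.
  apply: CkVD => //.
    by apply: CkV_sum => // j; apply: CkVM => //; exact: CkV_cst.
  apply: (@CkV_comp _ _ _ k O0 O (fun x => f0 x i 0) (fun z => usubmx z)) => //.
    by move=> z /OO[].
  exact: CkV_coord_fun.
apply: CkVM => //; apply: CkV_sub (CkV_coord_fun i oOg gC).
by move=> z /OO[].
Qed.

Section branch_class.
Variables (R : realType) (N : nat) (A : 'M[R]_N) (f0 : 'cV[R]_N -> 'cV[R]_N).
Variables (g : 'cV[R]_(N + 1) -> 'cV[R]_N) (O0 : set 'cV[R]_N).
Variables (Og : set 'cV[R]_(N + 1)) (e0 K d k eps : R) (tau : R -> 'cV[R]_N).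
Variable (J : 'M[R]_(N, N + 1)).
Let F := field_pair A f0 g.
Hypotheses (oO0 : open O0) (oOg : open Og) (K0 : 0 <= K) (k0 : 0 <= k).
Hypotheses (eps0 : 0 <= eps) (keps : k * eps < 1) (e0d : e0 <= d).
Hypothesis dO0 : forall x : 'cV[R]_N, `|x| < d -> O0 x.
Hypothesis dOg : forall z : 'cV[R]_(N + 1), `|z| < d -> Og z.
Hypothesis Ak : forall w : 'cV[R]_N, `|w| <= k * `|lsubmx J *m w|.
Hypothesis FJ : forall u v : 'cV[R]_(N + 1), `|u - 0| < d -> `|v - 0| < d ->
  `|F u - F v - J *m (u - v)| <= eps * `|u - v|.
Hypothesis tau_in : forall e : R, `|e| < e0 -> `|tau e| < d.
Hypothesis tauF : forall e : R, `|e| < e0 -> F (pair_col (tau e) e) = 0.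
Hypothesis tau_lip : forall e e' : R, `|e| < e0 -> `|e'| < e0 ->
  `|tau e - tau e'| <= K * `|e - e'|.

(** A strict derivative of F at any point of the ball is close to J, whose x-part is
    boundedly invertible. *)
Let strict_unit (z : 'cV[R]_(N + 1)) M : `|z| < d -> strict_diff F z M ->
  lsubmx M \in unitmx.
Proof.
move=> zd FM; apply: (@unitmx_perturb _ _ (lsubmx J) _ k eps) => // w.
have zd' : `|z - 0| < d by rewrite subr0.
have := strict_diff_close FJ zd' FM (pair_col w 0).
rewrite mulmx_pair_col scale0r addr0 linearB /= => /le_trans; apply.
rewrite ler_wpM2l// (le_trans (pair_col_norm_add _ _))//.
by rewrite normr0 addr0.
Qed.

Let tau_pair_col (e : R) : `|e| < e0 -> `|pair_col (tau e) e| < d.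
Proof.
move=> ee; apply: pair_col_norm_lt; first exact: tau_in.
exact: lt_le_trans e0d.
Qed.

Let branch_Ck n : CkV n.+1 O0 f0 -> CkV n.+1 Og g ->
  CkV n.+1 [set z : 'cV[R]_1 | `|z 0 0| < e0] (fun z => tau (z 0 0)).
Proof.
move=> f0C gC; pose O := [set z : 'cV[R]_(N + 1) | `|z| < d].
have oO : open O.
  rewrite (_ : O = (fun z : 'cV[R]_(N + 1) => `|z|) @^-1` [set y | y < d])//.
  by apply: open_comp; [move=> z _; exact: norm_continuous|exact: open_lt].
have FC : CkV n.+1 O F.
  apply: (@field_pair_Ck R N A f0 g n.+1 O0 Og O) => // z zd; split; last exact: dOg.
  apply: dO0; apply: le_lt_trans zd; apply: col_norm_le => // i.
  by rewrite mxE mx_coord_le.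
apply: (@smooth_branch _ _ F O e0 K tau) => // z Oz.
exact: (strict_unit Oz (C1_strict_diff oO Oz (CkV_leq (ltn0Sn n) FC))).
Qed.

(** For C^k regularity the branch is differentiated; for analytic regularity it is
    expanded at each of its points. *)
Lemma branch_class (r : smoothness) : r <> Cfin 0 ->
  class_on_open r O0 f0 -> class_on_open r Og g ->
  class_on_open r [set z : 'cV[R]_1 | `|z 0 0| < e0] (fun z => tau (z 0 0)).
Proof.
case: r => [[//|n]||] _ f0C gC.
- by apply/CkVE; apply: branch_Ck; exact/CkVE.
- move=> n; apply/CkVE; apply: CkVW; apply: branch_Ck; apply/CkVE.
    exact: f0C.
  exact: gC.
move=> z Oz; pose eb := z 0 0.
have td := tau_in Oz; have qd := tau_pair_col Oz.
have [L [C [r f0E]]] := analytic_expansion (f0C _ (dO0 td)).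
have [Lg [Cg [rg gE]]] := analytic_expansion (gC _ (dOg qd)).
have [M FM MD] := field_pair_strict_diff A
  (expansion_strict_diff f0E) (expansion_strict_diff gE).
have Du : A + L + eb *: lsubmx Lg \in unitmx by rewrite -MD; exact: strict_unit FM.
have [rho [B [rho0 tauB]]] := analytic_branch_power_series K0 Oz tauF tau_lip f0E gE Du.
apply: (analytic_of_power_series rho0 (M := B)) => i.
by apply: power_series_eq (tauB i) => t _; rewrite !mxE.
Qed.

End branch_class.

Theorem theorem1 (R : realType) (N : nat) (r : smoothness)
    (A : 'M[R]_N) (U : set 'cV[R]_N) (e1 : R)
    (f0 : 'cV[R]_N -> 'cV[R]_N) (f1 : 'cV[R]_N -> R -> 'cV[R]_N)
    (r_pos : r <> Cfin 0)
    (U_open : open U) (U0 : U 0) (e1_gt0 : 0 < e1)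
    (f0_reg : class_on r U f0)
    (f1_reg : class_on_param r U [set e : R | 0 <= e < e1] f1)
    (f0_O2 : f0 =O_ (nbhs (0 : 'cV[R]_N)) (fun x : 'cV[R]_N => `|x| ^+ 2 : R^o))
    (A_stable : forall lam : R[i],
        eigenvalue (map_mx (real_complex R) A) lam -> complex.Re lam < 0) :
  exists (W : set 'cV[R]_N) (e0 : R) (tau : R -> 'cV[R]_N),
    [/\ nbhs (0 : 'cV[R]_N) W, 0 < e0 <= e1, tau 0 = 0,
        forall e : R, 0 < e < e0 ->
          let F := vector_field A f0 f1 e in
          [/\ W (tau e), trivial_NNM U F (tau e),
              forall p, W p -> trivial_NNM U F p -> p = tau e &
              attracts_nearby U F (tau e)]
      & class_on_curve r [set e : R | 0 <= e < e0] tau].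
Proof.
(* C^r extensions of the two terms to open neighbourhoods of the origin *)
have [V0 [g0 [oV0 V00 g0C g0f]]] := f0_reg 0 U0.
have pair_col00 : [set z : 'cV[R]_(N + 1) | U (usubmx z) /\
    [set e : R | 0 <= e < e1] (dsubmx z 0 0)] 0.
  by rewrite /= !linear0 mxE lexx e1_gt0.
have [Vg [g [oVg Vg0 gC gf]]] := f1_reg 0 pair_col00.
have g0E x : V0 x -> U x -> g0 x = f0 x.
  by move=> Ox Ux; apply: g0f; rewrite inE.
have gE x e : Vg (pair_col x e) -> U x -> 0 <= e < e1 -> g (pair_col x e) = f1 x e.
  move=> Oz Ux ee; rewrite gf; first by rewrite /pair_col col_mxKu col_mxKd mxE.
  by rewrite inE; split => //=; rewrite /pair_col col_mxKu col_mxKd mxE.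
have [d1 d1_gt0 [d1e d1V0 d1U d1Vg]] : exists2 d1 : R, 0 < d1 &
    [/\ d1 <= e1, forall x : 'cV[R]_N, `|x| < d1 -> V0 x,
        forall x : 'cV[R]_N, `|x| < d1 -> U x &
        forall z : 'cV[R]_(N + 1), `|z| < d1 -> Vg z].
  have op m (P : set 'cV[R]_m) : open P -> P 0 ->
      exists2 b : R, 0 < b & forall x : 'cV[R]_m, `|x| < b -> P x.
    move=> oP P0; have /nbhs_ballP[b /= b0 bP] := open_nbhs_nbhs (conj oP P0).
    by exists b => // x xb; apply: bP; rewrite -ball_normE /= sub0r normrN.
  have [a a0 aP] := op _ _ oV0 V00; have [b b0 bP] := op _ _ U_open U0.
  have [c c0 cP] := op _ _ oVg Vg0.
  exists (Num.min (Num.min e1 a) (Num.min b c)).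
    by rewrite !lt_min e1_gt0 a0 b0 c0.
  split=> [|x|x|x]; first by rewrite !ge_min lexx.
  - by rewrite !lt_min => /andP[/andP[_ h] _]; exact: aP.
  - by rewrite !lt_min => /andP[_ /andP[h _]]; exact: bP.
  - by rewrite !lt_min => /andP[_ /andP[_ h]]; exact: cP.
have [L0 g0L] := class_strict_diff r_pos oV0 V00 g0C.
have [Lg gL] := class_strict_diff r_pos oVg Vg0 gC.
(* the quadratic bound makes the derivative of the nonlinear term vanish *)
have [C [dC dC0 f0C]] : exists C : R, exists2 d : R, 0 < d &
    forall x, `|x| < d -> `|g0 x| <= C * `|x| ^+ 2.
  have /eqO_exP[C _ /nbhs_ballP[b /= b0 bP]] := f0_O2.
  exists C, (Num.min b d1); first by rewrite lt_min b0.
  move=> x; rewrite lt_min => /andP[xb xd].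
  rewrite g0E; [|exact: d1V0|exact: d1U].
  have := bP x; rewrite -ball_normE /= sub0r normrN => /(_ xb).
  by rewrite ger0_norm// sqr_ge0.
have L00 : L0 = 0 := strict_diff_quadratic dC0 f0C g0L.
have g00 : g0 0 = 0.
  have := f0C 0; rewrite normr0 expr0n mulr0 => /(_ dC0).
  by rewrite normr_le0 => /eqP.
pose F := field_pair A g0 g.
have F0 : F 0 = 0.
  by rewrite -{1}(@pair_col0 R N) /F field_pairE mulmx0 g00 scale0r !addr0.
have [J FJ JA] : exists2 J, strict_diff F 0 J & lsubmx J = A.
  have gL' : strict_diff g (pair_col 0 0) Lg by rewrite pair_col0.
  have [J FJ JE] := field_pair_strict_diff A g0L gL'.
  by exists J; [rewrite -(@pair_col0 R N)|rewrite JE L00 scale0r !addr0].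
have [S [al [ST al0 Slow Sdiss]]] := lyapunov_form A_stable.
have Au : A \in unitmx.
  apply: unitmx_of_injective => w Aw; have := Sdiss w.
  rewrite Aw mulmx0 mxE mulNr oppr_ge0 pmulr_rle0// => h.
  by apply/eqP; rewrite -normr_eq0 -sqrf_eq0 eq_le h sqr_ge0.
have [k k0 kP] := mulmx_bound (invmx A).
have [Cf Cf0 CfP] := form_bound S.
have [KJ KJ0 KJP] := mulmx_bound J.
(* the first bound on eps lets the form of A absorb the nonlinear part, the second
   keeps D_x F invertible near the origin *)
have [eps [eps0 epsal epsk]] : exists eps : R,
    [/\ 0 < eps, Cf * eps <= al / 2 & k * eps < 1].
  exists (Num.min (al / 2 / Cf) (2 * k)^-1); split.
  - by rewrite lt_min !divr_gt0// invr_gt0 mulr_gt0.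
  - by rewrite mulrC -ler_pdivlMr// ge_min lexx.
  - rewrite mulrC -ltr_pdivlMr// gt_min; apply/orP; right.
    by rewrite div1r ltf_pV2 ?posrE ?mulr_gt0// ltr_pMl// ltr1n.
have [d2 d20 Fd2] := FJ eps eps0.
pose d := Num.min d1 d2.
have d0 : 0 < d by rewrite lt_min d1_gt0.
have dd1 (y : R) : y < d -> y < d1 by rewrite lt_min => /andP[].
have Fd u v : `|u - 0| < d -> `|v - 0| < d ->
    `|F u - F v - J *m (u - v)| <= eps * `|u - v|.
  by rewrite !lt_min => /andP[_ ud] /andP[_ vd]; exact: Fd2.
have Ju : lsubmx J \in unitmx by rewrite JA.
have d2_gt0 : 0 < d / 2 by rewrite divr_gt0.
have [s [e2 [K [tau [/andP[s0 sd] e20 tauP tau_uniq tau_lip]]]]] :=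
  implicit_branch FJ F0 Ju d2_gt0.
have sd' : s < d by rewrite (le_lt_trans sd)// ltr_pdivrMr// mulr_natr mulr2n ltrDl.
pose e0 := Num.min e2 d.
have e0_gt0 : 0 < e0 by rewrite lt_min e20.
have e0e2 (e : R) : `|e| < e0 -> `|e| < e2 by rewrite lt_min => /andP[].
have e0d (e : R) : `|e| < e0 -> `|e| < d by rewrite lt_min => /andP[].
have de1 : d <= e1 by rewrite ge_min d1e.
have fieldE x e : `|x| < d -> 0 < e < e0 -> vector_field A f0 f1 e x = F (pair_col x e).
  move=> xd /andP[e_gt0 ee0].
  have ed : `|e| < d by apply: e0d; rewrite gtr0_norm.
  rewrite /F field_pairE g0E ?gE//; try exact/d1U/dd1; try exact/d1V0/dd1.
    by apply: d1Vg; apply: pair_col_norm_lt; exact: dd1.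
  by rewrite ltW//= (lt_le_trans _ de1)// -(gtr0_norm e_gt0).
(* the ball on which [implicit_branch] gives uniqueness serves as W *)
exists [set x : 'cV[R]_N | `|x| < s], e0, tau; split.
- apply/nbhs_ballP; exists s => // x; by rewrite -ball_normE /= sub0r normrN.
- by rewrite e0_gt0 ge_min de1 orbT.
- by apply/esym/tau_uniq; rewrite ?normr0 ?pair_col0// ltW.
- move=> e ee Fe; have /andP[e_gt0 elt] := ee.
  have en : `|e| < e0 by rewrite gtr0_norm.
  have [ts Ft] := tauP e (e0e2 _ en).
  have sU x : `|x| <= s -> U x by move=> xs; apply: d1U; apply: dd1; exact: le_lt_trans sd'.
  have FeE x : `|x| <= s -> Fe x = F (pair_col x e).
    by move=> xs; apply: fieldE => //; exact: le_lt_trans sd'.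
  split => //.
  + by split; [apply: sU; exact: ltW|rewrite FeE// ltW].
  + move=> p ps [Up Fp]; apply: tau_uniq; [exact: e0e2|exact: ltW|].
    by rewrite -FeE// ltW.
  have near (x : 'cV[R]_N) : `|x| <= s -> `|pair_col x e - 0| < d.
    by move=> xs; rewrite subr0 pair_col_norm_lt ?e0d// (le_lt_trans xs).
  have rem z w : `|z| <= s -> `|w| <= s ->
      `|Fe z - Fe w - A *m (z - w)| <= eps * `|z - w|.
    move=> zs ws; rewrite !FeE//; have := Fd _ _ (near z zs) (near w ws).
    rewrite pair_colB subrr mulmx_pair_col scale0r addr0 JA => /le_trans; apply.
    rewrite ler_pM2l// (le_trans (pair_col_norm_add _ _))// normr0 addr0//.
  have [KA KA0 KAP] := mulmx_bound A.
  apply: (@attracts_of_dissipative R N S al (al / (2 * Cf)) s (eps + KA)) => //.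
  + by rewrite divr_gt0// mulr_gt0.
  + by rewrite addr_ge0// ltW.
  + move=> z w zs ws.
    have -> : Fe z - Fe w = (Fe z - Fe w - A *m (z - w)) + A *m (z - w) by rewrite subrK.
    by rewrite (le_trans (ler_normD _ _))// mulrDl lerD// rem.
  + move=> z w zs ws.
    have -> : Fe z - Fe w = A *m (z - w) + (Fe z - Fe w - A *m (z - w)).
      by rewrite [RHS]addrC subrK.
    rewrite [leLHS]formDr.
    have h1 : form S (z - w) (A *m (z - w)) <= - al * `|z - w| ^+ 2 := Sdiss _.
    have h2 : form S (z - w) (Fe z - Fe w - A *m (z - w)) <= al / 2 * `|z - w| ^+ 2.
      rewrite (le_trans (ler_norm _))// (le_trans (CfP _ _))//.
      apply: (@le_trans _ _ (Cf * `|z - w| * (eps * `|z - w|))).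
        by rewrite ler_wpM2l ?rem// mulr_ge0// ltW.
      by rewrite mulrACA -expr2 ler_wpM2r ?sqr_ge0.
    have h3 : al / (2 * Cf) * form S (z - w) (z - w) <= al / 2 * `|z - w| ^+ 2.
      apply: (@le_trans _ _ (al / (2 * Cf) * (Cf * `|z - w| ^+ 2))).
        rewrite ler_wpM2l//; first by rewrite divr_ge0 ?mulr_ge0// ltW.
        by rewrite expr2 mulrA (le_trans (ler_norm _))// CfP.
      have Cfn0 : Cf != 0 by rewrite gt_eqF.
      by rewrite le_eqVlt; apply/orP; left; apply/eqP; field.
    apply: (le_trans (lerD h1 h2)); rewrite [leRHS]mulNr lerNr (le_trans h3)//.
    by move: (`|z - w| ^+ 2) => n2; clear; lra.
  + by rewrite FeE// ltW.
move=> z /= /andP[z0 ze]; exists [set z : 'cV[R]_1 | `|z 0 0| < e0], (fun z => tau (z 0 0)).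
split => //.
- exact: open_coord_ball.
- by rewrite /= ger0_norm.
apply: (@branch_class R N A g0 g V0 Vg e0 `|K| d k eps tau J) => //.
- exact: ltW.
- exact: ltW.
- by rewrite ge_min lexx orbT.
- by move=> x /dd1; exact: d1V0.
- by move=> x /dd1; exact: d1Vg.
- move=> w; rewrite JA; have := kP 1%N (A *m w); rewrite mulKmx//.
- by move=> e ee; have [ts _] := tauP e (e0e2 _ ee); exact: lt_trans sd'.
- by move=> e ee; have [_ Ft] := tauP e (e0e2 _ ee).
move=> e e' ee ee'; rewrite (le_trans (tau_lip e e' (e0e2 _ ee) (e0e2 _ ee')))//.
by rewrite ler_wpM2r// ler_norm.
Qed.
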